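(* There is an algorithm that takes as input an integer $n\in\mathbb{Z}_{\geq0}$ and an element $\alpha\in\overline{\mathbb{Z}}$ given by its minimal polynomial over $\mathbb{Q}$, and decides whether $q(\alpha)>4$ and, if so, computes $n$ distinct non-trivial decompositions $(\beta,\gamma)\in\mathrm{dec}(\alpha)$, each represented by the minimal polynomial of $\beta$ over $\mathbb{Z}[\alpha]$.
   Context: $\overline{\mathbb{Q}}$ is an algebraic closure of $\mathbb{Q}$ and $\overline{\mathbb{Z}}\subseteq\overline{\mathbb{Q}}$ is the ring of algebraic integers. $\overline{\mathbb{Q}}$ carries the inner product $\langle\alpha,\beta\rangle=\frac{1}{[\mathbb{Q}(\alpha,\beta):\mathbb{Q}]}\sum_{\sigma}\sigma(\alpha)\overline{\sigma(\beta)}$, where $\sigma$ ranges over all field embeddings $\mathbb{Q}(\alpha,\beta)\to\mathbb{C}$, and $q(\alpha)=\langle\alpha,\alpha\rangle$. A decomposition of $\alpha\in\overline{\mathbb{Z}}$ is a pair $(\beta,\gamma)\in\overline{\mathbb{Z}}^2$ with $\alpha=\beta+\gamma$ and $\langle\beta,\gamma\rangle\geq0$; $\mathrm{dec}(\alpha)$ is the set of decompositions of $\alpha$. It is non-trivial if $\beta\neq0$ and $\gamma\neq0$. Encodings: integers are encoded with length $O(\log|n|)$, rationals as pairs of integers (numerator, denominator), lists as nested pairs. An order (a commutative ring that is free and finitely generated as a $\mathbb{Z}$-module) is encoded by its rank $m$ and integers $(a_{ijk})_{1\leq i,j,k\leq m}$ with $e_ie_j=\sum_k a_{ijk}e_k$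 on the standard basis; a number field $K$ is represented by an order $R\subseteq K$ with $\mathbb{Q}R=K$; a polynomial is encoded by its degree and list of coefficients. The minimal polynomial of $\beta$ over $\mathbb{Z}[\alpha]$ means its monic minimal polynomial over the fraction field $\mathbb{Q}(\alpha)$ of $\mathbb{Z}[\alpha]$; it determines $\beta$ up to conjugation over $\mathbb{Q}(\alpha)$, and $(\beta,\alpha-\beta)\in\mathrm{dec}(\alpha)$ depends only on this conjugacy class. *)

(* Defs.v *)
From Stdlib Require Import BinNums.
From HB Require Import structures.
From mathcomp Require Import all_boot all_order all_algebra all_field.
From mathcomp Require Import boolp classical_sets fsbigop.

Set Implicit Arguments.
Unset Strict Implicit.
Unset Printing Implicit Defensive.

Import Order.TTheory GRing.Theory Num.Theory.
Local Open Scope ring_scope.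

(* Model of computation: Jones's WHILE language on binary trees, in point-free
   form.  A program is a partial function on trees; a program with several
   variables keeps them as nested pairs.  As in Jones, both projections of
   the empty tree are the empty tree, and a test succeeds on every nonempty
   tree. *)
Inductive tree : Type := Leaf | Node of tree & tree.

Definition left_tree (t : tree) : tree := if t is Node l _ then l else Leaf.
Definition right_tree (t : tree) : tree := if t is Node _ r then r else Leaf.

Inductive prog : Type :=
| PId
| PLeaf
| PLeft
| PRight
| PNode of prog & prog
| PSeq of prog & prog
| PIf of prog & prog & prog
| PWhile of prog & prog.

(* [eval p x y]: on input x, p halts with output y. *)
Inductive eval : prog -> tree -> tree -> Prop :=
| EvId x : eval PId x x
| EvLeaf x : eval PLeaf x Leaf
| EvLeft x : eval PLeft x (left_tree x)
| EvRight x : eval PRight x (right_tree x)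
| EvNode p1 p2 x y1 y2 :
    eval p1 x y1 -> eval p2 x y2 -> eval (PNode p1 p2) x (Node y1 y2)
| EvSeq p1 p2 x y z :
    eval p1 x y -> eval p2 y z -> eval (PSeq p1 p2) x z
| EvIfTrue c p1 p2 x l r y :
    eval c x (Node l r) -> eval p1 x y -> eval (PIf c p1 p2) x y
| EvIfFalse c p1 p2 x y :
    eval c x Leaf -> eval p2 x y -> eval (PIf c p1 p2) x y
| EvWhileStop c p x :
    eval c x Leaf -> eval (PWhile c p) x x
| EvWhileStep c p x l r y z :
    eval c x (Node l r) -> eval p x y -> eval (PWhile c p) y z ->
    eval (PWhile c p) x z.

Lemma eval_fun p x y z : eval p x y -> eval p x z -> y = z.
Proof.
move=> xy; elim: xy z => {p x y}.
- by move=> x z H; inversion H.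
- by move=> x z H; inversion H.
- by move=> x z H; inversion H.
- by move=> x z H; inversion H.
- move=> p1 p2 x y1 y2 _ IH1 _ IH2 z H; inversion H; subst.
  by congr Node; [apply: IH1 | apply: IH2].
- move=> p1 p2 x y w _ IH1 _ IH2 z H; inversion H; subst.
  by apply: IH2; rewrite (IH1 y0).
- move=> c p1 p2 x l r y _ IHc _ IH z H; inversion H; subst; first exact: IH.
  by have /(_ Leaf) := IHc; move=> /(_ ltac:(assumption)).
- move=> c p1 p2 x y _ IHc _ IH z H; inversion H; subst; last exact: IH.
  by have /(_ (Node l r)) := IHc; move=> /(_ ltac:(assumption)).
- move=> c p x _ IHc z H; inversion H; subst => //.
  by have /(_ (Node l r)) := IHc; move=> /(_ ltac:(assumption)).
- move=> c p x l r y w _ IHc _ IHp _ IHw z H; inversion H; subst.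
    by have /(_ Leaf) := IHc; move=> /(_ ltac:(assumption)).
  by apply: IHw; rewrite (IHp y0).
Qed.

Definition enc_bool (b : bool) : tree := if b then Node Leaf Leaf else Leaf.

Definition enc_seq (T : Type) (e : T -> tree) (s : seq T) : tree :=
  foldr (fun x t => Node (e x) t) Leaf s.

Definition enc_option (T : Type) (e : T -> tree) (o : option T) : tree :=
  if o is Some x then Node Leaf (e x) else Leaf.

(* Binary digits, least significant first, without the leading 1. *)
Fixpoint enc_pos (p : positive) : tree :=
  match p with
  | xH => Leaf
  | xO p' => Node (enc_bool false) (enc_pos p')
  | xI p' => Node (enc_bool true) (enc_pos p')
  end.

Definition enc_nat (n : nat) : tree :=
  if bin_of_nat n is Npos p then Node Leaf (enc_pos p) else Leaf.

Definition enc_int (z : int) : tree := Node (enc_bool (z < 0)) (enc_nat `|z|).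

Definition enc_rat (r : rat) : tree := Node (enc_int (numq r)) (enc_int (denq r)).

(* A nonzero polynomial, given by its sequence of coefficients. *)
Definition enc_poly (T : Type) (e : T -> tree) (cs : seq T) : tree :=
  Node (enc_int (size cs).-1) (enc_seq e cs).

(* [QQ s] is the number field Q(s) generated by the finite list s of algebraic
   numbers; [QQval] is its inclusion in algC and [QQgen i] is the element of
   Q(s) with value s`_i. *)
Definition QQ (s : seq algC) : fieldExtType rat := tag (num_field_exists s).

Definition QQval (s : seq algC) : {rmorphism QQ s -> algC} :=
  tag (tagged (num_field_exists s)).

Definition QQgen (s : seq algC) (i : nat) : QQ s :=
  (s2val (tagged (tagged (num_field_exists s))))`_i.

Lemma QQgenK (s : seq algC) (i : nat) : QQval s (QQgen s i) = s`_i.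
Proof.
rewrite /QQval /QQgen /QQ.
case: (num_field_exists s) => Qs [QsC [s1 /= defs _]].
have [lt_i | le_i] := ltnP i (size s1).
  by rewrite -(nth_map 0 0) // defs.
by rewrite !nth_default ?rmorph0 // -defs size_map.
Qed.

(* The field embeddings Q(s) -> C are the ring morphisms to algC, as they take
   algebraic values.  {classic _} equips their type with the (classical) choice
   structure needed to index a finite sum. *)
Definition embedding (s : seq algC) : choiceType :=
  {classic {rmorphism QQ s -> algC}}.

Definition emb_fun (s : seq algC) (sigma : embedding s) : QQ s -> algC :=
  (sigma : {rmorphism QQ s -> algC}).

Definition inner (alpha beta : algC) : algC :=
  let s := [:: alpha; beta] in
  (\dim {:QQ s})%:R^-1 *
  \sum_(sigma \in [set: embedding s])
     emb_fun sigma (QQgen s 0) * (emb_fun sigma (QQgen s 1))^*.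

Definition q (alpha : algC) : algC := inner alpha alpha.

Definition dec (alpha : algC) : set (algC * algC) :=
  [set d | [/\ d.1 \in Aint, d.2 \in Aint, alpha = d.1 + d.2
             & 0 <= inner d.1 d.2]].

Definition nontrivial_dec (d : algC * algC) : Prop := d.1 != 0 /\ d.2 != 0.

(* Coefficients of the minimal polynomial of beta over Q(alpha), each written
   as its vector of rational coordinates on the basis 1, alpha, ...,
   alpha^(d-1) of Z[alpha], where d is the degree of alpha. *)
Definition minpoly_over (alpha beta : algC) : seq (seq rat) :=
  let s := [:: alpha; beta] in
  let a := QQgen s 0 in
  let b := QQgen s 1 in
  let basis := [tuple a ^+ i | i < adjoin_degree 1%AS a] in
  [seq [seq coord basis i c | i <- enum 'I_(adjoin_degree 1%AS a)]
     | c <- polyseq (minPoly <<1; a>>%AS b)].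

Definition enc_input (n : nat) (f : {poly rat}) : tree :=
  Node (enc_int n) (enc_poly enc_rat f).

Definition enc_output (o : option (seq (seq (seq rat)))) : tree :=
  enc_option (enc_seq (enc_poly (enc_seq enc_rat))) o.

(* Main.v *)
From Stdlib Require Import BinNums.
From Corelib Require Import PosDef.
From HB Require Import structures.
Require Import Defs.
From mathcomp Require Import all_boot all_order all_fingroup all_algebra all_field.
From mathcomp Require Import boolp classical_sets fsbigop.
From mathcomp Require Import ring zify.

(** An algebraic integer [x] of degree [d] has [q x = S / d], where [S] is the sum
    of the [|a|^2] over the conjugates [a] of [x] ([q_conjugates]).  The algorithm
    searches through all binary trees for a certificate of [q x <= 4] or of
    [4 < q x] together with [n] decompositions.  Such a search is a program as
    soon as the test of a certificate is one ([search_program]); so it remains to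
    give certificates that are sound, that exist in all cases, and that can be
    tested with integer arithmetic only.

    _Comparing [q x] with 4._  If Gaussian rationals [z_1, ..., z_d] are pairwise
    more than [2 / E] apart and the minimal polynomial [f] of [x] satisfies
    [|f(z_i)| < E ^ -d], then they are within [1 / E] of the [d] distinct
    conjugates ([isolation_sum]), so that [S] is known up to [O(1 / E)].  This
    certifies strict inequalities.  For [S <= 4 d] one uses that [S - 4 d] is
    either 0 or not too small: it is one of the numbers
    [T_j = \sum_i a_i a_(j i) - 4 d], for the functions [j] from indices to
    indices, and the product of the nonzero [T_j] is a nonzero integer
    ([conjugates_norm_gap]).

    _Decompositions._  The pair [(b, x - b)] is a decomposition as soon as all
    conjugates of [2 b - x] have absolute value at most [sqrt (q x)], because
    [b (x - b)^* ] averages to a quarter of the average of [|x|^2 - |2 b - x|^2]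
    ([near_half_dec]).  If [4 < q x], there is a rational [rho > 2] with
    [rho ^ 2 <= q x], and one needs monic polynomials [g] over [Z[x]] all of
    whose roots, and those of its conjugates, are at distance less than
    [rho / 2 > 1] from half the conjugate of [x].  Since [rho / 2 > 1], the
    polynomial [(X - x / 2) ^ N] can be rounded to integral coefficients without
    leaving this disc, by the classical argument of Fekete and Szego: for [N]
    divisible enough the leading coefficients need no rounding, and the others
    weigh little against [|X - x / 2| ^ N] on the boundary of the disc
    ([good_tower_exists]).  One may moreover prescribe the rounded coefficients
    modulo [p ^ 2].  Take for [p] a prime that divides some value [f(k)] exactly
    once ([exact_prime_value]), make the constant coefficient congruent to
    [x - k], and the others except the first to 0.  Then [g] is irreducible over
    [Q(x)] by a version of Eisenstein's criterion which uses only norms to the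
    integers ([Eisenstein_over]); so the coordinates of its coefficients on the
    powers of [x] are the required description of its roots ([minpoly_overE]).
    Towers of different degrees [N] give different decompositions. *)

Set Implicit Arguments.
Unset Strict Implicit.
Unset Printing Implicit Defensive.
Import Order.TTheory GRing.Theory Num.Theory.
Local Open Scope ring_scope.

(** * Conjugates and automorphisms of algebraic numbers *)

(** Adjoining all conjugates of [x] gives a normal field, to which the
    isomorphism [Q(x) -> Q(y)] extends; from there it extends to all algebraic
    numbers. *)
Lemma conjugate_aut (x y : algC) : root (minCpoly x) y ->
  exists tau : {rmorphism algC -> algC}, tau x = y.
Proof.
have [p [Dp mon_p] dv_p] := minCpolyP x; rewrite Dp => py0.
have px0 : root (map_poly ratr p) x by rewrite dv_p.
have [r Dr] := closed_field_poly_normal (map_poly ratr p : {poly algC}).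
rewrite lead_coef_map (monicP mon_p) rmorph1 scale1r in Dr.
have [L [LC [rr Drr genL]]] := num_field_exists r.
have Linj q : map_poly LC (map_poly (in_alg L) q) = map_poly ratr q.
  rewrite -map_poly_comp; apply: eq_map_poly => a.
  by rewrite /= rmorphZ_num rmorph1 mulr1.
have lift z : root (map_poly ratr p) z -> exists2 zz, zz \in rr & LC zz = z.
  rewrite Dr root_prod_XsubC -Drr => /mapP[zz rzz ->]; by exists zz.
have [xx rxx Dx] := lift _ px0; have [yy ryy Dy] := lift _ py0.
pose pr := map_poly (in_alg L) p.
have Qpr : pr \is a polyOver 1%VS.
  by apply/polyOverP=> i; rewrite coef_map memvZ ?memv_line.
have irr : minPoly 1 xx %= pr.
  have : minPoly 1 xx %| pr.
    rewrite minPoly_dvdp //; last by rewrite -(fmorph_root LC) Linj Dx.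
  move=> dv1; rewrite /eqp dv1 /=.
  have /polyOver1P [m Dm] := minPolyOver 1%VS xx.
  have : p %| m by rewrite -dv_p -Linj -Dx -Dm fmorph_root root_minPoly.
  by rewrite Dm dvdp_map.
pose phi := kHomExtend 1 \1 xx yy.
have hom1 : kHom 1 1 (\1%VF : 'End(L)) by rewrite kHom1.
have rootyy : root (map_poly \1%VF (minPoly 1 xx)) yy.
  rewrite (_ : map_poly _ _ = minPoly 1 xx).
    by rewrite (eqp_root irr) -(fmorph_root LC) Linj Dy.
  by apply/polyP=> i; rewrite coef_map /= id_lfunE.
have hphi : kHom 1 <<1; xx>> phi by exact: kHomExtendP.
have splitL : splittingFieldFor <<1; xx>> pr fullv.
  apply: splittingFieldForS (sub1v _) (subvf _) _; exists rr => //.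
  congr (_ %= _): (eqpxx pr); apply/(map_poly_inj LC).
  rewrite Linj Dr -Drr big_map rmorph_prod /=; apply: eq_bigr => zz _.
  by rewrite map_polyXsubC.
have [f1 aut_f1 Df1] := kHom_extends (sub1v _) hphi Qpr splitL.
pose f1mM := GRing.isMonoidMorphism.Build _ _ f1 (kHom_monoid_morphism aut_f1).
pose nu : {lrmorphism _ -> _} := HB.pack (fun_of_lfun f1) f1mM.
have [tau Dtau] := extend_algC_subfield_aut LC nu.
exists tau; rewrite -Dx -Dtau -Dy; congr (LC _).
by rewrite /= -Df1 ?memv_adjoin // (kHomExtend_val hom1).
Qed.

Lemma minCpoly_irreducible (x : algC) (p : {poly rat}) :
  minCpoly x = map_poly ratr p -> irreducible_poly p.
Proof.
have [r [Dr mon_r] dv_r] := minCpolyP x; rewrite Dr => /map_poly_inj <-.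
have rx0 : root (map_poly ratr r) x by rewrite dv_r.
apply/(subfx_irreducibleP rx0 (monic_neq0 mon_r)) => q qx0 nzq.
by rewrite dvdp_leq // -dv_r.
Qed.

Lemma irreducible_separable (p : {poly rat}) :
  irreducible_poly p -> separable_poly p.
Proof.
move=> irr_p; have sp := irr_p.1.
have p'0 : p^`() != 0.
  apply/eqP => /(congr1 (fun q : {poly rat} => q`_(size p).-2)).
  rewrite coef_deriv coef0 => /eqP.
  rewrite prednK; last by case: (size p) sp => [|[]].
  rewrite -lead_coefE mulrn_eq0 lead_coef_eq0 -size_poly_eq0.
  by case: (size p) sp => [|[]].
rewrite separable_poly.unlock irreducible_poly_coprime //.
apply/negP=> /(dvdp_leq p'0).
by rewrite leqNgt lt_size_deriv // -size_poly_eq0 -lt0n ltnW.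
Qed.

Lemma minCpoly_separable (x : algC) : separable_poly (minCpoly x).
Proof.
have [p [Dp _] _] := minCpolyP x.
by rewrite Dp separable_map; apply/irreducible_separable/minCpoly_irreducible/Dp.
Qed.

Definition conjugates (x : algC) : seq algC :=
  sval (closed_field_poly_normal (minCpoly x)).

Lemma minCpoly_conjugates (x : algC) :
  minCpoly x = \prod_(z <- conjugates x) ('X - z%:P).
Proof.
rewrite /conjugates; case: closed_field_poly_normal => r /= Dr.
by rewrite (monicP (minCpoly_monic x)) scale1r in Dr.
Qed.

Lemma mem_conjugates (x z : algC) : (z \in conjugates x) = root (minCpoly x) z.
Proof. by rewrite minCpoly_conjugates root_prod_XsubC. Qed.

Lemma conjugates_self x : x \in conjugates x.
Proof. by rewrite mem_conjugates root_minCpoly. Qed.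

Lemma conjugates_uniq (x : algC) : uniq (conjugates x).
Proof.
by rewrite -separable_prod_XsubC -minCpoly_conjugates minCpoly_separable.
Qed.

Lemma size_conjugates (x : algC) : size (conjugates x) = (size (minCpoly x)).-1.
Proof. by rewrite minCpoly_conjugates size_prod_XsubC. Qed.

Lemma conjugates_aut (tau : {rmorphism algC -> algC}) (x z : algC) :
  (tau z \in conjugates x) = (z \in conjugates x).
Proof.
rewrite !mem_conjugates -(fmorph_root tau _ z).
have [p [-> _] _] := minCpolyP x.
rewrite -map_poly_comp (@eq_map_poly _ _ _ ratr) // => a /=.
by rewrite fmorph_rat.
Qed.

Lemma perm_conjugates (tau : {rmorphism algC -> algC}) (x : algC) :
  perm_eq (map tau (conjugates x)) (conjugates x).
Proof.
have u := conjugates_uniq x.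
have ut : uniq (map tau (conjugates x)) by rewrite map_inj_uniq //; exact: fmorph_inj.
apply: uniq_perm => //; have sub : {subset map tau (conjugates x) <= conjugates x}.
  by move=> _ /mapP[z xz ->]; rewrite conjugates_aut.
by have [] := uniq_min_size ut sub _; rewrite ?size_map.
Qed.

(** A separable minimal polynomial with a single root is linear. *)
Lemma aut_fixed_rat (x : algC) :
  (forall tau : {rmorphism algC -> algC}, tau x = x) -> x \in Crat.
Proof.
move=> fix_x; have [p [Dp mon_p] dv_p] := minCpolyP x.
have rx z : z \in conjugates x -> z = x.
  by rewrite mem_conjugates => /conjugate_aut[tau <-].
have : size (conjugates x) = 1%N.
  have := conjugates_uniq x; have := conjugates_self x.
  case: (conjugates x) rx => [|y [|z s]] // rx _ /andP[/negP[]].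
  have -> : y = x by apply: rx; rewrite inE eqxx.
  have -> : z = x by apply: rx; rewrite !inE eqxx orbT.
  by rewrite inE eqxx.
rewrite size_conjugates; move: (root_minCpoly x) (minCpoly_monic x); rewrite Dp size_map_poly.
move=> px0 _; case sp : (size p) => [|[|[|n]]] // _.
move: px0; rewrite rootE horner_coef size_map_poly sp big_ord_recl big_ord1 /=.
rewrite !coef_map /= expr0 mulr1 expr1 (_ : p`_1 = 1) ?rmorph1 ?mul1r.
  by rewrite addr_eq0 => /eqP e; rewrite -[x]opprK -e -rmorphN /= Crat_rat.
by move/monicP: mon_p; rewrite lead_coefE sp.
Qed.

Lemma aut_fixed_int (x : algC) : x \in Aint ->
  (forall tau : {rmorphism algC -> algC}, tau x = x) -> x \in Num.int.
Proof. by move=> Ax fx; apply: Cint_rat_Aint Ax; apply: aut_fixed_rat. Qed.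

(** * Embeddings of a number field *)

Lemma rmorphism_ext (R S : nzRingType) (f g : {rmorphism R -> S}) : f =1 g -> f = g.
Proof.
case: f g => [f [[af] [mf]]] [g [[ag] [mg]]] /= /funext e.
move: af mf ag mg; rewrite e => af mf ag mg.
by rewrite (Prop_irrelevance af ag) (Prop_irrelevance mf mg).
Qed.

Lemma field_generator (L : fieldExtType rat) :
  exists t : L, <<1; t>>%VS = fullv.
Proof.
have [t Dt] : exists t : L, <<1 & vbasis {:L}>>%VS = <<1; t>>%VS.
  elim/last_ind: (tval (vbasis {: L})) => [|l x [t IHt]].
    by exists 0; rewrite Fadjoin_nil (Fadjoin_idP _) ?rpred0.
  have [|z Dz _] := @strong_Primitive_Element_Theorem _ L 1%AS x t.
    by apply: pcharf0_separable => p; rewrite pchar_lalg pchar_num.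
  by exists z; rewrite adjoin_rcons IHt.
exists t; rewrite -Dt; apply/eqP; rewrite eqEsubv subvf /=.
rewrite -{1}(span_basis (vbasisP {:L})); apply/span_subvP => x.
exact: seqv_sub_adjoin.
Qed.

Lemma minCpoly_QQval (s : seq algC) (x : QQ s) :
  minCpoly (QQval s x) = map_poly (QQval s) (minPoly 1 x).
Proof.
have [p [Dp mon_p] dv_p] := minCpolyP (QQval s x).
have /polyOver1P[m Dm] := minPolyOver 1%VS x.
have DC r : map_poly (QQval s) (map_poly (in_alg (QQ s)) r) = map_poly ratr r.
  rewrite -map_poly_comp; apply: eq_map_poly => a.
  by rewrite /= rmorphZ_num rmorph1 mulr1.
have eqpm : p %= m.
  rewrite /eqp -dv_p -(dvdp_map (in_alg (QQ s))) -Dm.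
  rewrite -DC fmorph_root -Dm root_minPoly /=.
  rewrite minPoly_dvdp //; first by apply/polyOverP=> i; rewrite coef_map memvZ ?memv_line.
  by rewrite -(fmorph_root (QQval s)) DC dv_p.
have mon_m : m \is monic.
  by rewrite -(map_monic (in_alg (QQ s))) -Dm monic_minPoly.
by rewrite Dp Dm DC; move: eqpm; rewrite eqp_monic // => /eqP->.
Qed.

Lemma embedding_on_poly (s : seq algC) (t : QQ s) (p : {poly QQ s}) (u : embedding s) :
  p \is a polyOver 1%VS -> emb_fun u p.[t] = (map_poly (QQval s) p).[emb_fun u t].
Proof.
have E (w : {rmorphism QQ s -> algC}) (a : rat) : w a%:A = ratr a.
  by rewrite alg_num_field fmorph_rat.
rewrite /emb_fun => Qp; rewrite -horner_map; congr _.[_].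
apply/polyP=> i; rewrite !coef_map.
have /vlineP[a ->] : p`_i \in 1%VS by apply: polyOverP.
by rewrite [RHS]E [LHS]E.
Qed.

Lemma emb_root (s : seq algC) (u : embedding s) (x : QQ s) :
  emb_fun u x \in conjugates (QQval s x).
Proof.
rewrite mem_conjugates minCpoly_QQval rootE -embedding_on_poly ?minPolyOver //.
have /eqP -> := root_minPoly 1 x.
by rewrite /emb_fun rmorph0.
Qed.

Definition emb_comp (s : seq algC) (tau : {rmorphism algC -> algC})
  (u : embedding s) : embedding s :=
  (tau \o (u : {rmorphism QQ s -> algC}) : {rmorphism QQ s -> algC}).

Definition emb_incl (s : seq algC) : embedding s := QQval s.

Lemma emb_ext (s : seq algC) (t : QQ s) : <<1; t>>%VS = fullv ->
  forall u v : embedding s, emb_fun u t = emb_fun v t -> u = v.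
Proof.
move=> gen u v e; apply: rmorphism_ext => x.
have /Fadjoin_polyP[p Qp ->] : x \in <<1; t>>%VS by rewrite gen memvf.
by rewrite -!/(emb_fun _ _) !embedding_on_poly // e.
Qed.

(** An embedding is determined by its value at a primitive element, and this value
    can be any conjugate; thus there are as many embeddings as the degree. *)
Lemma embeddings_enum (s : seq algC) :
  exists r : seq (embedding s),
    [/\ uniq r, forall u, u \in r & size r = \dim {:QQ s}].
Proof.
have [t gen] := field_generator (QQ s).
have /choice [g Dg] : forall z : algC, exists u : embedding s,
    z \in conjugates (QQval s t) -> emb_fun u t = z.
  move=> z; have [|] := boolP (z \in conjugates (QQval s t)); last by exists (emb_incl s).
  by rewrite mem_conjugates => /conjugate_aut [tau <-]; exists (emb_comp tau (emb_incl s)).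
exists (map g (conjugates (QQval s t))); split.
- rewrite map_inj_in_uniq ?conjugates_uniq // => z w zt wt e.
  by rewrite -(Dg z zt) -(Dg w wt) e.
- move=> u; apply/mapP; exists (emb_fun u t); first exact: emb_root.
  by apply: (emb_ext gen); rewrite Dg ?emb_root.
rewrite size_map size_conjugates minCpoly_QQval size_map_poly size_minPoly /=.
by have := dim_Fadjoin 1%AS t; rewrite dimv1 muln1 [X in \dim X]gen => ->.
Qed.

Definition embeddings (s : seq algC) : seq (embedding s) :=
  sval (cid (embeddings_enum s)).

Lemma mem_embeddings s u : u \in embeddings s.
Proof. by rewrite /embeddings; case: cid => r /= []. Qed.
Lemma embeddings_uniq s : uniq (embeddings s).
Proof. by rewrite /embeddings; case: cid => r /= []. Qed.
Lemma size_embeddings s : size (embeddings s) = \dim {:QQ s}.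
Proof. by rewrite /embeddings; case: cid => r /= []. Qed.

Lemma sum_embeddings s (F : embedding s -> algC) :
  \sum_(u \in [set: embedding s]) F u = \sum_(u <- embeddings s) F u.
Proof.
rewrite [RHS]fsbig_seq ?embeddings_uniq //.
suff -> : [set: embedding s]%classic = [set` embeddings s]%classic by [].
by apply/seteqP; split=> u //= _; exact: mem_embeddings.
Qed.

(** Composition with an automorphism permutes the embeddings. *)
Lemma sum_emb_comp s (tau : {rmorphism algC -> algC}) (F : embedding s -> algC) :
  \sum_(u <- embeddings s) F (emb_comp tau u) = \sum_(u <- embeddings s) F u.
Proof.
rewrite -(big_map (emb_comp tau) xpredT F); apply: perm_big.
have ui : uniq (map (emb_comp tau) (embeddings s)).
  rewrite map_inj_uniq ?embeddings_uniq // => u v e; apply: rmorphism_ext => x.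
  apply: (fmorph_inj tau).
  by move/(congr1 (fun w : embedding s => emb_fun w x)): e.
apply: uniq_perm => //; first exact: embeddings_uniq.
by have [] := uniq_min_size ui (fun u _ => mem_embeddings u) _; rewrite ?size_map.
Qed.

(** Composing with an automorphism that moves one conjugate of [x] to another
    matches up the embeddings taking these two values at [x]; so every conjugate
    is taken equally often. *)
Lemma sum_embeddings_conjugates s (x : QQ s) (F : algC -> algC) :
  (\dim {:QQ s})%:R^-1 * \sum_(u <- embeddings s) F (emb_fun u x) =
  (size (conjugates (QQval s x)))%:R^-1 * \sum_(a <- conjugates (QQval s x)) F a.
Proof.
set c := conjugates _.
pose m : algC := \sum_(u <- embeddings s) (emb_fun u x == QQval s x)%:R.
have fib a : a \in c -> \sum_(u <- embeddings s) (emb_fun u x == a)%:R = m.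
  rewrite mem_conjugates => /conjugate_aut[tau Dtau].
  rewrite -(sum_emb_comp tau); apply: eq_bigr => u _.
  by rewrite -Dtau /emb_fun /= (inj_eq (fmorph_inj tau)).
have key G : \sum_(u <- embeddings s) G (emb_fun u x) = m * \sum_(a <- c) G a.
  transitivity (\sum_(u <- embeddings s) \sum_(a <- c) (emb_fun u x == a)%:R * G a).
    apply: eq_bigr => u _.
    rewrite (bigD1_seq (emb_fun u x)) ?emb_root ?conjugates_uniq //= eqxx mul1r.
    by rewrite big1 ?addr0 // => a; rewrite eq_sym => /negPf ->; rewrite mul0r.
  rewrite exchange_big /= mulr_sumr !big_seq; apply: eq_bigr => a ca.
  by rewrite -mulr_suml fib.
have := key (fun=> 1); rewrite !big_const_seq !iter_addr_0 !count_predT.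
rewrite size_embeddings => e; rewrite key (_ : _%:R = m * (size c)%:R) //.
have c0 : (size c)%:R != 0 :> algC.
  rewrite pnatr_eq0; have := conjugates_self (QQval s x); rewrite -/c.
  by case: (c).
have m0 : m != 0.
  apply: contraTneq (adim_gt0 {:QQ s}%AS) => m0.
  by move: e; rewrite m0 mul0r => /eqP; rewrite -mulr_natr mul1r pnatr_eq0 lt0n => ->.
by rewrite invfM mulrACA mulVf // mul1r.
Qed.

Lemma q_conjugates (x : algC) :
  q x = (size (conjugates x))%:R^-1 * \sum_(a <- conjugates x) `|a| ^+ 2.
Proof.
have [e0 e1] : QQval [:: x; x] (QQgen [:: x; x] 0) = x /\
               QQval [:: x; x] (QQgen [:: x; x] 1) = x by rewrite !QQgenK.
have e : QQgen [:: x; x] 1 = QQgen [:: x; x] 0.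
  by apply: (fmorph_inj (QQval [:: x; x])); rewrite e1 e0.
rewrite /q /inner sum_embeddings e.
under eq_bigr do rewrite -normCK.
by rewrite (sum_embeddings_conjugates _ (fun a => `|a| ^+ 2)) e0.
Qed.

(** With [x = b + c] and [z = b - c], the sum of [u b * conj (u c)] is a quarter
    of the sum of [|u x|^2 - |u z|^2]: the cross terms cancel between complex
    conjugate embeddings. *)
Lemma near_half_dec (alpha beta : algC) :
    alpha \in Aint -> beta \in Aint ->
    (forall tau : {rmorphism algC -> algC},
       `|tau (beta *+ 2 - alpha)| ^+ 2 <= q alpha) ->
  dec alpha (beta, alpha - beta).
Proof.
move=> Aa Ab near; split=> //=; [by rewrite rpredB | by rewrite addrC subrK |].
rewrite /inner sum_embeddings; set s := [:: beta; _].
set b := QQgen s 0; set c := QQgen s 1.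
have [eb ec] : QQval s b = beta /\ QQval s c = alpha - beta by rewrite !QQgenK.
pose x := b + c; pose z := b - c.
have ex : QQval s x = alpha by rewrite rmorphD /= eb ec addrC subrK.
have ez : QQval s z = beta *+ 2 - alpha.
  by rewrite rmorphB /= eb ec opprB addrA mulr2n.
(* The sum of the cross terms changes sign under complex conjugation. *)
have V0 : \sum_(u <- embeddings s)
    (emb_fun u z * (emb_fun u x)^* - emb_fun u x * (emb_fun u z)^*) = 0.
  set V := \sum_(u <- _) _.
  have : V = - V.
    rewrite {1}/V -(sum_emb_comp (Num.conj : {rmorphism algC -> algC})) /V -sumrN.
    apply: eq_bigr => u _; rewrite /emb_fun /=.
    rewrite !conjCK; ring.
  by move/eqP; rewrite eq_sym -subr_eq0 -opprD oppr_eq0 -mulr2n mulrn_eq0 /= => /eqP.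
have -> : \sum_(u <- embeddings s) emb_fun u b * (emb_fun u c)^* =
    4^-1 * (\sum_(u <- embeddings s) `|emb_fun u x| ^+ 2
            - \sum_(u <- embeddings s) `|emb_fun u z| ^+ 2).
  apply/(canRL (mulKf _)); first by rewrite pnatr_eq0.
  rewrite -[RHS]addr0 -[X in _ = _ + X]V0 -sumrB -big_split /= mulr_sumr; apply: eq_bigr => u _.
  rewrite !normCK /emb_fun !(rmorphD, rmorphB) /=; ring.
rewrite mulrCA mulr_ge0 ?invr_ge0 ?ler0n // mulrBr subr_ge0.
rewrite (sum_embeddings_conjugates x (fun a => `|a| ^+ 2)) ex -q_conjugates.
have D0 : 0 < (\dim {:QQ s})%:R :> algC by rewrite ltr0n adim_gt0.
rewrite mulrC ler_pdivrMr // -size_embeddings mulr_natr -iter_addr_0.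
rewrite -(count_predT (embeddings s)) -big_const_seq; apply: ler_sum => u _.
have := emb_root u z; rewrite mem_conjugates => /conjugate_aut[tau <-].
by rewrite ez.
Qed.

(** * A gap for the mean square of the conjugates *)

Lemma conj_conjugates (x a : algC) : (a^* \in conjugates x) = (a \in conjugates x).
Proof. exact: (conjugates_aut (Num.conj : {rmorphism algC -> algC})). Qed.

Lemma conjugates_Aint (x a : algC) : x \in Aint -> a \in conjugates x -> a \in Aint.
Proof.
by move=> Ax; rewrite mem_conjugates => /conjugate_aut[tau <-]; rewrite Aint_aut.
Qed.

Lemma aut_permutes_conjugates (tau : {rmorphism algC -> algC}) (x : algC) :
  exists s : {perm 'I_(size (conjugates x))},
    forall i : 'I__, tau (conjugates x)`_i = (conjugates x)`_(s i).
Proof.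
set c := conjugates x.
have idx_lt (i : 'I_(size c)) : (index (tau c`_i)%R c < size c)%N.
  by rewrite index_mem conjugates_aut mem_nth.
pose s0 i := Ordinal (idx_lt i).
have s0P i : c`_(s0 i) = tau c`_i by rewrite nth_index ?conjugates_aut ?mem_nth.
have s0I : injective s0.
  move=> i j /(congr1 (fun k : 'I__ => c`_k)); rewrite !s0P => /fmorph_inj /eqP.
  by rewrite nth_uniq ?conjugates_uniq // => /eqP/val_inj.
by exists (perm s0I) => i; rewrite permE s0P.
Qed.

(** The sums [T_j = \sum_i a_i a_(j i) - 4 d] over all functions [j] are permuted
    by the Galois group, so the product of the nonzero ones is a nonzero
    integer.  The sum of the [|a|^2] occurs, as complex conjugation permutes the
    conjugates; so it cannot be close to [4 d] without being equal to it. *)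
Lemma conjugates_norm_gap (x : algC) (B : nat) :
    let c := conjugates x in let d := size c in
    x \in Aint -> {in c, forall a, `|a| <= B%:R} ->
    \sum_(a <- c) `|a| ^+ 2 != (4 * d)%:R ->
  1 <= `|\sum_(a <- c) `|a| ^+ 2 - (4 * d)%:R| * (d * B ^ 2 + 4 * d)%:R ^+ (d ^ d).
Proof.
move=> c d Ax leB neq.
pose T (j : {ffun 'I_d -> 'I_d}) : algC := \sum_(i < d) c`_i * c`_(j i) - (4 * d)%:R.
set M := (_ + _)%N.
have d0 : (0 < d)%N by rewrite /d /c; case: conjugates (conjugates_self x).
have M1 : 1 <= M%:R :> algC.
  by rewrite ler1n /M addn_gt0 orbC muln_gt0 d0.
have leM j : `|T j| <= M%:R.
  apply: (le_trans (ler_normB _ _)); rewrite normr_nat /M natrD lerD2r.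
  apply: (le_trans (ler_norm_sum _ _ _)).
  rewrite natrM natrX mulrC -[d in _ * d%:R]card_ord -sum1_card natr_sum mulr_sumr.
  apply: ler_sum => i _; rewrite mulr1 normrM expr2.
  by apply: ler_pM; rewrite ?normr_ge0 ?leB ?mem_nth.
pose E := \prod_(j | T j != 0) T j.
have AE : E \in Aint.
  apply: rpred_prod => j _; rewrite rpredB ?rpred_nat //.
  have Ac (i : 'I_d) : c`_i \in Aint by apply: (conjugates_Aint Ax); apply: mem_nth.
  by apply: rpred_sum => i _; apply: rpredM; apply: Ac.
have fixE (tau : {rmorphism algC -> algC}) : tau E = E.
  have [s Ds] := aut_permutes_conjugates tau x.
  pose h (j : {ffun 'I_d -> 'I_d}) := [ffun i => s (j ((s^-1)%g i))].
  pose h' (j : {ffun 'I_d -> 'I_d}) := [ffun i => (s^-1)%g (j (s i))].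
  have hK : cancel h h' by move=> j; apply/ffunP=> i; rewrite !ffunE !permK.
  have h'K : cancel h' h by move=> j; apply/ffunP=> i; rewrite !ffunE !permKV.
  have Th j : tau (T j) = T (h j).
    rewrite rmorphB rmorph_nat rmorph_sum /= /T; congr (_ - _).
    rewrite [RHS](reindex_inj (@perm_inj _ s)) /=; apply: eq_bigr => i _.
    by rewrite rmorphM /= !Ds ffunE permK.
  rewrite /E rmorph_prod [RHS](reindex h); last by exists h' => j _.
  apply: eq_big => j; last by rewrite Th.
  by rewrite -Th fmorph_eq0.
have E0 : E != 0 by apply/prodf_neq0 => j.
have E1 : 1 <= `|E|.
  by rewrite norm_intr_ge1 ?aut_fixed_int.
have [j0 Dj0] : exists j0, T j0 = \sum_(a <- c) `|a| ^+ 2 - (4 * d)%:R.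
  have idx_lt (i : 'I_d) : (index ((c`_i)^*)%R c < d)%N.
    by rewrite index_mem conj_conjugates mem_nth.
  exists [ffun i => Ordinal (idx_lt i)]; congr (_ - _).
  rewrite (big_nth 0) big_mkord; apply: eq_bigr => i _.
  by rewrite ffunE /= nth_index ?conj_conjugates ?mem_nth // normCK.
rewrite -Dj0; apply: (le_trans E1).
rewrite /E (bigD1 j0) /=; last by rewrite Dj0 subr_eq0.
rewrite normrM ler_wpM2l ?normr_ge0 // normr_prod.
apply: (@le_trans _ _ (\prod_(j | (T j != 0) && (j != j0)) M%:R)).
  by apply: ler_prod => j _; rewrite normr_ge0 leM.
rewrite prodr_const ler_weXn2l //.
by apply: leq_trans (max_card _) _; rewrite card_ffun card_ord.
Qed.

(** * Isolating the conjugates by Gaussian rationals *)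

Definition gauss_mul (z w : int * int) : int * int :=
  (z.1 * w.1 - z.2 * w.2, z.1 * w.2 + z.2 * w.1).
Definition gauss_exp (z : int * int) (n : nat) : int * int :=
  iter n (gauss_mul z) (1, 0).
Definition gauss_norm (z : int * int) : int := z.1 * z.1 + z.2 * z.2.

(** [m ^ deg * f (z / m)], for the polynomial with coefficients [fs]. *)
Definition gauss_eval (fs : seq int) (m : nat) (z : int * int) : int * int :=
  (\sum_(0 <= i < size fs) fs`_i * (gauss_exp z i).1 * m%:Z ^+ ((size fs).-1 - i),
   \sum_(0 <= i < size fs) fs`_i * (gauss_exp z i).2 * m%:Z ^+ ((size fs).-1 - i)).

(** For a monic polynomial of degree [d], the last condition puts a root at
    distance less than [1 / E] from each [z / m]; by the other one, which keeps
    these points more than [2 / E] apart, these roots are distinct. *)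
Definition isolates (fs : seq int) (E m : nat) (zs : seq (int * int)) : bool :=
  let d := (size fs).-1 in
  let z i := nth (0, 0) zs i in
  [&& (0 < E)%N, (0 < m)%N, size zs == d,
      all (fun i => all (fun j => (i == j) ||
        (4 * (m%:Z * m%:Z) < E%:Z * E%:Z *
           gauss_norm ((z i).1 - (z j).1, (z i).2 - (z j).2)))
        (iota 0 d)) (iota 0 d)
    & all (fun w => gauss_norm (gauss_eval fs m w) * (E%:Z ^+ d * E%:Z ^+ d)
             < m%:Z ^+ d * m%:Z ^+ d) zs].

Definition gaussC (z : int * int) : algC := z.1%:~R + 'i * z.2%:~R.

Lemma gaussC_mul z w : gaussC (gauss_mul z w) = gaussC z * gaussC w.
Proof.
rewrite /gaussC /gauss_mul /= rmorphB rmorphD !rmorphM /=.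
have := @sqrCi algC; rewrite expr2 => e; ring: e.
Qed.

Lemma gaussC_exp z n : gaussC (gauss_exp z n) = gaussC z ^+ n.
Proof.
elim: n => [|n IHn]; first by rewrite expr0 /gaussC mulr0 addr0.
by rewrite /gauss_exp iterS gaussC_mul IHn exprS.
Qed.

Lemma gaussC_norm z : `|gaussC z| ^+ 2 = (gauss_norm z)%:~R.
Proof.
rewrite /gaussC /gauss_norm rmorphD !rmorphM /= normC2_rect ?Rreal_int //.
Qed.

Lemma gaussC_sub (z w : int * int) :
  gaussC (z.1 - w.1, z.2 - w.2) = gaussC z - gaussC w.
Proof. by rewrite /gaussC /= !rmorphB /=; ring. Qed.

Definition intpoly (fs : seq int) : {poly algC} := map_poly intr (Poly fs).

Lemma horner_intpoly fs (x : algC) :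
  (intpoly fs).[x] = \sum_(0 <= i < size fs) (fs`_i)%:~R * x ^+ i.
Proof.
rewrite (@horner_coef_wide _ (size fs)).
  rewrite big_mkord; apply: eq_bigr => i _.
  by rewrite coef_map coef_Poly.
by rewrite (leq_trans (size_poly _ _)) // size_Poly.
Qed.

Lemma gaussC_eval fs m z : (0 < m)%N ->
  gaussC (gauss_eval fs m z) =
  m%:R ^+ (size fs).-1 * (intpoly fs).[gaussC z / m%:R].
Proof.
move=> m0; have m0' : m%:R != 0 :> algC by rewrite pnatr_eq0 -lt0n.
rewrite horner_intpoly /gauss_eval /gaussC /= !rmorph_sum /= !mulr_sumr -big_split /=.
rewrite !big_nat; apply: eq_bigr => i /= lei.
rewrite !rmorphM !rmorphXn /= -!mulrA.
have -> : (m%:R ^+ (size fs).-1 : algC) = m%:R ^+ ((size fs).-1 - i) * m%:R ^+ i.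
  by rewrite -exprD subnK // -ltnS prednK // (leq_ltn_trans _ lei).
rewrite expr_div_n -(gaussC_exp z i) /gaussC -!pmulrn.
have mi0 : m%:R ^+ i != 0 :> algC by rewrite expf_neq0.
by field.
Qed.

(** Cauchy's bound on the roots of a monic polynomial. *)
Definition root_bound (fs : seq int) : nat := (\sum_(c <- fs) `|c|%N).+1.

(** The condition on the sizes excludes trailing zeros. *)
Definition minpoly_coefs (fs : seq int) (x : algC) : Prop :=
  intpoly fs = minCpoly x /\ size fs = size (minCpoly x).

Section MinpolyCoefs.
Context (fs : seq int) (x : algC) (fsx : minpoly_coefs fs x).
Let d := (size fs).-1.

Lemma minpoly_coefs_degree : size (conjugates x) = d.
Proof. by rewrite size_conjugates -fsx.2. Qed.

Lemma minpoly_coefs_size : size fs = d.+1.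
Proof. by rewrite /d fsx.2 prednK // (leq_trans _ (size_minCpoly x)). Qed.

Lemma minpoly_coefs_degree_gt0 : (0 < d)%N.
Proof. by rewrite /d -ltnS -minpoly_coefs_size fsx.2 size_minCpoly. Qed.

Lemma minpoly_coefs_lead : fs`_d = 1.
Proof.
have sz : size (intpoly fs) = size fs by rewrite fsx.1 fsx.2.
have := minCpoly_monic x; rewrite monicE -fsx.1 lead_coefE sz coef_map coef_Poly -/d => /eqP.
by move=> e; apply: (@intr_inj algC); rewrite e.
Qed.

Lemma minpoly_coefs_Aint : x \in Aint.
Proof.
rewrite unfold_in -fsx.1; apply/polyOverP=> i; rewrite coef_map.
exact: intr_int.
Qed.

Lemma minpoly_coefs_root a : a \in conjugates x ->
  a ^+ d = - \sum_(0 <= i < d) (fs`_i)%:~R * a ^+ i.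
Proof.
rewrite mem_conjugates -fsx.1 rootE horner_intpoly minpoly_coefs_size.
rewrite big_nat_recr //= minpoly_coefs_lead mul1r addrC addr_eq0.
by move/eqP.
Qed.

Lemma conjugates_bound a : a \in conjugates x -> `|a| <= (root_bound fs)%:R.
Proof.
move=> ca; rewrite real_leNgt ?normr_real ?realn // -natr1.
rewrite [_ + 1]addrC; set S := (\sum_(c <- fs) _)%N; apply/negP => gt_a.
have a1 : 1 < `|a| by apply: le_lt_trans gt_a; rewrite lerDl ler0n.
have a0 : 0 < `|a| by apply: lt_trans a1.
suff : `|a| ^+ d <= S%:R * `|a| ^+ d.-1.
  rewrite -{1}(prednK minpoly_coefs_degree_gt0) exprS ler_pM2r ?exprn_gt0 // => le_S.
  by have := lt_le_trans gt_a le_S; rewrite gtrDr ltr10.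
rewrite -normrX (minpoly_coefs_root ca) normrN.
apply: le_trans (ler_norm_sum _ _ _) _.
apply: (@le_trans _ _ (\sum_(0 <= i < d) `|fs`_i|%:~R * `|a| ^+ d.-1)).
  rewrite !big_nat; apply: ler_sum => i /= lei; rewrite normrM normrX -intr_norm.
  rewrite ler_wpM2l ?ler0z ?normr_ge0 // ler_weXn2l ?(ltW a1) //.
  by rewrite -ltnS prednK // minpoly_coefs_degree_gt0.
rewrite -mulr_suml ler_wpM2r ?exprn_ge0 ?normr_ge0 //.
rewrite /S [in leRHS](big_nth 0) minpoly_coefs_size big_nat_recr //= natrD natr_sum.
by rewrite -[leLHS]addr0 lerD ?ler0n.
Qed.

End MinpolyCoefs.

(** Otherwise the product of the [|z - a|] over the roots [a] would be too large. *)
Lemma close_root (x z e : algC) : 0 < e ->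
    `|(minCpoly x).[z]| < e ^+ size (conjugates x) ->
  exists2 a, a \in conjugates x & `|z - a| < e.
Proof.
move=> e0 lt_f; apply/hasP; rewrite -[has _ _]negbK; apply/negP => /hasPn far.
move: lt_f; rewrite minCpoly_conjugates horner_prod normr_prod.
rewrite real_ltNge ?rpred_prod ?realX ?gtr0_real // => [/negP[]|i _]; last exact: normr_real.
have -> : e ^+ size (conjugates x) = \prod_(a <- conjugates x) e.
  by rewrite big_const_seq count_predT iter_mulr_1.
rewrite [leLHS]big_seq [leRHS]big_seq; apply: ler_prod => a ca.
rewrite (ltW e0) hornerXsubC /= real_leNgt ?(gtr0_real e0) ?normr_real //.
exact: far.
Qed.

(** Points that nearly kill the minimal polynomial of [x] are close to its
    roots; if they are pairwise far apart, they are close to distinct roots, hence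
    to all of them. *)
Lemma isolation_sum (x e : algC) (B : algC) (zs : seq algC) :
    0 < e -> size zs = size (conjugates x) ->
    {in conjugates x, forall a, `|a| <= B} ->
    (forall i j, (i < size zs)%N -> (j < size zs)%N -> i != j ->
       e *+ 2 < `|zs`_i - zs`_j|) ->
    {in zs, forall z, `|(minCpoly x).[z]| < e ^+ size (conjugates x)} ->
  `|\sum_(a <- conjugates x) `|a| ^+ 2 - \sum_(z <- zs) `|z| ^+ 2|
    <= (size (conjugates x))%:R * ((B *+ 2 + e) * e).
Proof.
move=> e0 sz leB sep small.
have /choice[r Dr] : forall z, exists a, z \in zs -> a \in conjugates x /\ `|z - a| < e.
  move=> z; have [zzs|] := boolP (z \in zs); last by exists 0.
  by have [a ca lta] := close_root e0 (small z zzs); exists a.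
have uz : uniq zs.
  apply/(uniqP 0) => i j; rewrite !inE => lei lej eij; apply/eqP/negPn/negP => nij.
  have := sep i j lei lej nij; rewrite eij subrr normr0.
  by move/(lt_trans (_ : 0 < e *+ 2)); rewrite ltxx pmulrn_lgt0 // => /(_ e0).
have ur : uniq (map r zs).
  rewrite map_inj_in_uniq // => z w zzs wzs erw; apply/eqP/negPn/negP => nzw.
  have [_ ltz] := Dr z zzs; have [_ ltw] := Dr w wzs.
  have := sep (index z zs) (index w zs); rewrite !index_mem !nth_index // => /(_ zzs wzs).
  have -> : index z zs != index w zs.
    by apply: contraNneq nzw => eii; rewrite -(nth_index 0 zzs) eii nth_index.
  move=> /(_ isT); have -> : z - w = (z - r z) - (w - r w) by rewrite erw; ring.
  have := ler_normB (z - r z) (w - r w) => /lt_le_trans h /h.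
  by rewrite mulr2n => /lt_trans/(_ (ltrD ltz ltw)); rewrite ltxx.
have pr : perm_eq (map r zs) (conjugates x).
  apply: uniq_perm => //; first exact: conjugates_uniq.
  have sub : {subset map r zs <= conjugates x}.
    by move=> _ /mapP[z /Dr[cz _] ->].
  by have [] := uniq_min_size ur sub _; rewrite // size_map sz.
rewrite -(perm_big _ pr) big_map -sumrB /=.
apply: le_trans (ler_norm_sum _ _ _) _; rewrite -sz -[size zs]count_predT.
rewrite mulrC mulr_natr -iter_addr_0 -big_const_seq [leLHS]big_seq [leRHS]big_seq.
apply: ler_sum => z /Dr[crz ltz].
rewrite subr_sqr normrM mulrC; apply: ler_pM; rewrite ?normr_ge0 //; last first.
  by apply: le_trans (ler_dist_dist _ _) _; rewrite distrC ltW.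
rewrite ger0_norm ?addr_ge0 ?normr_ge0 // mulr2n -addrA lerD ?leB //.
have -> : z = r z + (z - r z) by ring.
by apply: le_trans (ler_normD _ _) _; rewrite lerD ?leB ?ltW.
Qed.

Definition gauss_sum (zs : seq (int * int)) : int := \sum_(z <- zs) gauss_norm z.

Lemma ltr_sqr_nneg (R : numDomainType) (x y : R) : 0 <= x -> 0 <= y ->
  (x ^+ 2 < y ^+ 2) = (x < y).
Proof. by move=> x0 y0; rewrite ltr_pXn2r ?nnegrE. Qed.

Lemma gauss_sepE (E m : nat) (z w : int * int) : (0 < E)%N -> (0 < m)%N ->
  (4 * (m%:Z * m%:Z) < E%:Z * E%:Z * gauss_norm (z.1 - w.1, z.2 - w.2)) =
  (E%:R^-1 *+ 2 < `|gaussC z / m%:R - gaussC w / m%:R|).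
Proof.
move=> E0 m0; have E0' : 0 < E%:R :> algC by rewrite ltr0n.
have m0' : 0 < m%:R :> algC by rewrite ltr0n.
rewrite -(ltr_int algC) !rmorphM /= -gaussC_norm gaussC_sub -!pmulrn.
rewrite -mulrBl normf_div normr_nat.
rewrite [RHS]ltr_pdivlMr // -[_^-1 *+ 2]mulr_natl [in RHS]mulrAC [RHS]ltr_pdivrMr //.
rewrite -[RHS]ltr_sqr_nneg ?mulr_ge0 ?ler0n ?normr_ge0 //.
have -> : (2 * m%:R) ^+ 2 = 4 * (m%:R * m%:R) :> algC by ring.
by rewrite exprMn [in RHS](mulrC _ (E%:R ^+ 2)) [E%:R ^+ 2]expr2.
Qed.

Lemma gauss_smallE fs x (E m : nat) (z : int * int) (d := (size fs).-1) :
    minpoly_coefs fs x -> (0 < E)%N -> (0 < m)%N ->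
  (gauss_norm (gauss_eval fs m z) * (E%:Z ^+ d * E%:Z ^+ d) < m%:Z ^+ d * m%:Z ^+ d)
  = (`|(minCpoly x).[gaussC z / m%:R]| < E%:R^-1 ^+ d).
Proof.
move=> fsx E0 m0; have E0' : 0 < E%:R :> algC by rewrite ltr0n.
have m0' : 0 < m%:R :> algC by rewrite ltr0n.
rewrite -(ltr_int algC) !rmorphM /= -gaussC_norm.
rewrite gaussC_eval // fsx.1 normrM normrX normr_nat !rmorphXn /= -!pmulrn.
rewrite -!expr2 -exprMn ltr_sqr_nneg ?mulr_ge0 ?exprn_ge0 ?ler0n ?normr_ge0 //.
rewrite -mulrA gtr_pMr ?exprn_gt0 // exprVn.
by rewrite -[X in _ = (_ < X)]mul1r ltr_pdivlMr ?exprn_gt0.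
Qed.

Lemma isolates_sound fs x E m zs : minpoly_coefs fs x -> isolates fs E m zs ->
  `|\sum_(a <- conjugates x) `|a| ^+ 2 - (gauss_sum zs)%:~R / m%:R ^+ 2| <=
  ((size fs).-1 * (2 * root_bound fs + 1))%:R / E%:R.
Proof.
move=> fsx /and5P[E0 m0 /eqP sz /allP sep /allP small].
have E0' : 0 < E%:R :> algC by rewrite ltr0n.
have -> : (gauss_sum zs)%:~R / m%:R ^+ 2 =
    \sum_(z <- [seq gaussC z / m%:R | z <- zs]) `|z| ^+ 2 :> algC.
  rewrite big_map rmorph_sum mulr_suml /=; apply: eq_bigr => z _.
  by rewrite normf_div expr_div_n gaussC_norm normr_nat.
apply: le_trans (isolation_sum (e := E%:R^-1) (B := (root_bound fs)%:R) _ _ _ _ _) _.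
- by rewrite invr_gt0.
- by rewrite size_map sz (minpoly_coefs_degree fsx).
- exact: conjugates_bound.
- move=> i j; rewrite size_map sz => lei lej nij.
  have := sep i; rewrite mem_iota add0n => /(_ lei) /allP /(_ j).
  rewrite mem_iota add0n => /(_ lej); rewrite (negPf nij) /=.
  by rewrite gauss_sepE // !(nth_map (0, 0)) ?sz.
- move=> _ /mapP[z zzs ->]; rewrite (minpoly_coefs_degree fsx).
  by rewrite -gauss_smallE // small.
rewrite (minpoly_coefs_degree fsx) natrM -mulrA ler_wpM2l ?ler0n //.
rewrite ler_pM2r ?invr_gt0 // natrD natrM mulr2n mulrDl mul1r lerD2l.
by rewrite invf_le1 // ler1n.
Qed.

Lemma gauss_approx (c : algC) (m : nat) :
  exists z, `|gaussC z - m%:R * c| <= 2.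
Proof.
pose z := (Num.floor (m%:R * 'Re c), Num.floor (m%:R * 'Im c)).
exists z.
have fl (y : algC) : y \is Num.real -> `|(Num.floor y)%:~R - y| <= 1.
  move=> yr; have /andP[h1 h2] := real_floor_itv yr.
  rewrite distrC ger0_norm ?subr_ge0 // lerBlDl ltW //.
  by move: h2; rewrite rmorphD.
have -> : gaussC z - m%:R * c = (z.1%:~R - m%:R * 'Re c) + 'i * (z.2%:~R - m%:R * 'Im c).
  by rewrite {1}[c]algCrect /gaussC; ring.
apply: le_trans (ler_normD _ _) _; rewrite normrM normCi mul1r.
rewrite -[2]/(1 + 1) lerD ?fl // rpredM ?rpred_nat // ?Creal_Re ?Creal_Im //.
Qed.

(** Round the conjugates to multiples of [1 / m], where [m] is large compared
    with [E ^ d] and [1 / E] is small compared with their mutual distances. *)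
Lemma isolates_complete fs x : minpoly_coefs fs x ->
  exists E0, forall E, (E0 <= E)%N -> exists m zs, isolates fs E m zs.
Proof.
move=> fsx; set c := conjugates x; set d := (size fs).-1.
have szc : size c = d by exact: minpoly_coefs_degree.
set B := root_bound fs.
(* The points are within [2 / E] of conjugates, and must be more than [2 / E]
   apart: it is enough that the conjugates are more than [6 / E] apart. *)
pose sp i j := Num.bound (6 / `|c`_i - c`_j|).
exists (\sum_(i < d) \sum_(j < d) sp i j).+1 => E leE.
have E0 : (0 < E)%N by apply: leq_trans leE.
(* [K] bounds the product of the distances to the other conjugates. *)
pose K := ((2 * B + 2) ^ d)%N; pose m := (2 * K * E ^ d).+1.
have m0' : 0 < m%:R :> algC by rewrite ltr0n.
have E0' : 0 < E%:R :> algC by rewrite ltr0n.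
have K0 : (0 < K)%N by rewrite expn_gt0 addn_gt0 orbT.
have leEm : (E <= m)%N.
  rewrite /m ltnW // ltnS -{1}(expn1 E).
  apply: (@leq_trans (E ^ d)%N); first by rewrite leq_pexp2l ?(minpoly_coefs_degree_gt0 fsx).
  by rewrite leq_pmull // muln_gt0.
have /choice[g Dg] := fun a : algC => gauss_approx a m.
have close a : `|gaussC (g a) / m%:R - a| <= 2 / m%:R.
  have -> : gaussC (g a) / m%:R - a = (gaussC (g a) - m%:R * a) / m%:R.
    by rewrite mulrBl mulrAC divff ?mul1r // gt_eqF.
  by rewrite normf_div normr_nat ler_pM2r ?invr_gt0.
exists m, (map g c).
apply/and5P; split=> //; first by rewrite size_map szc.
  apply/allP=> i; rewrite mem_iota add0n => /= lei.
  apply/allP=> j; rewrite mem_iota add0n => /= lej.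
  have [//|nij] := eqVneq i j.
  rewrite gauss_sepE // !(nth_map 0) ?szc //.
  have cij : 0 < `|c`_i - c`_j|.
    by rewrite normr_gt0 subr_eq0 nth_uniq ?conjugates_uniq ?szc.
  have lt6 : 6 / E%:R < `|c`_i - c`_j|.
    rewrite ltr_pdivrMr // mulrC -ltr_pdivrMr //.
    apply: (lt_le_trans (archi_boundP _)); first by rewrite divr_ge0 ?ler0n // ltW.
    rewrite ler_nat -/(sp i j); apply: leq_trans (ltnW leE).
    rewrite (bigD1 (Ordinal lei)) //= (bigD1 (Ordinal lej)) //= -addnA.
    exact: leq_addr.
  have le2 a : `|gaussC (g a) / m%:R - a| <= 2 / E%:R.
    by apply: le_trans (close a) _; rewrite ler_pM2l ?ltr0n // lef_pV2 ?posrE // ler_nat.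
  have tri : `|c`_i - c`_j| <= 2 / E%:R + 2 / E%:R
      + `|gaussC (g c`_i) / m%:R - gaussC (g c`_j) / m%:R|.
    have -> : c`_i - c`_j = - (gaussC (g c`_i) / m%:R - c`_i)
        + (gaussC (g c`_j) / m%:R - c`_j)
        + (gaussC (g c`_i) / m%:R - gaussC (g c`_j) / m%:R) by ring.
    apply: le_trans (ler_normD _ _) _; rewrite lerD2r.
    by apply: le_trans (ler_normD _ _) _; rewrite normrN lerD.
  have := lt_le_trans lt6 tri.
  have -> : 6 / E%:R = 2 / E%:R + 2 / E%:R + E%:R^-1 *+ 2 :> algC by ring.
  by rewrite ltrD2l.
apply/allP=> _ /mapP[a ca ->]; rewrite (gauss_smallE _ fsx) // -/d.
rewrite minCpoly_conjugates horner_prod normr_prod.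
rewrite (bigD1_seq a) ?conjugates_uniq //= hornerXsubC.
apply: (@le_lt_trans _ _ (2 / m%:R * K%:R)).
  apply: ler_pM; rewrite ?normr_ge0 //; first by apply: prodr_ge0 => b _; rewrite normr_ge0.
  rewrite /K natrX -szc -/c.
  have -> : (2 * B + 2)%:R ^+ size c = \prod_(b <- c) (2 * B + 2)%:R :> algC.
    by rewrite big_const_seq count_predT iter_mulr_1.
  rewrite [leRHS](bigID (fun b => b != a)) /= -[leLHS]mulr1.
  have b1 : 1 <= (2 * B + 2)%:R :> algC by rewrite ler1n addn_gt0 orbT.
  apply: ler_pM => //; first by apply: prodr_ge0 => b _; rewrite normr_ge0.
    rewrite big_seq_cond [leRHS]big_seq_cond; apply: ler_prod => b /andP[cb _].
    rewrite normr_ge0 hornerXsubC /=.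
    have -> : gaussC (g a) / m%:R - b = (gaussC (g a) / m%:R - a) + (a - b) by ring.
    apply: le_trans (ler_normD _ _) _; rewrite addnC natrD lerD //.
      by apply: le_trans (close a) _; rewrite ler_pdivrMr // ler_peMr ?ler0n // ler1n.
    rewrite mul2n -addnn natrD.
    by apply: le_trans (ler_normB _ _) _; rewrite lerD ?(conjugates_bound fsx).
  by elim/big_rec: _ => // b y _; exact: mulr_ege1.
rewrite exprVn mulrAC ltr_pdivrMr // -ltr_pdivrMl ?invr_gt0 ?exprn_gt0 // invrK.
by rewrite -natrX -natrM -natrM ltr_nat /m ltnS mulnC.
Qed.

(** * Eisenstein's criterion over [Q(x)] *)

Lemma Aint_integral (z : algC) : z \in Aint <-> integralOver (intr : int -> algC) z.
Proof.
split; last first.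
  case=> p mon_p pz; apply: root_monic_Aint pz _ _; first exact: monic_map.
  by apply/polyOverP=> i; rewrite coef_map; exact: intr_int.
rewrite unfold_in => /floorpP[p Dp]; exists p; last by rewrite -Dp root_minCpoly.
have := minCpoly_monic z; rewrite Dp !monicE lead_coef_map_inj //; last exact: intr_inj.
by rewrite -(inj_eq (@intr_inj algC)).
Qed.

Lemma root_monic_over_Aint (g : {poly algC}) (b : algC) :
  g \is monic -> (forall i, g`_i \in Aint) -> root g b -> b \in Aint.
Proof.
move=> mon_g Ag gb; apply/Aint_integral; apply: integral_root_monic mon_g gb _.
by move=> y /(nthP 0)[i _ <-]; apply/Aint_integral.
Qed.

Lemma prod_add_multiple (q : algC) (u w : algC -> algC) (s : seq algC) :
    {in s, forall a, u a \in Aint /\ w a \in Aint} -> q \in Aint ->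
  exists2 W, W \in Aint & \prod_(a <- s) (u a + q * w a) = \prod_(a <- s) u a + q * W.
Proof.
move=> + Aq; elim: s => [|a s IHs] As; first by exists 0; rewrite ?big_nil ?mulr0 ?addr0.
have [|W AW DW] := IHs; first by move=> b sb; apply: As; rewrite inE sb orbT.
have [Au Aw] := As a (mem_head _ _).
have AP : \prod_(b <- s) u b \in Aint.
  rewrite big_seq; apply: rpred_prod => b sb.
  by have [] := As b; rewrite ?inE ?sb ?orbT.
exists (u a * W + w a * \prod_(b <- s) u b + q * (w a * W)).
  by rewrite !rpredD ?rpredM.
by rewrite !big_cons DW; ring.
Qed.

Lemma int_multiple_Aint (n : int) (p : nat) (y : algC) :
  (0 < p)%N -> y \in Aint -> n%:~R = p%:R * y -> exists z, n = p%:Z * z.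
Proof.
move=> p0 Ay e; have p0' : p%:R != 0 :> algC by rewrite pnatr_eq0 -lt0n.
have : y \in Num.int.
  apply: (Cint_rat_Aint _ Ay); rewrite (_ : y = n%:~R / p%:R).
    by rewrite rpred_div ?rpred_nat // rpred_int.
  by rewrite e mulrC mulKf.
case/intrP=> z Dz; exists z; apply: (@intr_inj algC).
by rewrite e Dz rmorphM.
Qed.

(** This product is a norm from [Q(x)], or a power of it: it is fixed by all
    automorphisms, which permute its factors. *)
Lemma conjugates_norm_int (x : algC) (h : {poly rat}) :
    (map_poly ratr h).[x] \in Aint ->
  exists n : int, n%:~R = \prod_(a <- conjugates x) (map_poly ratr h).[a] :> algC.
Proof.
move=> Ah; have tauh (tau : {rmorphism algC -> algC}) a :
    tau (map_poly ratr h).[a] = (map_poly ratr h).[tau a].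
  rewrite -horner_map; congr _.[_]; rewrite -map_poly_comp.
  by apply: eq_map_poly => r /=; rewrite fmorph_rat.
suff /intrP[n Dn] : \prod_(a <- conjugates x) (map_poly ratr h).[a] \in Num.int.
  by exists n.
apply: aut_fixed_int.
  rewrite big_seq; apply: rpred_prod => a; rewrite mem_conjugates.
  by case/conjugate_aut => tau <-; rewrite -tauh Aint_aut.
move=> tau; rewrite rmorph_prod -[RHS](perm_big _ (perm_conjugates tau x)) big_map /=.
by apply: eq_bigr => a _; rewrite tauh.
Qed.

(** The norm argument behind Eisenstein's criterion.  Suppose that a power of
    [c = h(x)] is in the ideal generated by [x - k] and [p].  The same holds for
    the conjugates of [c]; multiplying over them, a power of the norm of [c] is
    in the ideal generated by the norm of [x - k], which [p] divides, and by [p]. *)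
Lemma norm_dvd (x U W : algC) (k n n0 : int) (p N : nat) (h : {poly rat}) :
    x \in Aint -> prime p -> U \in Aint -> W \in Aint ->
    \prod_(a <- conjugates x) (a - k%:~R) = n0%:~R -> (p%:Z %| n0)%Z ->
    \prod_(a <- conjugates x) (map_poly ratr h).[a] = n%:~R ->
    (map_poly ratr h).[x] ^+ N = (x - k%:~R) * U + p%:R * W ->
  (p%:Z %| n)%Z.
Proof.
move=> Ax pr_p AU AW Dn0 /dvdzP[m Dm] Dn DN.
have tauh (tau : {rmorphism algC -> algC}) a :
    tau (map_poly ratr h).[a] = (map_poly ratr h).[tau a].
  rewrite -horner_map; congr _.[_]; rewrite -map_poly_comp.
  by apply: eq_map_poly => r /=; rewrite fmorph_rat.
have /choice[UW DUW] : forall a, exists uw : algC * algC, a \in conjugates x ->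
    [/\ uw.1 \in Aint, uw.2 \in Aint &
    (map_poly ratr h).[a] ^+ N = (a - k%:~R) * uw.1 + p%:R * uw.2].
  move=> a; have [|] := boolP (a \in conjugates x); last by exists (0, 0).
  rewrite mem_conjugates => /conjugate_aut[tau <-].
  exists (tau U, tau W); rewrite /= !Aint_aut -tauh -rmorphXn DN; split=> //.
  by rewrite rmorphD !rmorphM rmorphB /= rmorph_int rmorph_nat.
have Ac a : a \in conjugates x -> a - k%:~R \in Aint.
  by move=> ca; rewrite rpredB ?Aint_int ?(conjugates_Aint Ax).
have [|| W' AW' DW'] := @prod_add_multiple p%:R
    (fun a => (a - k%:~R) * (UW a).1) (fun a => (UW a).2) (conjugates x).
- by move=> a ca; have [? ? _] := DUW a ca; rewrite rpredM ?Ac.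
- exact: rpred_nat.
pose U' := \prod_(a <- conjugates x) (UW a).1.
have AU' : U' \in Aint.
  by rewrite /U' big_seq; apply: rpred_prod => a /DUW[].
have [] : exists z, n ^+ N = p%:Z * z.
  apply: (@int_multiple_Aint _ _ (m%:~R * U' + W')); first exact: prime_gt0.
    by rewrite rpredD ?rpredM ?Aint_int.
  rewrite rmorphXn /= -Dn -prodrXl.
  under eq_big_seq => a ca do have [_ _ ->] := DUW a ca.
  rewrite DW' big_split /= Dn0 -/U' Dm rmorphM /= -pmulrn; ring.
move=> z Dz; have : (p %| `|n| ^ N)%N by rewrite -abszX Dz abszM dvdn_mulr.
by rewrite Euclid_dvdX // => /andP[].
Qed.

(** Eisenstein's criterion over [Q(x)], at a prime [p] that divides the norm of
    [x - k] exactly once: the constant coefficients of two factors would both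
    have norm divisible by [p], but the product of these norms is that of the
    constant coefficient of [g], which is not divisible by [p ^ 2]. *)
Lemma Eisenstein_over (x w0 : algC) (k n0 : int) (p : nat) (g m1 m2 : {poly algC})
    (h1 h2 : {poly rat}) :
    x \in Aint -> prime p -> w0 \in Aint ->
    \prod_(a <- conjugates x) (a - k%:~R) = n0%:~R ->
    (p%:Z %| n0)%Z -> ~~ ((p ^ 2)%:Z %| n0)%Z ->
    g \is monic -> g`_0 = x - k%:~R + (p ^ 2)%:R * w0 ->
    (forall i, (0 < i)%N -> (i < (size g).-1)%N -> exists2 w, w \in Aint & g`_i = p%:R * w) ->
    g = m1 * m2 -> m1 \is monic -> m2 \is monic ->
    m1`_0 = (map_poly ratr h1).[x] -> m2`_0 = (map_poly ratr h2).[x] ->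
  (size m1 <= 1)%N \/ (size m2 <= 1)%N.
Proof.
move=> Ax pr_p Aw0 Dn0 pn0 p2n0 mon_g g0 gi Dg mon1 mon2 D1 D2.
have [?|lt1] := leqP (size m1) 1; first by left.
have [?|lt2] := leqP (size m2) 1; first by right.
exfalso; pose N := (size g).-1.
have sg : size g = N.+1 by rewrite /N prednK // size_poly_gt0 monic_neq0.
have N0 : (0 < N)%N.
  have nz2 : m2 != 0 by apply: monic_neq0.
  have : (size g > 1)%N.
    rewrite Dg size_monicM // -(prednK (ltnW lt1)) addSn /=.
    by rewrite (leq_trans lt2) // leq_addl.
  by rewrite sg.
have /choice[w Dw] : forall i, exists w,
    (0 < i)%N -> (i < N)%N -> w \in Aint /\ g`_i = p%:R * w.
  move=> i; have [i0|] := boolP (0 < i)%N; last by exists 0.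
  have [lti|] := boolP (i < N)%N; last by exists 0.
  by have [w Aw Dw] := gi i i0 lti; exists w.
have Ag i : g`_i \in Aint.
  have [->|i0] := posnP i; first by rewrite g0 rpredD ?rpredB ?rpredM ?rpred_nat ?Aint_int.
  have [lti|gei|->] := ltngtP i N.
  - by have [Aw ->] := Dw i i0 lti; rewrite rpredM ?rpred_nat.
  - by rewrite nth_default ?sg.
  by move: mon_g; rewrite monicE lead_coefE => /eqP; rewrite -/N => ->.
have Aroot b : root g b -> b \in Aint by apply: root_monic_over_Aint.
(* A root [b] of [g] has its [N]-th power in the ideal [(x - k, p)]. *)
have pw b : root g b -> exists2 W, W \in Aint & b ^+ N = (x - k%:~R) * -1 + p%:R * W.
  move=> gb; have Ab := Aroot b gb.
  exists (- (p%:R * w0 + \sum_(0 <= i < N.-1) w i.+1 * b ^+ i.+1)).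
    rewrite rpredN rpredD ?rpredM ?rpred_nat // big_nat; apply: rpred_sum => i /= lti.
    have [|Aw _] := Dw i.+1 isT; first by rewrite -(prednK N0) ltnS.
    by rewrite rpredM ?rpredX.
  move: gb; rewrite rootE horner_coef sg big_ord_recr /=.
  have -> : g`_N = 1 by apply/eqP; move: mon_g; rewrite monicE lead_coefE.
  rewrite mul1r addrC addr_eq0 => /eqP ->.
  rewrite -(big_mkord xpredT (fun i => g`_i * b ^+ i)) -{1}(prednK N0) big_nat_recl //=.
  rewrite g0 expr0 mulr1 natrX.
  under eq_big_nat => i lti.
    have [|_ ->] := Dw i.+1 isT; first by rewrite -(prednK N0) ltnS.
    rewrite -mulrA; over.
  by rewrite -mulr_sumr; ring.
(* Hence so has the constant coefficient of a factor: it is, up to sign, the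
   product of some of these roots. *)
have const m : m \is monic -> (1 < size m)%N -> (forall b, root m b -> root g b) ->
    exists UW : algC * algC, [/\ UW.1 \in Aint, UW.2 \in Aint, m`_0 \in Aint &
      m`_0 ^+ N = (x - k%:~R) * UW.1 + p%:R * UW.2].
  move=> mon_m sm rm; have [r Dr] := closed_field_poly_normal m.
  rewrite (monicP mon_m) scale1r in Dr.
  have Ar b : b \in r -> root g b by move=> rb; apply: rm; rewrite Dr root_prod_XsubC.
  have m0 : m`_0 = \prod_(b <- r) (- b).
    rewrite -horner_coef0 Dr horner_prod; apply: eq_bigr => b _.
    by rewrite hornerXsubC sub0r.
  have Ap (s : seq algC) : {subset s <= r} -> \prod_(b <- s) (- b) \in Aint.
    move=> sr; rewrite big_seq; apply: rpred_prod => b /sr/Ar/Aroot.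
    by rewrite rpredN.
  rewrite m0 {m0}; case: r Dr Ar Ap => [|b r] Dr Ar Ap.
    by move: sm; rewrite Dr big_nil size_poly1.
  have [W AW DW] := pw b (Ar b (mem_head _ _)).
  pose P := (-1) ^+ N * (\prod_(b <- r) (- b)) ^+ N.
  have AP : P \in Aint.
    rewrite rpredM ?rpredX ?rpredN1 // Ap // => c rc; by rewrite inE rc orbT.
  exists (- P, W * P); split; [by rewrite /= rpredN | by rewrite /= rpredM | exact: Ap |].
  rewrite big_cons exprMn [(- b) ^+ N]exprNn DW /P.
  by move: ((\prod_(j <- r) - j) ^+ N) ((-1) ^+ N) => t s /=; ring.
have rg1 b : root m1 b -> root g b by rewrite Dg rootM => ->.
have rg2 b : root m2 b -> root g b by rewrite Dg rootM orbC => ->.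
have [[U1 W1] /= [AU1 AW1 A1 P1]] := const _ mon1 lt1 rg1.
have [[U2 W2] /= [AU2 AW2 A2 P2]] := const _ mon2 lt2 rg2.
rewrite D1 in A1 P1; rewrite D2 in A2 P2.
have [n1 Dn1] := conjugates_norm_int A1; have [n2 Dn2] := conjugates_norm_int A2.
have p1 := norm_dvd Ax pr_p AU1 AW1 Dn0 pn0 (esym Dn1) P1.
have p2 := norm_dvd Ax pr_p AU2 AW2 Dn0 pn0 (esym Dn2) P2.
have tauh (tau : {rmorphism algC -> algC}) (h : {poly rat}) a :
    tau (map_poly ratr h).[a] = (map_poly ratr h).[tau a].
  rewrite -horner_map; congr _.[_]; rewrite -map_poly_comp.
  by apply: eq_map_poly => r /=; rewrite fmorph_rat.
have /choice[w' Dw'] : forall a, exists w', a \in conjugates x ->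
    [/\ w' \in Aint, a - k%:~R \in Aint &
    (map_poly ratr h1).[a] * (map_poly ratr h2).[a] = (a - k%:~R) + (p ^ 2)%:R * w'].
  move=> a; have [|] := boolP (a \in conjugates x); last by exists 0.
  rewrite mem_conjugates => /conjugate_aut[tau <-].
  exists (tau w0); rewrite Aint_aut rpredB ?Aint_aut ?Aint_int //; split=> //.
  rewrite -!tauh -rmorphM /= -D1 -D2 -coef0M -Dg g0.
  by rewrite rmorphD rmorphB rmorphM /= rmorph_int rmorph_nat.
have [|| W' AW' DW'] := @prod_add_multiple (p ^ 2)%:R
    (fun a => a - k%:~R) w' (conjugates x).
- by move=> a /Dw'[].
- exact: rpred_nat.
have [|||z Dz] := @int_multiple_Aint (n1 * n2 - n0) (p ^ 2) W' => //.
- by rewrite expn_gt0 prime_gt0.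
- rewrite rmorphB rmorphM /= Dn1 Dn2 -big_split /=.
  under eq_big_seq => a ca do have [_ _ ->] := Dw' a ca.
  by rewrite DW' Dn0 addrC addKr.
case/negP: p2n0; have -> : n0 = n1 * n2 - (p ^ 2)%:Z * z by rewrite -Dz opprB addrC subrK.
apply: rpredB; last exact: dvdz_mulr.
by rewrite (_ : (p ^ 2)%:Z = p%:Z * p%:Z) ?dvdz_mul // -PoszM.
Qed.

(** * Coordinates of a relative minimal polynomial *)

(** The list [G] stands for a polynomial over [Z[X]], of which this is the image
    over [Z[x]]. *)
Definition tower_poly (G : seq (seq int)) (x : algC) : {poly algC} :=
  Poly [seq (intpoly v).[x] | v <- G].

Lemma coef_tower_poly G x i : (tower_poly G x)`_i = (intpoly (nth [::] G i)).[x].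
Proof.
rewrite coef_Poly; have [lti|gei] := ltnP i (size G); first by rewrite (nth_map [::]).
by rewrite !nth_default ?size_map // /intpoly rmorph0 horner0.
Qed.

Section MinpolyOver.
Context (fs : seq int) (x beta : algC) (G : seq (seq int)).
Hypothesis fsx : minpoly_coefs fs x.
Let s := [:: x; beta].
Let a : QQ s := QQgen s 0.
Let b : QQ s := QQgen s 1.
Let d := (size fs).-1.

Let aC : QQval s a = x. Proof. exact: QQgenK. Qed.
Let bC : QQval s b = beta. Proof. exact: QQgenK. Qed.

Lemma adjoin_degree_gen : adjoin_degree 1%AS a = d.
Proof.
have : size (minPoly 1%AS a) = size fs.
  by have := minCpoly_QQval a; rewrite aC fsx.2 => ->; rewrite size_map_poly.
by rewrite size_minPoly /d => <-.
Qed.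

Let evL (v : seq int) : QQ s := \sum_(0 <= i < size v) (v`_i)%:~R * a ^+ i.

Let evLC v : QQval s (evL v) = (intpoly v).[x].
Proof.
rewrite horner_intpoly rmorph_sum; apply: eq_bigr => i _.
by rewrite rmorphM rmorphXn rmorph_int /= aC.
Qed.

Let evL_mem v : evL v \in <<1; a>>%VS.
Proof.
by rewrite rpred_sum // => i _; rewrite rpredM ?rpredX ?memv_adjoin ?rpred_int.
Qed.

Let basis := [tuple a ^+ i | i < adjoin_degree 1%AS a].

Let basis_free : free basis.
Proof.
apply/freeP => k k0 i.
pose p : {poly QQ s} := \poly_(j < adjoin_degree 1%AS a) (oapp k 0 (insub j))%:A.
have : root p a.
  rewrite rootE horner_poly; apply/eqP; rewrite -[RHS]k0; apply: eq_bigr => j _.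
  by rewrite valK /= (nth_mktuple _ 0) mulr_algl.
rewrite (@root_small_adjoin_poly _ _ 1%AS) ?size_poly //; last first.
  by apply/polyOverP=> j; rewrite coef_poly; case: ifP => _; rewrite ?rpred0 ?rpredZ ?rpred1.
move/eqP/(congr1 (fun q : {poly _} => q`_i)); rewrite coef0 coef_poly ltn_ord valK /= => /eqP.
by rewrite scaler_eq0 oner_eq0 orbF => /eqP.
Qed.

Let coord_evL v (i : 'I_(adjoin_degree 1%AS a)) : size v = d ->
  coord basis i (evL v) = (v`_i)%:~R.
Proof.
move=> sv; have -> : evL v = \sum_(j < adjoin_degree 1%AS a) (v`_j)%:~R *: basis`_j.
  rewrite /evL sv -adjoin_degree_gen big_mkord; apply: eq_bigr => j _.
  by rewrite (nth_mktuple _ 0) -mulr_algl scaler_int.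
exact: coord_sum_free.
Qed.

(** The relative minimal polynomial of [beta] divides the image of [G] over
    [Q(x)]; if the latter is irreducible they are equal, and then the entries of
    [G], which have length [d], are the coordinates of its coefficients. *)
Lemma minpoly_overE :
    all (fun v => size v == d) G ->
    (1 < size G)%N ->
    (intpoly (last [::] G)).[x] = 1 ->
    root (tower_poly G x) beta ->
    (forall m1 m2 (h1 h2 : {poly rat}), m1 \is monic -> m2 \is monic ->
       tower_poly G x = m1 * m2 ->
       m1`_0 = (map_poly ratr h1).[x] -> m2`_0 = (map_poly ratr h2).[x] ->
       (size m1 <= 1)%N \/ (size m2 <= 1)%N) ->
  minpoly_over x beta = [seq [seq c%:~R | c <- v] | v <- G].
Proof.
move=> /allP sG szG lastG rootG irr.
pose g : {poly QQ s} := Poly [seq evL v | v <- G].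
have gC : map_poly (QQval s) g = tower_poly G x.
  apply/polyP=> i; rewrite coef_map coef_tower_poly coef_Poly.
  have [lti|gei] := ltnP i (size G); first by rewrite (nth_map [::]) //; exact: evLC.
  rewrite (nth_default [::]) // [RHS](_ : _ = 0); last by rewrite /intpoly rmorph0 horner0.
  rewrite nth_default ?size_map // ?rmorph0. exact: (rmorph0 (QQval s)).
have lastE : last 0 [seq evL v | v <- G] = 1.
  apply: (fmorph_inj (QQval s)); rewrite rmorph1 -lastG -evLC; congr (QQval s _).
  by case: (G) szG => // v G' _; rewrite /= last_map.
have polyg : g = [seq evL v | v <- G] :> seq _.
  by apply: (@PolyK _ 0); rewrite lastE oner_eq0.
have szg : size g = size G by rewrite polyg size_map.
have mon_g : g \is monic by rewrite monicE lead_coefE nth_last polyg lastE.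
have Kg : g \is a polyOver <<1; a>>%VS.
  apply/polyOverP=> i; rewrite coef_Poly.
  have [lti|gei] := ltnP i (size G); first by rewrite (nth_map [::]).
  by rewrite nth_default ?size_map ?rpred0.
have rootg : root g b by rewrite -(fmorph_root (QQval s)) gC bC.
have min_g : minPoly <<1; a>>%AS b = g.
  have dv : minPoly <<1; a>>%AS b %| g by apply: minPoly_dvdp.
  set m := minPoly _ _ in dv *.
  have mon_m : m \is monic by apply: monic_minPoly.
  pose m2 := g %/ m.
  have Dg : g = m * m2 by rewrite mulrC divpK.
  have Km2 : m2 \is a polyOver <<1; a>>%AS by apply: divp_polyOver => //; apply: minPolyOver.
  have mon_m2 : m2 \is monic by rewrite -(monicMl _ mon_m) -Dg.
  have low (c : QQ s) : c \in <<1; a>>%VS ->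
      exists h : {poly rat}, QQval s c = (map_poly ratr h).[x].
    case/Fadjoin_polyP=> r /polyOver1P[h ->] ->; exists h.
    rewrite -horner_map aC -map_poly_comp; congr _.[_]; apply: eq_map_poly => r0 /=.
    by rewrite rmorphZ_num rmorph1 mulr1.
  have [h1 D1] := low m`_0 (polyOverP (minPolyOver _ _) _).
  have [h2 D2] := low m2`_0 (polyOverP Km2 _).
  have [||||||] := irr (map_poly (QQval s) m) (map_poly (QQval s) m2) h1 h2.
  - by rewrite map_monic.
  - by rewrite map_monic.
  - by rewrite -gC Dg rmorphM.
  - by rewrite -D1 coef_map.
  - by rewrite -D2 coef_map.
  - by rewrite size_map_poly size_minPoly ltnS leqn0.
  rewrite size_map_poly => s2.
  have : m2 == 1.
    rewrite -eqp_monic ?monic1 // -size_poly_eq1 eqn_leq s2 size_poly_gt0.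
    by rewrite monic_neq0.
  by move/eqP=> m21; rewrite Dg m21 mulr1.
rewrite /minpoly_over -/s -/a -/b -/basis min_g polyg -map_comp.
apply/eq_in_map => v Gv /=; have /eqP sv := sG v Gv.
apply: (@eq_from_nth _ 0).
  by rewrite [LHS]size_map size_enum_ord [RHS]size_map sv adjoin_degree_gen.
rewrite size_map size_enum_ord => i lti.
rewrite (nth_map (Ordinal lti)) ?size_enum_ord // coord_evL //.
by rewrite nth_enum_ord ?[RHS](nth_map 0) ?sv -?adjoin_degree_gen.
Qed.

End MinpolyOver.

(** * Values divisible by a prime exactly once *)

Lemma poly_nonroot (R : idomainType) (P : {poly R}) (g : nat -> R) :
  P != 0 -> injective g -> exists t, P.[g t] != 0.
Proof.
move=> P0 gI; apply: contrapT => no.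
have al : all (root P) (map g (iota 0 (size P))).
  apply/allP=> _ /mapP[t _ ->]; apply: contrapT => /negP h; apply: no; exists t.
  exact: h.
have un : uniq (map g (iota 0 (size P))) by rewrite map_inj_uniq ?iota_uniq.
by have := max_poly_roots P0 al un; rewrite size_map size_iota ltnn.
Qed.

Lemma poly_taylor1 (P : {poly int}) (k : int) :
  exists Q : {poly int}, forall y, P.[y] = P.[k] + Q.[y] * (y - k).
Proof.
have /factor_theorem[Q DQ] : root (P - P.[k]%:P) k.
  by rewrite rootE hornerD hornerN hornerC subrr.
exists Q => y; have := congr1 (horner^~ y) DQ.
by rewrite hornerM hornerXsubC hornerD hornerN hornerC => <-; ring.
Qed.

Lemma poly_taylor2 (P : {poly int}) (k : int) :
  exists R : {poly int}, forall y,
    P.[y] = P.[k] + P^`().[k] * (y - k) + R.[y] * (y - k) ^+ 2.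
Proof.
have /factor_theorem[Q DQ] : root (P - P.[k]%:P) k.
  by rewrite rootE hornerD hornerN hornerC subrr.
have [R DR] := poly_taylor1 Q k; exists R => y.
have := congr1 (horner^~ y) DQ; rewrite hornerM hornerXsubC hornerD hornerN hornerC.
have -> : P^`().[k] = Q.[k].
  have := congr1 (fun p : {poly int} => (deriv p).[k]) DQ.
  rewrite /= derivB derivC subr0 => ->.
  by rewrite derivM derivXsubC hornerD !hornerM hornerXsubC subrr hornerC; ring.
by rewrite (DR y) => /eqP; rewrite subr_eq => /eqP ->; ring.
Qed.

(** Clear denominators in a Bezout relation over the rationals. *)
Lemma separable_Bezout_int (F : {poly int}) :
    separable_poly (map_poly intr F : {poly rat}) ->
  exists (u w : {poly int}) (D : int), D != 0 /\ u * F + w * F^`() = D%:P.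
Proof.
rewrite separable_poly.unlock => /Bezout_coprimepP[[u w] /= uw].
have : size (u * map_poly intr F + w * (map_poly intr F)^`()) == 1%N.
  by rewrite (eqp_size uw) size_poly1.
case/size_poly1P => c c0 Dc.
have [u' [a a0 Du]] := rat_poly_scale u; have [w' [b b0 Dw]] := rat_poly_scale w.
have a0' : a%:~R != 0 :> rat by rewrite intr_eq0.
have b0' : b%:~R != 0 :> rat by rewrite intr_eq0.
have d0 : (denq c)%:~R != 0 :> rat by rewrite intr_eq0 denq_neq0.
exists ((denq c * b) *: u'), ((denq c * a) *: w'), (numq c * a * b); split.
  by rewrite !mulf_neq0 // numq_eq0.
apply: (map_inj_poly (f := intr : int -> rat)); [exact: intr_inj | by [] |].
rewrite [RHS]map_polyC /=.
have -> : (numq c * a * b)%:~R%:P = ((denq c)%:~R * a%:~R * b%:~R) *: c%:P :> {poly rat}.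
  rewrite -mul_polyC -polyCM; congr (_%:P).
  by rewrite !rmorphM /= numqE; ring.
rewrite -Dc scalerDr !scalerAl Du Dw !scalerA rmorphD !rmorphM /= !map_polyZ /=.
rewrite deriv_map !rmorphM /=.
by congr (_ *: _ * _ + _ *: _ * _); field.
Qed.

(** A separable integer polynomial has, for some prime [p], a value divisible by
    [p] exactly once.  With [u F + w F' = D] and [c = F(k0)], the values of [F]
    on [k0 + c D Z] are [c (1 + D s)], which gives a prime [p] not dividing [D];
    then [F] and [F'] have no common root modulo [p], and one of [F(k)] and
    [F(k + p)] will do. *)
Lemma exact_prime_value (F : {poly int}) :
    (1 < size F)%N -> separable_poly (map_poly intr F : {poly rat}) ->
  exists (p : nat) (k : int),
    [/\ prime p, (p%:Z %| F.[k])%Z & ~~ ((p ^ 2)%:Z %| F.[k])%Z].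
Proof.
move=> sF sepF; have [u [w [D [D0 uw]]]] := separable_Bezout_int sepF.
have F0 : F != 0 by rewrite -size_poly_gt0 ltnW.
have [k0 c0] := poly_nonroot F0 (can_inj absz_nat).
set c := F.[Posz k0] in c0.
have nzC (e : int) : F - e%:P != 0.
  have lt : (size (- e%:P : {poly int})%R < size F)%N.
    by rewrite size_polyN; exact: leq_ltn_trans (size_polyC_leq1 _) sF.
  by rewrite -size_poly_gt0 (size_polyDl lt) ltnW.
pose g (t : nat) : int := k0%:Z + c * D * t%:Z.
have gI : injective g.
  by move=> s t /addrI /(mulfI (mulf_neq0 c0 D0)) [].
have P0 : F * (F - c%:P) * (F - (- c)%:P) != 0 by rewrite !mulf_neq0.
(* Avoid the values [0] and [c], [- c] of [F], for which [1 + D s] would have no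
   prime divisor. *)
have [t] := poly_nonroot P0 gI.
rewrite !hornerM !hornerD !hornerN !hornerC !mulf_eq0 !negb_or => /andP[/andP[f0 f1] f2].
have [Q DQ] := poly_taylor1 F k0%:Z.
have Dg : F.[g t] = c * (1 + D * (t%:Z * Q.[g t])).
  by rewrite DQ -/c /g; ring.
set s := t%:Z * _ in Dg.
pose p := pdiv (absz (1 + D * s)).
have pr_p : prime p.
  apply: pdiv_prime.
  have : absz (1 + D * s) != 0%N.
    by apply: contraNneq f0 => /eqP; rewrite absz_eq0 Dg => /eqP ->; rewrite mulr0.
  have : absz (1 + D * s) != 1%N.
    apply/eqP => /eqP; rewrite -eqz_nat abszE eqr_norml ler01 andbT => /orP[] /eqP e.
      by move: f1; rewrite Dg e mulr1 subrr eqxx.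
    by move: f2; rewrite Dg e mulrN1 subrr eqxx.
  by case: (absz _) => [|[]].
have pD : ~~ (p%:Z %| D)%Z.
  apply/negP => pD; have : (p%:Z %| 1 + D * s)%Z by rewrite dvdzE pdiv_dvd.
  rewrite (rpredDr _ (dvdz_mulr s pD)) dvdz1 => /eqP e.
  by move: pr_p; rewrite -[p]/(absz p%:Z) e.
have pF : (p%:Z %| F.[g t])%Z by rewrite Dg dvdz_mull // dvdzE pdiv_dvd.
have [ex|] := boolP ((p ^ 2)%:Z %| F.[g t])%Z; last by exists p, (g t).
exists p, (g t + p%:Z).
have [R DR] := poly_taylor2 F (g t).
have e : F.[g t + p%:Z] = F.[g t] + p%:Z * (F^`().[g t] + R.[g t + p%:Z] * p%:Z).
  by rewrite DR; ring.
split=> //; first by rewrite e rpredD // dvdz_mulr.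
apply: contra pD; rewrite e (rpredDl _ ex).
rewrite (_ : (p ^ 2)%:Z = p%:Z * p%:Z); last by rewrite -PoszM.
rewrite dvdz_mul2l ?eqz_nat -?lt0n ?prime_gt0 // => pF'.
have {pF'} pF' : (p%:Z %| F^`().[g t])%Z.
  by move: pF'; rewrite (rpredDr _ (dvdz_mull _ (dvdzz p%:Z))).
have := congr1 (horner^~ (g t)) uw; rewrite hornerD !hornerM hornerC => <-.
by rewrite rpredD // dvdz_mull.
Qed.

(** * Arithmetic on coordinate vectors *)

(** Elements of [Z[a]], for a root [a] of the monic polynomial with coefficients
    [fs], as their coordinates on the powers of [a]. *)
Definition vec_add (d : nat) (u v : seq int) : seq int :=
  [seq u`_i + v`_i | i <- iota 0 d].
Definition vec_scale (k : int) (v : seq int) : seq int := [seq k * c | c <- v].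
Definition vec_one (d : nat) : seq int := [seq (i == 0)%N%:Z | i <- iota 0 d].
(** Multiplication by [a]: shift, then replace [a ^ d] by lower powers. *)
Definition vec_mulgen (fs v : seq int) : seq int :=
  let d := (size fs).-1 in
  [seq (0 :: v)`_i - v`_d.-1 * fs`_i | i <- iota 0 d].
(** An upper bound on the absolute values of the conjugates of the vector's value,
    when [B] bounds those of [a]. *)
Definition vec_norm (B : nat) (v : seq int) : nat :=
  \sum_(0 <= i < size v) absz (v`_i)%R * B ^ i.

Definition taylor_cons (fs c : seq int) (H : seq (seq int)) : seq (seq int) :=
  [seq vec_add (size fs).-1 (nth [::] (vec_scale (2 ^+ size H) c :: H) j)
                            (vec_mulgen fs (nth [::] H j))
     | j <- iota 0 (size H).+1].
(** The coefficients of [2 ^ N g((y + a) / 2)], computed by Horner's rule. *)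
Definition taylor_shift (fs : seq int) (G : seq (seq int)) : seq (seq int) :=
  foldr (taylor_cons fs) [::] G.

(** The monic polynomial over [Z[x]] whose other coefficients are [p ^ 2] times the
    vectors [ws], plus [x - k] for the constant one: the shape to which
    Eisenstein's criterion applies. *)
Definition tower (fs : seq int) (p : nat) (k : int) (ws : seq (seq int)) :
    seq (seq int) :=
  let d := (size fs).-1 in
  vec_add d (vec_scale (p ^ 2)%N%:Z (nth [::] ws 0))
            (vec_add d (vec_mulgen fs (vec_one d)) (vec_scale (- k) (vec_one d)))
    :: rcons [seq vec_scale (p ^ 2)%N%:Z w | w <- behead ws] (vec_one d).

(** With [rho = u / v] and [h_j] the entries of [H], this says that the sum of the
    [|h_j| rho ^ j] for [j] less than the degree is less than that of the leading
    term, after multiplying by a power of [v]; the factor 2 accounts for the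
    leading term in the sum. *)
Definition small_tail (B u v : nat) (H : seq (seq int)) : bool :=
  (\sum_(0 <= j < size H) vec_norm B (nth [::] H j) * (u ^ j * v ^ ((size H).-1 - j))
     < 2 * u ^ (size H).-1)%N.

Definition good_tower (fs : seq int) (p : nat) (k : int) (u v : nat)
    (ws : seq (seq int)) : bool :=
  [&& (2 <= size ws)%N, all (fun w => size w == (size fs).-1) ws
    & small_tail (root_bound fs) u v (taylor_shift fs (tower fs p k ws))].

Section VectorSemantics.
Context (fs : seq int) (x a : algC).
Hypothesis fsx : minpoly_coefs fs x.
Hypothesis xa : a \in conjugates x.
Let d := (size fs).-1.
Let ev (v : seq int) : algC := (intpoly v).[a].

Lemma vec_eval_wide v n : (size v <= n)%N ->
  ev v = \sum_(0 <= i < n) (v`_i)%:~R * a ^+ i.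
Proof.
move=> le; rewrite /ev (@horner_coef_wide _ n).
  by rewrite big_mkord; apply: eq_bigr => i _; rewrite coef_map coef_Poly.
rewrite (leq_trans (size_poly _ _)) // (leq_trans _ le) //.
by rewrite (leq_trans (size_Poly _)).
Qed.

Lemma vec_eval_map (F : nat -> int) n :
  ev [seq F i | i <- iota 0 n] = \sum_(0 <= i < n) (F i)%:~R * a ^+ i.
Proof.
rewrite (@vec_eval_wide _ n) ?size_map ?size_iota //; rewrite !big_nat.
apply: eq_bigr => i /= lti; rewrite (nth_map 0%N) ?size_iota //.
by rewrite nth_iota.
Qed.

Lemma vec_eval_add u v : (size u <= d)%N -> (size v <= d)%N ->
  ev (vec_add d u v) = ev u + ev v.
Proof.
move=> su sv; rewrite /vec_add vec_eval_map (vec_eval_wide su) (vec_eval_wide sv).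
by rewrite -big_split; apply: eq_bigr => i _; rewrite rmorphD mulrDl.
Qed.

Lemma vec_eval_scale k v : ev (vec_scale k v) = k%:~R * ev v.
Proof.
rewrite (@vec_eval_wide _ (size v)) ?size_map // (@vec_eval_wide v (size v)) //.
rewrite mulr_sumr !big_nat; apply: eq_bigr => i /= lti.
by rewrite (nth_map 0) // rmorphM mulrA.
Qed.

Lemma vec_eval_one : ev (vec_one d) = 1.
Proof.
have d0 := minpoly_coefs_degree_gt0 fsx; rewrite -/d in d0.
rewrite vec_eval_map -(prednK d0) big_nat_recl //.
rewrite big1 => [|i _]; last by rewrite mul0r.
by rewrite expr0 mulr1 addr0.
Qed.

Lemma vec_eval_mulgen v : (size v <= d)%N -> ev (vec_mulgen fs v) = a * ev v.
Proof.
move=> sv; have d0 := minpoly_coefs_degree_gt0 fsx; rewrite -/d in d0.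
rewrite /vec_mulgen vec_eval_map (vec_eval_wide sv) -/d.
under eq_bigr do rewrite rmorphB mulrBl rmorphM -mulrA.
rewrite big_split /= sumrN -mulr_sumr.
have := minpoly_coefs_root fsx xa; rewrite -/d => /(congr1 -%R); rewrite opprK => <-.
rewrite mulrN opprK -{1 4}(prednK d0) big_nat_recl //= mul0r add0r.
rewrite [in RHS]big_nat_recr //= mulrDr mulr_sumr mulrCA -exprS prednK //.
by congr (_ + _); apply: eq_bigr => i _; rewrite exprS; ring.
Qed.

Lemma vec_norm_ge B v : `|a| <= B%:R -> `|ev v| <= (vec_norm B v)%:R.
Proof.
move=> leB; rewrite (@vec_eval_wide v (size v)) // /vec_norm natr_sum.
apply: le_trans (ler_norm_sum _ _ _) _; apply: ler_sum => i _.
rewrite normrM normrX natrM natrX -intr_norm -abszE -pmulrn ler_wpM2l ?ler0n //.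
by rewrite lerXn2r ?nnegrE ?ler0n.
Qed.

Lemma size_vec_add u v : size (vec_add d u v) = d.
Proof. by rewrite size_map size_iota. Qed.

Lemma size_taylor_shift G : size (taylor_shift fs G) = size G.
Proof. by elim: G => //= c G IHG; rewrite size_map size_iota IHG. Qed.

Lemma taylor_shift_sizes G : all (fun v => size v == d) (taylor_shift fs G).
Proof.
case: G => // c G; apply/allP => w.
by rewrite -[taylor_shift _ _]/(taylor_cons fs c _) => /mapP[j _ ->]; rewrite size_vec_add.
Qed.

Lemma all_nth_size (H : seq (seq int)) j :
  all (fun v => size v == d) H -> (size (nth [::] H j) <= d)%N.
Proof.
move/allP=> sH; have [lt|ge] := ltnP j (size H); last by rewrite nth_default.
by rewrite (eqP (sH _ (mem_nth _ lt))).
Qed.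

Lemma tower_taylor_cons c H : size c = d -> all (fun v => size v == d) H ->
  tower_poly (taylor_cons fs c H) a =
  (2 ^+ size H * ev c)%:P + ('X + a%:P) * tower_poly H a.
Proof.
move=> sc sH; apply/polyP=> j.
rewrite mulrDl coefD coefD coefC coefXM coefCM !coef_tower_poly -!/(ev _).
have [ltj|gej] := ltnP j (size H).+1; last first.
  rewrite !nth_default ?size_map ?size_iota //; [| exact: ltnW | by case: (j) gej].
  by case: j gej => // j _; rewrite /ev /intpoly rmorph0 horner0 mulr0 !addr0.
rewrite (nth_map 0%N) ?size_iota // nth_iota //= add0n.
rewrite -/d vec_eval_add ?vec_eval_mulgen ?all_nth_size //; last 2 first.
- by rewrite /= size_map sc eqxx.
- by rewrite size_map size_iota.
rewrite addrA; congr (_ + _); case: j {ltj} => [|j] /=; last by rewrite add0r.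
by rewrite vec_eval_scale addr0 rmorphXn.
Qed.

Lemma tower_taylor_shift G y : all (fun v => size v == d) G ->
  2 * (tower_poly (taylor_shift fs G) a).[y] =
  2 ^+ size G * (tower_poly G a).[(y + a) / 2].
Proof.
elim: G => [|c G IHG] /=; first by rewrite /tower_poly !horner0 !mulr0.
move=> /andP[/eqP sc sG]; rewrite tower_taylor_cons ?taylor_shift_sizes //.
rewrite {2}/tower_poly /= horner_cons -/(tower_poly G a) -/(ev c).
rewrite !(hornerD, hornerM, hornerC, hornerX) mulrDr.
rewrite [2 * ((y + a) * _)]mulrCA IHG // size_taylor_shift.
by rewrite exprS; field.
Qed.

(** If a root [y] had [|y| >= u / v], its leading term would outweigh the
    others. *)
Lemma small_tail_root B u v H y :
    `|a| <= B%:R -> (0 < u)%N -> (0 < v)%N -> (0 < size H)%N ->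
    ev (last [::] H) = 1 -> (1 <= vec_norm B (last [::] H))%N ->
    small_tail B u v H -> root (tower_poly H a) y ->
  `|y| < u%:R / v%:R.
Proof.
move=> leB u0 v0 sH lastH nlast small rooty.
have u0' : 0 < u%:R :> algC by rewrite ltr0n.
have v0' : 0 < v%:R :> algC by rewrite ltr0n.
set rho := _ / _; have rho0 : 0 < rho by rewrite divr_gt0.
rewrite real_ltNge ?normr_real ?gtr0_real //; apply/negP => le_y.
have y0 : 0 < `|y| by apply: lt_le_trans le_y.
pose N := (size H).-1; have szH : size H = N.+1 by rewrite prednK.
have lastE : nth [::] H N = last [::] H by rewrite nth_last.
move: small; rewrite /small_tail -/N szH big_nat_recr //= subnn expn0 muln1 lastE.
set T := (\sum_(0 <= j < N) _)%N => small.
suff : (u ^ N <= T)%N.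
  move=> le; move: small; rewrite ltnNge mul2n -addnn leq_add //.
  by rewrite leq_pmull.
have : y ^+ N = - \sum_(0 <= j < N) ev (nth [::] H j) * y ^+ j.
  apply/eqP; rewrite -addr_eq0 addrC; move: rooty; rewrite rootE.
  rewrite (@horner_coef_wide _ N.+1); last first.
    by rewrite -szH (leq_trans (size_Poly _)) // size_map.
  rewrite big_ord_recr /= !coef_tower_poly lastE -/(ev _) lastH mul1r.
  rewrite -(big_mkord xpredT (fun j => (tower_poly H a)`_j * y ^+ j)).
  by under eq_bigr do rewrite coef_tower_poly.
move/(congr1 (fun z => `|z|)); rewrite normrN normrX => eqN.
have leN : `|y| ^+ N <= \sum_(0 <= j < N) (vec_norm B (nth [::] H j))%:R * `|y| ^+ j.
  rewrite eqN; apply: le_trans (ler_norm_sum _ _ _) _; apply: ler_sum => j _.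
  by rewrite normrM normrX ler_wpM2r ?exprn_ge0 ?vec_norm_ge.
have : `|y| ^+ N * rho ^+ N <=
    `|y| ^+ N * \sum_(0 <= j < N) (vec_norm B (nth [::] H j))%:R * rho ^+ j.
  apply: (le_trans (ler_wpM2r (exprn_ge0 N (ltW rho0)) leN)).
  rewrite mulr_suml mulr_sumr !big_nat; apply: ler_sum => j /= ltj.
  rewrite -mulrA [leRHS]mulrCA; apply: ler_wpM2l; first exact: ler0n.
  rewrite -{1}(subnK (ltnW ltj)) [rho ^+ (_ + _)]exprD mulrA.
  rewrite ler_wpM2r ?exprn_ge0 ?(ltW rho0) //.
  rewrite -[in leRHS](subnK (ltnW ltj)) [leRHS]exprD mulrC ler_wpM2r ?exprn_ge0 //.
  by rewrite lerXn2r ?nnegrE ?(ltW rho0).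
rewrite ler_pM2l ?exprn_gt0 // -(ler_pM2r (exprn_gt0 N v0')) -exprMn.
rewrite divfK ?gt_eqF // mulr_suml => le.
rewrite -(ler_nat algC) natrX; apply: le_trans le _.
rewrite /T natr_sum !big_nat; apply: ler_sum => j /= ltj.
rewrite natrM -mulrA ler_wpM2l ?ler0n // natrM !natrX /rho expr_div_n.
rewrite -{1}(subnKC (ltnW ltj)) exprD mulrA divfK // expf_neq0 // gt_eqF //.
Qed.

End VectorSemantics.

(** * Towers describe decompositions *)

Lemma lead_taylor_shift fs x a G : minpoly_coefs fs x -> a \in conjugates x ->
    all (fun v => size v == (size fs).-1) G ->
  (tower_poly (taylor_shift fs G) a)`_(size G).-1 = (tower_poly G a)`_(size G).-1.
Proof.
move=> fsx xa; elim: G => // c G IHG /andP[/eqP sc sG].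
rewrite -[taylor_shift _ _]/(taylor_cons fs c (taylor_shift fs G)).
rewrite (tower_taylor_cons fsx xa) ?taylor_shift_sizes //.
rewrite mulrDl !coefD coefC coefXM coefCM /= size_taylor_shift.
have top : (tower_poly (taylor_shift fs G) a)`_(size G) = 0.
  by rewrite nth_default // (leq_trans (size_Poly _)) // size_map size_taylor_shift.
rewrite top mulr0 addr0; case: G sG IHG top => [|c' G] sG IHG top.
  by rewrite /= expr0 mul1r addr0 coef_tower_poly.
by rewrite [LHS]add0r [LHS]IHG // !coef_tower_poly.
Qed.

Section TowerSoundness.
Context (fs : seq int) (x : algC) (fsx : minpoly_coefs fs x).
Context (p : nat) (k : int) (ws : seq (seq int)).
Hypothesis ws2 : (2 <= size ws)%N.
Hypothesis ws_size : all (fun w => size w == (size fs).-1) ws.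
Let d := (size fs).-1.
Let G := tower fs p k ws.

Lemma size_tower : size G = (size ws).+1.
Proof. by rewrite /G /= size_rcons size_map size_behead prednK // ltnW. Qed.

Lemma last_tower : last [::] G = vec_one d.
Proof. by rewrite /G /= last_rcons. Qed.

Lemma tower_sizes : all (fun w => size w == d) G.
Proof.
rewrite /G /= size_map size_iota eqxx all_rcons size_map size_iota eqxx /=.
apply/allP=> _ /mapP[w ww ->]; rewrite size_map; apply: (allP ws_size).
exact: mem_behead.
Qed.

Lemma tower_coef_mid a i : a \in conjugates x -> (0 < i)%N -> (i < size ws)%N ->
  (tower_poly G a)`_i = (p ^ 2)%:R * (intpoly (nth [::] ws i)).[a].
Proof.
move=> xa; case: i => // i _ lti; rewrite coef_tower_poly /G /= nth_rcons size_map size_behead.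
have lti' : (i < (size ws).-1)%N by rewrite -ltnS prednK // ltnW.
rewrite lti' (nth_map [::]) ?size_behead // nth_behead.
by rewrite vec_eval_scale -pmulrn.
Qed.

Lemma tower_coef0 a : a \in conjugates x ->
  (tower_poly G a)`_0 = a - k%:~R + (p ^ 2)%:R * (intpoly (nth [::] ws 0)).[a].
Proof.
move=> xa; have s1 : size (vec_one d) = d by rewrite size_map size_iota.
rewrite coef_tower_poly /G /= vec_eval_add ?size_map ?size_iota //; last first.
  exact: all_nth_size ws_size.
rewrite vec_eval_add ?size_map ?size_iota // !vec_eval_scale.
rewrite (vec_eval_mulgen fsx xa) ?s1 // (vec_eval_one _ fsx) rmorphN /= -pmulrn; ring.
Qed.

Lemma tower_monic a : a \in conjugates x -> tower_poly G a \is monic /\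
  size (tower_poly G a) = (size ws).+1.
Proof.
move=> xa; have lastE : last 0 [seq (intpoly v).[a] | v <- G] = 1.
  have := vec_eval_one a fsx; rewrite -/d -last_tower => <-.
  by rewrite /G /= map_rcons !last_rcons.
have pE : tower_poly G a = [seq (intpoly v).[a] | v <- G] :> seq _.
  by apply: (@PolyK _ 0); rewrite lastE oner_eq0.
by rewrite monicE lead_coefE nth_last pE lastE size_map size_tower.
Qed.

Lemma vec_eval_Aint a v : a \in conjugates x -> (intpoly v).[a] \in Aint.
Proof.
move=> xa; rewrite horner_intpoly; apply: rpred_sum => i _.
by rewrite rpredM ?Aint_int ?rpredX ?(conjugates_Aint (minpoly_coefs_Aint fsx)).
Qed.

Lemma tower_coef_Aint a i : a \in conjugates x -> (tower_poly G a)`_i \in Aint.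
Proof. by move=> xa; rewrite coef_tower_poly vec_eval_Aint. Qed.

Lemma tower_poly_aut (tau : {rmorphism algC -> algC}) (a b : algC) :
  root (tower_poly G a) b -> root (tower_poly G (tau a)) (tau b).
Proof.
rewrite -(fmorph_root tau); congr (root _ _); apply/polyP=> i.
rewrite coef_map !coef_tower_poly /= -horner_map; congr _.[_].
rewrite /intpoly -map_poly_comp; apply: eq_map_poly => n /=.
by rewrite rmorph_int.
Qed.

Lemma conjugate_aut_mem (tau : {rmorphism algC -> algC}) : tau x \in conjugates x.
Proof. by rewrite conjugates_aut conjugates_self. Qed.

Context (n0 : int) (u v : nat).
Hypotheses (pr_p : prime p) (normk : \prod_(a <- conjugates x) (a - k%:~R) = n0%:~R).
Hypotheses (pn0 : (p%:Z %| n0)%Z) (p2n0 : ~~ ((p ^ 2)%:Z %| n0)%Z).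
Hypotheses (u0 : (0 < u)%N) (v0 : (0 < v)%N).
Hypothesis small : small_tail (root_bound fs) u v (taylor_shift fs G).
Hypothesis leq : (u%:R / v%:R) ^+ 2 <= q x.

Lemma tower_minpoly beta : root (tower_poly G x) beta ->
  minpoly_over x beta = [seq [seq c%:~R | c <- v] | v <- G].
Proof.
move=> rootG; have xx := conjugates_self x; have [mon_g szg] := tower_monic xx.
apply: (minpoly_overE fsx) => //.
- exact: tower_sizes.
- by rewrite size_tower ltnS ltnW.
- by rewrite last_tower (vec_eval_one x fsx).
move=> m1 m2 h1 h2 mon1 mon2 Dg D1 D2.
apply: (Eisenstein_over (minpoly_coefs_Aint fsx) pr_p _ normk pn0 p2n0 mon_g
  (tower_coef0 xx) _ Dg mon1 mon2 D1 D2).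
  exact: vec_eval_Aint.
rewrite szg /= => i i0 lti; exists (p%:R * (intpoly (nth [::] ws i)).[x]).
  by rewrite rpredM ?rpred_nat ?vec_eval_Aint.
by rewrite tower_coef_mid // natrX expr2 mulrA.
Qed.

Lemma tower_root_near beta tau : root (tower_poly G x) beta ->
  `|(tau : {rmorphism algC -> algC}) (beta *+ 2 - x)| < u%:R / v%:R.
Proof.
move=> rootG; set a := tau x; have xa : a \in conjugates x by apply: conjugate_aut_mem.
have sH : (0 < size (taylor_shift fs G))%N by rewrite size_taylor_shift size_tower.
have := tower_taylor_shift fsx xa (tau (beta *+ 2 - x)) tower_sizes.
rewrite rmorphB rmorphMn /= -/a subrK -[tau beta *+ 2]mulr_natr mulfK ?pnatr_eq0 //.
have /eqP -> := tower_poly_aut tau rootG.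
rewrite mulr0 => /eqP; rewrite mulf_eq0 pnatr_eq0 /= => rootH.
have evlast : (intpoly (last [::] (taylor_shift fs G))).[a] = 1.
  rewrite -nth_last -coef_tower_poly size_taylor_shift.
  rewrite (lead_taylor_shift fsx xa tower_sizes) coef_tower_poly nth_last last_tower.
  exact: vec_eval_one _ fsx.
apply: (small_tail_root (conjugates_bound fsx xa) u0 v0 sH evlast _ small rootH).
rewrite lt0n; apply/eqP => n0'.
have := vec_norm_ge (last [::] (taylor_shift fs G)) (conjugates_bound fsx xa).
by rewrite evlast n0' normr1 ler10.
Qed.

(** Any root [beta] of the tower will do: its conjugates are close to halves of
    conjugates of [x], which gives the sign of the inner product.  Neither part is
    zero, since [beta] has degree at least 2 over [Q(x)]. *)
Lemma tower_dec : exists2 d : algC * algC,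
  dec x d /\ nontrivial_dec d &
  minpoly_over x d.1 = [seq [seq c%:~R | c <- v] | v <- G].
Proof.
have xx := conjugates_self x; have [mon_g szg] := tower_monic xx.
have [beta rootG] : exists b, root (tower_poly G x) b.
  apply/closed_rootP; first by case: (size _) szg ws2 => // n [->]; case: (size ws).
have DG := tower_minpoly rootG.
exists (beta, x - beta) => //; split.
  apply: near_half_dec; first exact: minpoly_coefs_Aint fsx.
    by apply: root_monic_over_Aint mon_g _ rootG => i; apply: tower_coef_Aint.
  move=> tau; apply: le_trans leq; rewrite lerXn2r ?nnegrE ?normr_ge0 //.
    by rewrite divr_ge0 ?ler0n.
  exact/ltW/tower_root_near.
suff notK : QQgen [:: x; beta] 1 \notin <<1; QQgen [:: x; beta] 0>>%VS.
  split; apply: contraNneq notK => /= b0.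
    suff -> : QQgen [:: x; beta] 1 = 0 by rewrite rpred0.
    by apply: (fmorph_inj (QQval [:: x; beta])); rewrite QQgenK rmorph0.
  suff -> : QQgen [:: x; beta] 1 = QQgen [:: x; beta] 0 by rewrite memv_adjoin.
  apply: (fmorph_inj (QQval [:: x; beta])); rewrite !QQgenK /=.
  by apply/esym/eqP; rewrite -subr_eq0 b0.
apply/negP => /minPoly_XsubC Dm.
have := congr1 size DG; rewrite /minpoly_over !size_map Dm size_XsubC size_tower.
by case: (size ws) ws2 => [|[]].
Qed.

End TowerSoundness.

(** * Rounding to integral coefficients *)

(** Bernoulli's inequality: [u ^ K >= (s + 1) ^ K >= s ^ K + K s ^ (K - 1)]. *)
Lemma exists_pow_lt (C s u : nat) : (s < u)%N -> exists K, (C * s ^ K < u ^ K)%N.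
Proof.
move=> su; pose K := (C * s).+1; exists K.
have le : (s ^ K + K * s ^ K.-1 <= u ^ K)%N.
  apply: (@leq_trans (s.+1 ^ K)%N); last by rewrite leq_exp2r.
  elim: (K) => [|n IHn]; first by rewrite muln1.
  rewrite [leqRHS]expnS; apply: leq_trans (leq_mul (leqnn s.+1) IHn).
  case: n {IHn} => [|n] /=; first by lia.
  by rewrite !expnS; nia.
apply: (leq_trans _ le); have [s0|s0] := posnP s; first by rewrite /K s0 !muln0 /=; lia.
rewrite /K /= expnS; have := expn_gt0 s (C * s); rewrite s0 /=; nia.
Qed.

Lemma geometric_le (s u n : nat) : (s < u)%N ->
  (\sum_(0 <= j < n) s ^ (n.-1 - j) * u ^ j <= u ^ n)%N.
Proof.
move=> su; elim: n => [|n IHn]; first by rewrite big_nil.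
rewrite big_nat_recr //= subnn expn0 mul1n.
rewrite (_ : \sum_(0 <= j < n) _ = s * \sum_(0 <= j < n) s ^ (n.-1 - j) * u ^ j)%N.
  by rewrite expnS; nia.
rewrite big_distrr /= !big_nat; apply: eq_bigr => j /= ltj.
by rewrite mulnA -expnS -subSn ?prednK //; lia.
Qed.

(** From [i 'C(N, i) = N 'C(N - 1, i - 1)], where [N] is the upper index. *)
Lemma dvdn_bin_top (M K r i : nat) : (0 < i)%N -> (i <= K)%N ->
  (M * 2 ^ i %| 'C(M * 2 ^ K * K`! * r, i))%N.
Proof.
case: i => // i _ leiK; set N := (_ * r)%N.
have /dvdnP[z Dz] : (i.+1 %| K`!)%N by rewrite dvdn_fact.
have DN : N = (i.+1 * (M * 2 ^ i.+1 * (2 ^ (K - i.+1) * z * r)))%N.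
  by rewrite /N Dz -{1}(subnKC leiK) expnD; ring.
have := mul_bin_diag N i; rewrite {1}DN -mulnA => /eqP.
by rewrite eqn_pmul2l // => /eqP <-; rewrite -!mulnA dvdn_mul // dvdn_mulr.
Qed.

(** The ring [Z[x]], as a predicate to which the lemmas on subrings apply. *)
Definition int_ring (x : algC) : {pred algC} :=
  fun z => `[< exists P : {poly int}, z = (map_poly intr P).[x] >].

Lemma int_ringP x z :
  reflect (exists P : {poly int}, z = (map_poly intr P).[x]) (z \in int_ring x).
Proof. exact: asboolP. Qed.

Lemma int_ring_closed x : subring_closed (int_ring x).
Proof.
split=> [|y z /int_ringP[P ->] /int_ringP[Q ->]|y z /int_ringP[P ->] /int_ringP[Q ->]];
  apply/int_ringP; [exists 1 | exists (P - Q) | exists (P * Q)].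
- by rewrite rmorph1 hornerC.
- by rewrite rmorphB hornerD hornerN.
- by rewrite rmorphM hornerM.
Qed.

HB.instance Definition _ x :=
  GRing.isSubringClosed.Build _ (int_ring x) (int_ring_closed x).

Lemma int_ring_gen x : x \in int_ring x.
Proof. by apply/int_ringP; exists 'X; rewrite map_polyX hornerX. Qed.

Section Completeness.
Context (fs : seq int) (x : algC) (fsx : minpoly_coefs fs x).
Let d := (size fs).-1.
Let ev (v : seq int) : algC := (intpoly v).[x].
Let xx := conjugates_self x.

Lemma vec_int_ring v : ev v \in int_ring x.
Proof. by apply/int_ringP; exists (Poly v). Qed.

Lemma int_ring_vec z : z \in int_ring x -> exists2 v, size v = d & z = ev v.
Proof.
case/int_ringP=> P ->; elim/poly_ind: P => [|P c [v sv IHP]].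
  exists (nseq d 0); first by rewrite size_nseq.
  rewrite rmorph0 horner0 /ev (@vec_eval_wide x _ d) ?size_nseq // big1_seq // => i _.
  by rewrite nth_nseq if_same mul0r.
exists (vec_add d (vec_mulgen fs v) (vec_scale c (vec_one d))).
  by rewrite size_map size_iota.
rewrite [RHS](vec_eval_add x) ?size_map ?size_iota //.
rewrite (vec_eval_mulgen fsx xx) ?sv // vec_eval_scale (vec_eval_one x fsx) mulr1.
by rewrite rmorphD rmorphM /= map_polyX map_polyC hornerD hornerC hornerMX IHP mulrC.
Qed.

(** A nonzero integer polynomial of degree less than [d] does not vanish at [x]. *)
Lemma vec_eval_inj v w : size v = d -> size w = d -> ev v = ev w -> v = w.
Proof.
move=> sv sw evw; pose P : {poly int} := Poly v - Poly w.
have sP : (size P <= d)%N.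
  rewrite (leq_trans (size_polyD _ _)) // size_polyN geq_max.
  by rewrite (leq_trans (size_Poly _)) ?sv // (leq_trans (size_Poly _)) ?sw.
have rootP : root (map_poly intr P) x.
  by rewrite rootE rmorphB hornerD hornerN /= -/(ev v) -/(ev w) evw subrr.
have P0 : P = 0.
  have [m [Dm mon_m] dv_m] := minCpolyP x.
  have DP : map_poly intr P = map_poly ratr (map_poly intr P : {poly rat}) :> {poly algC}.
    by rewrite -map_poly_comp; apply: eq_map_poly => c /=; rewrite rmorph_int.
  have sPr : size (map_poly intr P : {poly rat}) = size P.
    by apply: size_map_inj_poly => //; apply: intr_inj.
  apply/eqP; rewrite -size_poly_eq0 -sPr size_poly_eq0; apply: contraTT sP => Pr0.
  rewrite -ltnNge -ltnS -(minpoly_coefs_size fsx) ltnS fsx.2 Dm size_map_poly -sPr.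
  by apply: dvdp_leq => //; rewrite -dv_m -DP.
apply: (@eq_from_nth _ 0); rewrite ?sv ?sw // => i _.
have := congr1 (fun p : {poly int} => p`_i) P0.
by rewrite coefB !coef_Poly coef0 => /eqP; rewrite subr_eq0 => /eqP.
Qed.

(** Divide each coordinate by [n]; the remainders are less than [n]. *)
Lemma int_ring_mod z (n : nat) (B : nat) : z \in int_ring x -> (0 < n)%N ->
  exists v z', [/\ size v = d, z' \in int_ring x, z = ev v + n%:R * z'
    & (vec_norm B v <= n * \sum_(0 <= i < d) B ^ i)%N].
Proof.
move=> /int_ring_vec[w sw ->] n0.
pose v := [seq (c %% n)%Z | c <- w]; pose t := [seq (c %/ n)%Z | c <- w].
have n0' : n%:Z != 0 by rewrite eqz_nat -lt0n.
exists v, (ev t); split; rewrite ?size_map ?vec_int_ring //.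
  rewrite /ev !(vec_eval_wide x (_ : size _ <= d)%N) ?size_map ?sw //.
  rewrite mulr_sumr -big_split /= !big_nat; apply: eq_bigr => i /= lti.
  rewrite !(nth_map 0) ?sw // {1}(divz_eq w`_i n) rmorphD rmorphM /= -pmulrn; ring.
rewrite /vec_norm size_map sw big_distrr /= !big_nat; apply: leq_sum => i /= lti.
rewrite leq_mul2r (nth_map 0) ?sw // -lez_nat; apply/orP; right.
by rewrite gez0_abs ?modz_ge0 // ltW // ltz_pmod // ltz_nat.
Qed.

Let sub2 : {poly algC} := 2 *: 'X - x%:P.

(** Substitute [2X] for [X] in [h(X - x)]. *)
Lemma coef_sub2 (h : {poly algC}) j :
  (h \Po sub2)`_j = 2 ^+ j * (h \Po ('X - x%:P))`_j.
Proof.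
have -> : sub2 = ('X - x%:P) \Po (2 *: 'X).
  by rewrite /sub2 comp_polyB comp_polyX comp_polyC.
rewrite comp_polyA [LHS]coef_comp_poly; set r := h \Po _.
under eq_bigr do rewrite exprZn coefZ coefXn.
have [lt|ge] := ltnP j (size r).
  rewrite (bigD1 (Ordinal lt)) //= eqxx mulr1 big1 ?addr0 1?mulrC // => i ne.
  have -> : (j == i) = false by apply: contraNF ne => /eqP e; apply/eqP/val_inj.
  by rewrite !mulr0.
rewrite [in RHS]nth_default // mulr0 big1 // => i _.
by rewrite gtn_eqF ?mulr0 // (leq_trans (ltn_ord i)).
Qed.

Lemma coef_exp_sub2 i j : (i <= j)%N -> (sub2 ^+ i)`_j = 2 ^+ i *+ (i == j).
Proof.
move=> leij; have -> : sub2 ^+ i = 'X^i \Po sub2 by rewrite comp_Xn_poly.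
rewrite coef_sub2 comp_Xn_poly.
have [<-|ne] := eqVneq i j.
  have : ('X - x%:P) ^+ i \is monic by rewrite monic_exp ?monicXsubC.
  by rewrite monicE lead_coefE size_exp_XsubC => /eqP->; rewrite mulr1.
by rewrite nth_default ?mulr0 // size_exp_XsubC ltn_neqAle ne.
Qed.

Context (M N K B : nat) (target : nat -> algC).
Hypothesis M0 : (0 < M)%N.
Hypothesis leKN : (K < N)%N.
Hypothesis target_int : forall j, target j \in int_ring x.
Hypothesis target_top : forall j, (0 < j)%N -> target j = 0.
Hypothesis bin_top : forall i, (0 < i)%N -> (i <= K)%N -> (M * 2 ^ i %| 'C(N, i))%N.

Let bound j := if (j < N - K)%N then (M * 2 ^ (N - j) * \sum_(0 <= i < d) B ^ i)%N else 0%N.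

(** Invariant of the rounding: the coefficients of [h] of index less than [L] are
    still zero, and the coefficients of [2 ^ -N h(2X - x)] of index at least
    [L] have already been moved to the wanted classes modulo [M]. *)
Let rounded (L : nat) (h : {poly algC}) : Prop :=
  [/\ h \is monic, size h = N.+1, forall j, (j < L)%N -> h`_j = 0,
      forall j, (j < N)%N -> exists2 v, size v = d &
         h`_j = ev v /\ (vec_norm B v <= bound j)%N
    & forall j, (L <= j)%N -> (j < N)%N -> exists2 w, w \in int_ring x &
        (h \Po sub2)`_j = 2 ^+ N * (target j + M%:R * w)].

Lemma vec0 : [/\ size (nseq d (0 : int)) = d, ev (nseq d 0) = 0 & vec_norm B (nseq d 0) = 0%N].
Proof.
split; first by rewrite size_nseq.
  rewrite /ev (@vec_eval_wide x _ d) ?size_nseq // big1_seq // => i _.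
  by rewrite nth_nseq if_same mul0r.
by rewrite /vec_norm big1_seq // => i _; rewrite nth_nseq if_same.
Qed.

(** The coefficient of index [j] of [(2X - x) ^ N] is
    ['C(N, N - j) 2 ^ j (- x) ^ (N - j)]; for [N - j <= K] the hypothesis on
    binomial coefficients makes it divisible by [2 ^ N M]. *)
Lemma rounded_start : rounded (N - K) 'X^N.
Proof.
split; rewrite ?monicXn ?size_polyXn //.
- move=> j ltj; rewrite coefXn ltn_eqF //.
  by apply: leq_trans ltj _; rewrite leq_subr.
- move=> j ltj; have [s0 e0 n0] := vec0; exists (nseq d 0) => //.
  by rewrite coefXn ltn_eqF // e0 n0.
move=> j leLj ltjN; rewrite target_top ?add0r; last first.
  by apply: leq_trans leLj; rewrite subn_gt0.
have i0 : (0 < N - j)%N by rewrite subn_gt0.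
have leiK : (N - j <= K)%N by lia.
have /dvdnP[z Dz] := bin_top i0 leiK.
exists (z%:R * (- x) ^+ (N - j)).
  by rewrite rpredM ?rpred_nat // rpredX // rpredN int_ring_gen.
rewrite coef_sub2 comp_Xn_poly (exprDn 'X) coef_sum.
have ltNj : (N - j < N.+1)%N by rewrite ltnS leq_subr.
rewrite (bigD1 (Ordinal ltNj)) //= big1 => [|i ne].
  rewrite addr0 subKn 1?ltnW // -polyCN -polyC_exp coefMn coefMC coefXn eqxx mul1r.
  rewrite Dz -[in RHS](subnKC (ltnW ltjN)) exprD -[_ *+ (z * _)]mulr_natr.
  rewrite !natrM natrX addKn; ring.
rewrite -polyCN -polyC_exp coefMn coefMC coefXn.
case: eqP => [e|_]; last by rewrite mul0r mul0rn.
case/eqP: ne; apply: val_inj => /=; rewrite e; lia.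
Qed.

(** Adding [e X ^ L] to [h] changes the coefficient of index [L] of [h(2X - x)],
    which is [2 ^ L z] with [z] in [Z[x]], by [2 ^ L e], and leaves those of
    larger index alone. *)
Lemma rounded_step L h : (L < N - K)%N -> rounded L.+1 h -> exists h', rounded L h'.
Proof.
move=> ltL [mon_h sh low coefs done].
have ltLN : (L < N)%N by apply: leq_trans ltL _; rewrite leq_subr.
have h_int : h \is a polyOver (int_ring x).
  apply/polyOverP=> j; have [ltj|gej|->] := ltngtP j N.
  - by have [v _ [-> _]] := coefs j ltj; apply: vec_int_ring.
  - by rewrite nth_default ?rpred0 // sh.
  by have /eqP := mon_h; rewrite lead_coefE sh /= => ->; rewrite rpred1.
set z := (h \Po ('X - x%:P))`_L.
have z_int : z \in int_ring x.
  by apply/polyOverP/polyOver_comp; rewrite ?polyOverXsubC ?int_ring_gen.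
have P0 : (0 < M * 2 ^ (N - L))%N by rewrite muln_gt0 M0 expn_gt0.
have [|v [z' [sv z'_int Dz le_v]]] :=
  @int_ring_mod (2 ^+ (N - L) * target L - z) (M * 2 ^ (N - L)) B _ P0.
  by rewrite rpredB ?rpredM ?rpredX ?rpred_nat.
exists (h + ev v *: 'X^L).
have sL : (size (ev v *: 'X^L : {poly algC}) < size h)%N.
  by rewrite sh ltnS (leq_trans (size_scale_leq _ _)) ?size_polyXn.
have sh' : size (h + ev v *: 'X^L) = N.+1 by rewrite size_polyDl.
split=> //.
- by rewrite monicE lead_coefDl // (monicP mon_h).
- by move=> j ltj; rewrite coefD coefZ coefXn ltn_eqF // mulr0 addr0 low // ltnW.
- move=> j ltj; rewrite coefD coefZ coefXn.
  have [->|ne] := eqVneq j L; last by rewrite mulr0 addr0; apply: coefs.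
  by exists v; rewrite // low // add0r mulr1 /bound ltL.
move=> j leLj ltj; rewrite comp_polyD comp_polyZ comp_Xn_poly coefD coefZ.
rewrite coef_exp_sub2 //; move: leLj; rewrite leq_eqVlt => /orP[/eqP <-|ltLj]; last first.
  by rewrite ltn_eqF // mulr0 addr0; apply: done.
rewrite eqxx mulr1n coef_sub2 -/z; exists (- z'); first by rewrite rpredN.
have -> : ev v = 2 ^+ (N - L) * target L - z - (M * 2 ^ (N - L))%:R * z'.
  by rewrite Dz addrK.
rewrite -[in RHS](subnKC (ltnW ltLN)) exprD natrM natrX; ring.
Qed.

Lemma rounded_end : exists h, rounded 0 h.
Proof.
suff H L : (L <= N - K)%N -> exists h, rounded (N - K - L) h.
  by have := H _ (leqnn _); rewrite subnn.
elim: L => [|L IHL] leL; first by exists 'X^N; rewrite subn0; apply: rounded_start.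
have [|h hP] := IHL; first exact: ltnW.
apply: (@rounded_step _ h); first by lia.
by rewrite -subSn // subSS.
Qed.

End Completeness.

Lemma poly_eq_horner (g h : {poly algC}) : (forall y, g.[y] = h.[y]) -> g = h.
Proof.
move=> e; apply/eqP; rewrite -subr_eq0; apply/negPn/negP => nz.
have [|t] := @poly_nonroot algC (g - h) (fun n => n%:R) nz.
  by move=> m n /eqP; rewrite eqr_nat => /eqP.
by rewrite hornerD hornerN e subrr eqxx.
Qed.

(** Towers of arbitrarily large degree.  Start from [h = y ^ N] with [N] highly
    divisible, so that the top [K] coefficients of [h(2X - x)] need no change,
    and round the others; the change is dominated by [y ^ N] outside the disc
    of radius [u / v] because [2 < u / v] and [K] is large. *)
Lemma good_tower_exists fs x (p u v n0 : nat) (k : int) :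
    minpoly_coefs fs x -> (0 < p)%N -> (0 < v)%N -> (2 * v < u)%N ->
  exists2 ws, (n0 <= size ws)%N & good_tower fs p k u v ws.
Proof.
move=> fsx p0 v0 uv; set d := (size fs).-1; set B := root_bound fs.
have xx := conjugates_self x; have d0 := minpoly_coefs_degree_gt0 fsx; rewrite -/d in d0.
pose M := (p ^ 2)%N; have M0 : (0 < M)%N by rewrite expn_gt0 p0.
pose C := (M * (\sum_(0 <= i < d) B ^ i))%N; pose s := (2 * v)%N.
have s0 : (0 < s)%N by rewrite muln_gt0.
(* The rounding errors sum up to at most [C s ^ (K + 1) u ^ (N - K)]. *)
have [K ltK] := exists_pow_lt (C * s) uv.
pose N := (M * 2 ^ K * K`! * (n0 + K + 2))%N.
have leN : (n0 + K + 2 <= N)%N.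
  by apply: leq_pmull; rewrite muln_gt0 fact_gt0 andbT muln_gt0 expn_gt0 andbT.
have ltKN : (K < N)%N by apply: leq_trans leN; lia.
pose target j := if j == 0%N then x - k%:~R else 0 : algC.
have [|||||h [mon_h sh _ coefs done]] := @rounded_end fs x fsx M N K B target.
- exact: M0.
- exact: ltKN.
- move=> j; rewrite /target; case: ifP => _; rewrite ?rpred0 // rpredB ?int_ring_gen //.
  exact: rpred_int.
- by case.
- move=> i i0 leiK; exact: dvdn_bin_top.
pose bound j := if (j < N - K)%N then (M * 2 ^ (N - j) * \sum_(0 <= i < d) B ^ i)%N else 0%N.
have {}coefs j : (j < N)%N -> exists2 v, size v = d &
    h`_j = (intpoly v).[x] /\ (vec_norm B v <= bound j)%N by exact: coefs.
have /choice[w Dw] : forall j, exists w, (j < N)%N -> size w = d /\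
    (h \Po (2 *: 'X - x%:P))`_j = 2 ^+ N * (target j + M%:R * (intpoly w).[x]).
  move=> j; have [ltj|] := boolP (j < N)%N; last by exists [::].
  have [z /(int_ring_vec fsx)[w sw ->] Dz] := done j isT ltj.
  by exists w.
pose ws := mkseq w N; have szw : size ws = N by rewrite size_mkseq.
have nthw j : (j < N)%N -> nth [::] ws j = w j by move=> ltj; rewrite nth_mkseq.
have N2 : (2 <= size ws)%N by rewrite szw; lia.
have sws : all (fun w => size w == d) ws.
  by apply/allP=> y /mapP[j]; rewrite mem_iota add0n => /Dw[sw _] ->; rewrite sw.
exists ws; first by rewrite szw; lia.
apply/and3P; split=> //; set G := tower fs p k ws; set H := taylor_shift fs G.
have szH : size H = N.+1 by rewrite size_taylor_shift size_tower // szw.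
have Gx : 2 ^+ N *: tower_poly G x = h \Po (2 *: 'X - x%:P).
  apply/polyP=> j; rewrite coefZ.
  have [ltj|gej|->] := ltngtP j N.
  - have [_ ->] := Dw j ltj; congr (_ * _); rewrite /target.
    case: j ltj => [|j] ltj.
      by rewrite (tower_coef0 fsx _ _ sws xx) nthw.
    by rewrite (tower_coef_mid _ _ _ N2 xx) ?szw // nthw // add0r.
  - rewrite coef_sub2 (@nth_default _ _ (h \Po _)) ?mulr0; last first.
      by rewrite size_comp_poly2 ?sh ?size_XsubC.
    rewrite nth_default ?mulr0 //.
    by have [_ ->] := tower_monic fsx p k N2 xx; rewrite szw.
  have [mon_G szG] := tower_monic fsx p k N2 xx.
  have -> : (tower_poly G x)`_N = 1.
    by move: mon_G; rewrite monicE lead_coefE szG szw => /eqP.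
  rewrite coef_sub2; congr (_ * _); apply/esym.
  have : h \Po ('X - x%:P) \is monic.
    rewrite monicE lead_coef_comp ?size_XsubC // (monicP mon_h) mul1r.
    by rewrite lead_coefXsubC expr1n.
  by rewrite monicE lead_coefE size_comp_poly2 ?size_XsubC // sh => /eqP.
(* [taylor_shift] inverts the substitution of [2X - x]. *)
have DH : tower_poly H x = h.
  apply: poly_eq_horner => y; apply: (@mulfI _ 2); first by rewrite pnatr_eq0.
  rewrite (tower_taylor_shift fsx xx) ?tower_sizes // size_tower // szw exprS -mulrA.
  congr (_ * _); rewrite -hornerZ Gx horner_comp; congr _.[_].
  by rewrite hornerD hornerN hornerZ hornerX hornerC; field.
have sizeH j : (j < N.+1)%N -> size (nth [::] H j) = d.
  move=> ltj; apply/eqP; apply: (allP (taylor_shift_sizes fs G)).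
  by rewrite mem_nth // -/H szH.
have evH j : (intpoly (nth [::] H j)).[x] = h`_j by rewrite -coef_tower_poly DH.
have normH j : (j < N)%N -> (vec_norm B (nth [::] H j) <= bound j)%N.
  move=> ltj; have [z sz [Dz le_z]] := coefs j ltj.
  rewrite (_ : nth [::] H j = z) //; apply: (vec_eval_inj fsx) => //.
    by apply: sizeH; apply: ltnW.
  by rewrite evH.
have normN : vec_norm B (nth [::] H N) = 1%N.
  rewrite (_ : nth [::] H N = vec_one d).
    rewrite /vec_norm size_map size_iota -(prednK d0) big_nat_recl //=.
    rewrite big1_seq ?addn0 // => i; rewrite mem_index_iota => /andP[_ /andP[_ lti]].
    by rewrite (nth_map 0%N) ?size_iota // nth_iota.
  apply: (vec_eval_inj fsx); rewrite ?sizeH ?size_map ?size_iota //.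
  rewrite evH (vec_eval_one x fsx); move: mon_h.
  by rewrite monicE lead_coefE sh => /eqP.
rewrite /small_tail -/H szH big_nat_recr //= subnn expn0 muln1 normN mul1n.
rewrite mul2n -addnn ltn_add2r.
apply: (@leq_ltn_trans (\sum_(0 <= j < N) bound j * (u ^ j * v ^ (N - j)))%N).
  by rewrite !big_nat; apply: leq_sum => j /= ltj; rewrite leq_mul2r normH ?orbT.
rewrite (@big_cat_nat _ _ _ (N - K)) ?leq_subr //=.
rewrite [X in (_ + X)%N]big1_seq => [|j]; last first.
  by rewrite mem_index_iota /bound => /andP[_ /andP[leNj _]]; rewrite ltnNge leNj.
rewrite addn0.
apply: (@leq_ltn_trans (C * s * s ^ K * \sum_(0 <= j < N - K) s ^ ((N - K).-1 - j) * u ^ j)%N).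
  rewrite big_distrr /= !big_nat; apply: leq_sum => j /= ltj.
  rewrite /bound ltj -/C -/d -/B.
  have e : (s * s ^ K * s ^ ((N - K).-1 - j) = 2 ^ (N - j) * v ^ (N - j))%N.
    by rewrite -expnS -expnD -expnMn; congr (_ ^ _)%N; lia.
  rewrite (_ : C * s * s ^ K * _ =
    C * (s * s ^ K * s ^ ((N - K).-1 - j)) * u ^ j)%N; last by ring.
  by rewrite e /C; apply/eq_leq; ring.
apply: (@leq_ltn_trans (C * s * s ^ K * u ^ (N - K))%N).
  by rewrite leq_mul2l geometric_le ?orbT.
by rewrite -{2}(subnKC (ltnW ltKN)) expnD ltn_pmul2r // expn_gt0; lia.
Qed.

(** * Closure properties of computable functions *)

(** The programs below are never written out: they are assembled along the
    definitions of the functions on typed data that they compute up to encoding.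
    Speed does not matter, so numbers are in unary. *)
Class Enc (A : Type) := enc : A -> tree.

Fixpoint unary (n : nat) : tree := if n is n'.+1 then Node Leaf (unary n') else Leaf.
(** Integers are pairs of their positive and negative parts, so that all operations
    reduce to truncated ones on natural numbers. *)
Definition int_pos (z : int) : nat := if z is Posz n then n else 0%N.
Definition int_neg (z : int) : nat := if z is Negz n then n.+1 else 0%N.

#[export] Instance Enc_tree : Enc tree := id.
#[export] Instance Enc_bool : Enc bool := enc_bool.
#[export] Instance Enc_nat : Enc nat := unary.
#[export] Instance Enc_prod A B (eA : Enc A) (eB : Enc B) : Enc (A * B) :=
  fun p => Node (eA p.1) (eB p.2).
#[export] Instance Enc_seq A (eA : Enc A) : Enc (seq A) := enc_seq eA.
#[export] Instance Enc_int : Enc int := fun z => Node (unary (int_pos z)) (unary (int_neg z)).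

Definition computable A B (eA : Enc A) (eB : Enc B) (f : A -> B) : Prop :=
  exists p, forall a, eval p (eA a) (eB (f a)).
Arguments computable {A B eA eB} f.

Lemma comp_id {A} {eA : Enc A} : computable (fun a : A => a).
Proof. by exists PId => a; apply: EvId. Qed.

Lemma comp_comp {A} {eA : Enc A} {B} {eB : Enc B} {C} {eC : Enc C}
    (f : A -> B) (g : B -> C) :
  computable f -> computable g -> computable (fun a => g (f a)).
Proof. by case=> p Hp [r Hr]; exists (PSeq p r) => a; apply: EvSeq (Hp a) (Hr _). Qed.

Lemma comp_const {A} {eA : Enc A} {B} {eB : Enc B} (b : B) : computable (fun _ : A => b).
Proof.
suff [p Hp] : exists p, forall x, eval p x (eB b) by exists p => a; apply: Hp.
elim: (eB b) => [|l [p Hp] r [s Hs]]; first by exists PLeaf => x; apply: EvLeaf.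
by exists (PNode p s) => x; apply: EvNode.
Qed.

Lemma comp_pair {A} {eA : Enc A} {B} {eB : Enc B} {C} {eC : Enc C}
    (f : A -> B) (g : A -> C) :
  computable f -> computable g -> computable (fun a => (f a, g a)).
Proof. by case=> p Hp [r Hr]; exists (PNode p r) => a; apply: EvNode. Qed.

Lemma comp_fst {A} {eA : Enc A} {B} {eB : Enc B} {C} {eC : Enc C} (f : A -> B * C) :
  computable f -> computable (fun a => (f a).1).
Proof.
case=> p Hp; exists (PSeq p PLeft) => a; apply: EvSeq (Hp a) _.
exact: (EvLeft (Node _ _)).
Qed.

Lemma comp_snd {A} {eA : Enc A} {B} {eB : Enc B} {C} {eC : Enc C} (f : A -> B * C) :
  computable f -> computable (fun a => (f a).2).
Proof.
case=> p Hp; exists (PSeq p PRight) => a; apply: EvSeq (Hp a) _.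
exact: (EvRight (Node _ _)).
Qed.

Lemma comp_if {A} {eA : Enc A} {B} {eB : Enc B} (b : A -> bool) (f g : A -> B) :
  computable b -> computable f -> computable g ->
  computable (fun a => if b a then f a else g a).
Proof.
case=> p Hp [r Hr] [s Hs]; exists (PIf p r s) => a; have := Hp a.
case: (b a) => /= Hb; [exact: EvIfTrue Hb (Hr a) | exact: EvIfFalse Hb (Hs a)].
Qed.

(** Changes of representation cost nothing: functions that agree after encoding
    have the same programs. *)
Lemma comp_recode {A} {eA : Enc A} {B} {eB : Enc B} {C} {eC : Enc C}
    (f : A -> B) (g : A -> C) :
  (forall a, eC (g a) = eB (f a)) -> computable f -> computable g.
Proof. by move=> e [p Hp]; exists p => a; rewrite e. Qed.

Lemma comp_ext {A} {eA : Enc A} {B} {eB : Enc B}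
    (f g : A -> B) : f =1 g -> computable f -> computable g.
Proof. by move=> e [p Hp]; exists p => a; rewrite -e. Qed.

Lemma comp_Node {A} {eA : Enc A} (f g : A -> tree) :
  computable f -> computable g -> computable (fun a => Node (f a) (g a)).
Proof. by case=> p Hp [r Hr]; exists (PNode p r) => a; apply: EvNode. Qed.

Lemma comp_left {A} {eA : Enc A} (f : A -> tree) :
  computable f -> computable (fun a => left_tree (f a)).
Proof. by case=> p Hp; exists (PSeq p PLeft) => a; apply: EvSeq (Hp a) (EvLeft _). Qed.

Lemma comp_right {A} {eA : Enc A} (f : A -> tree) :
  computable f -> computable (fun a => right_tree (f a)).
Proof. by case=> p Hp; exists (PSeq p PRight) => a; apply: EvSeq (Hp a) (EvRight _). Qed.

Definition is_node (t : tree) : bool := if t is Node _ _ then true else false.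

Lemma comp_is_node {A} {eA : Enc A} (f : A -> tree) :
  computable f -> computable (fun a => is_node (f a)).
Proof.
case=> p Hp; exists (PIf p (PNode PLeaf PLeaf) PLeaf) => a; have := Hp a.
case: (f a) => [|l r] Hf; first exact: EvIfFalse Hf (EvLeaf _).
apply: EvIfTrue Hf _; apply: EvNode; exact: EvLeaf.
Qed.

Lemma comp_cons {A} {eA : Enc A} {B} {eB : Enc B} (f : A -> B) (g : A -> seq B) :
  computable f -> computable g -> computable (fun a => f a :: g a).
Proof. by case=> p Hp [r Hr]; exists (PNode p r) => a; apply: EvNode. Qed.

Lemma comp_behead {A} {eA : Enc A} {B} {eB : Enc B} (f : A -> seq B) :
  computable f -> computable (fun a => behead (f a)).
Proof.
case=> p Hp; exists (PSeq p PRight) => a; apply: EvSeq (Hp a) _.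
by case: (f a) => [|b s]; apply: EvRight.
Qed.

Lemma comp_head {A} {eA : Enc A} {B} {eB : Enc B} (b0 : A -> B) (f : A -> seq B) :
  computable b0 -> computable f -> computable (fun a => head (b0 a) (f a)).
Proof.
case=> r Hr [p Hp]; exists (PIf p (PSeq p PLeft) r) => a; have := Hp a.
case: (f a) => [|b s] Hf; first exact: EvIfFalse Hf (Hr a).
exact: EvIfTrue (Hf) (EvSeq (Hf) (EvLeft (Node _ _))).
Qed.

(** For searches, whose number of turns is not known in advance. *)
Lemma eval_while A (eA : Enc A) (b : A -> bool) (f : A -> A) :
    computable b -> computable f ->
  exists p, forall a k, (forall j, (j < k)%N -> b (iter j f a)) -> ~~ b (iter k f a) ->
    eval p (enc a) (enc (iter k f a)).
Proof.
case=> c Hc [p Hp]; exists (PWhile c p) => a k.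
elim: k a => [|k IHk] a Hj /negPf Hk.
  by apply: EvWhileStop; have := Hc a; rewrite -[a]/(iter 0 f a) Hk.
have b0 : b a by apply: (Hj 0%N).
have H0 := Hc a; rewrite b0 in H0.
apply: EvWhileStep H0 (Hp a) _; rewrite iterSr; apply: IHk.
  by move=> j ltj; have := Hj j.+1 ltj; rewrite iterSr.
by rewrite -iterSr Hk.
Qed.

(** The loop keeps the argument, the accumulator and the rest of the list; the
    function gets the argument as an environment for its free variables. *)
Lemma comp_foldl {A} {eA : Enc A} {B} {eB : Enc B} {C} {eC : Enc C}
    (F : A -> B -> C -> B) (b0 : A -> B) (s : A -> seq C) :
    computable (fun p : A * B * C => F p.1.1 p.1.2 p.2) ->
    computable b0 -> computable s ->
  computable (fun a => foldl (F a) (b0 a) (s a)).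
Proof.
case=> pF HF [pb Hb] [ps Hs].
pose tl := PSeq PRight PRight.
pose step := PNode PLeft (PNode (PSeq (PNode (PNode PLeft (PSeq PRight PLeft))
                                             (PSeq tl PLeft)) pF) (PSeq tl PRight)).
have tlE t u v : eval tl (Node t (Node u v)) v.
  exact: (EvSeq (EvRight (Node t (Node u v))) (EvRight (Node u v))).
have stepE a b c r : eval step (Node (eA a) (Node (eB b) (Node (eC c) r)))
                               (Node (eA a) (Node (eB (F a b c)) r)).
  apply: EvNode; first exact: (EvLeft (Node _ _)).
  apply: EvNode; last by apply: EvSeq (tlE _ _ _) _; exact: (EvRight (Node _ _)).
  apply: EvSeq (HF (a, b, c)).
  apply: EvNode; last by apply: EvSeq (tlE _ _ _) _; exact: (EvLeft (Node _ _)).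
  apply: EvNode; first exact: (EvLeft (Node _ _)).
  apply: EvSeq; first exact: (EvRight (Node _ _)).
  exact: (EvLeft (Node _ _)).
exists (PSeq (PNode PId (PNode pb ps)) (PSeq (PWhile tl step) (PSeq PRight PLeft))) => a.
apply: EvSeq.
  by apply: EvNode; [exact: EvId | apply: EvNode; [exact: Hb | exact: Hs]].
apply: (@EvSeq _ _ _ (Node (eA a) (Node (eB (foldl (F a) (b0 a) (s a))) Leaf))); last first.
  by apply: EvSeq; [exact: (EvRight (Node _ _)) | exact: (EvLeft (Node _ _))].
elim: (s a) (b0 a) => [|c r IHr] b /=; first by apply: EvWhileStop; exact: tlE.
by apply: EvWhileStep (IHr _); [exact: tlE | exact: stepE].
Qed.

Lemma comp_rev {A B} {eA : Enc A} {eB : Enc B} (s : A -> seq B) :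
  computable s -> computable (fun a => rev (s a)).
Proof.
move=> Hs; have : computable (fun a => foldl (fun t x => x :: t) [::] (s a)).
  apply: (comp_foldl (F := fun _ t x => x :: t)) => //; last exact: comp_const.
  by apply: comp_cons; [apply/comp_snd/comp_id | apply/comp_snd/comp_fst/comp_id].
apply: comp_ext => a; rewrite /rev; elim: (s a) [::] => //= x t IHt r.
Qed.

Lemma comp_foldr {A} {eA : Enc A} {B} {eB : Enc B} {C} {eC : Enc C}
    (F : A -> C -> B -> B) (b0 : A -> B) (s : A -> seq C) :
    computable (fun p : A * C * B => F p.1.1 p.1.2 p.2) ->
    computable b0 -> computable s ->
  computable (fun a => foldr (F a) (b0 a) (s a)).
Proof.
move=> HF Hb Hs.
have : computable (fun a => foldl (fun b c => F a c b) (b0 a) (rev (s a))).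
  apply: (comp_foldl (F := fun a b c => F a c b)) => //=; last exact: comp_rev.
  apply: (comp_comp (f := fun p : A * B * C => (p.1.1, p.2, p.1.2)) _ HF).
  apply: comp_pair; first apply: comp_pair.
  - exact/comp_fst/comp_fst/comp_id.
  - exact/comp_snd/comp_id.
  - exact/comp_snd/comp_fst/comp_id.
by apply: comp_ext => a; rewrite foldl_rev.
Qed.

Lemma comp_map {A} {eA : Enc A} {B} {eB : Enc B} {C} {eC : Enc C}
    (F : A -> C -> B) (s : A -> seq C) :
    computable (fun p : A * C => F p.1 p.2) -> computable s ->
  computable (fun a => [seq F a c | c <- s a]).
Proof.
move=> HF Hs; have : computable (fun a => foldr (fun c r => F a c :: r) [::] (s a)).
  apply: (comp_foldr (F := fun a c r => F a c :: r)) => //; last exact: comp_const.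
  apply: comp_cons; last exact/comp_snd/comp_id.
  exact: (comp_comp (f := fun p : A * C * seq B => p.1) (comp_fst comp_id) HF).
by apply: comp_ext => a.
Qed.

Lemma comp_all {A} {eA : Enc A} {C} {eC : Enc C} (F : A -> C -> bool) (s : A -> seq C) :
    computable (fun p : A * C => F p.1 p.2) -> computable s ->
  computable (fun a => all (F a) (s a)).
Proof.
move=> HF Hs; have : computable (fun a => foldr (fun c r => F a c && r) true (s a)).
  apply: (comp_foldr (F := fun a c r => F a c && r)) => //; last exact: comp_const.
  apply: comp_if; [|exact/comp_snd/comp_id|exact: comp_const].
  exact: (comp_comp (f := fun p : A * C * bool => p.1) (comp_fst comp_id) HF).
by apply: comp_ext => a.
Qed.

Lemma comp_iter {A} {eA : Enc A} {B} {eB : Enc B}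
    (F : A -> B -> B) (n : A -> nat) (b0 : A -> B) :
    computable (fun p : A * B => F p.1 p.2) -> computable n -> computable b0 ->
  computable (fun a => iter (n a) (F a) (b0 a)).
Proof.
move=> HF Hn Hb.
have : computable (fun a => foldl (fun b (_ : tree) => F a b) (b0 a) (nseq (n a) Leaf)).
  apply: (comp_foldl (F := fun a b (_ : tree) => F a b)) => //.
    exact: (comp_comp (f := fun p : A * B * tree => p.1) (comp_fst comp_id) HF).
  by apply: comp_recode Hn => a; elim: (n a) => //= k ->.
apply: comp_ext => a; elim: (n a) (b0 a) => //= k IHk b.
by rewrite IHk -iterSr.
Qed.

(** * Computable arithmetic *)

Lemma comp_negb {A} {eA : Enc A} (b : A -> bool) :
  computable b -> computable (fun a => ~~ b a).
Proof.
move=> Hb; have : computable (fun a => if b a then false else true).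
  by apply: comp_if => //; apply: comp_const.
by apply: comp_ext => a; case: (b a).
Qed.

Lemma comp_andb {A} {eA : Enc A} (b c : A -> bool) :
  computable b -> computable c -> computable (fun a => b a && c a).
Proof. by move=> Hb Hc; apply: comp_if => //; apply: comp_const. Qed.

Lemma comp_orb {A} {eA : Enc A} (b c : A -> bool) :
  computable b -> computable c -> computable (fun a => b a || c a).
Proof. by move=> Hb Hc; apply: comp_if => //; apply: comp_const. Qed.

Lemma comp_succn {A} {eA : Enc A} (f : A -> nat) :
  computable f -> computable (fun a => (f a).+1).
Proof. by case=> p Hp; exists (PNode PLeaf p) => a; apply: EvNode (EvLeaf _) (Hp a). Qed.

Lemma comp_predn {A} {eA : Enc A} (f : A -> nat) :
  computable f -> computable (fun a => (f a).-1).
Proof.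
case=> p Hp; exists (PSeq p PRight) => a; apply: EvSeq (Hp a) _.
by case: (f a) => [|n]; [exact: (EvRight Leaf) | exact: (EvRight (Node _ _))].
Qed.

Lemma comp_addn {A} {eA : Enc A} (f g : A -> nat) :
  computable f -> computable g -> computable (fun a => (f a + g a)%N).
Proof.
move=> Hf Hg; have : computable (fun a => iter (f a) succn (g a)).
  apply: (comp_iter (F := fun _ n => n.+1)) => //.
  exact/comp_succn/comp_snd/comp_id.
by apply: comp_ext => a; rewrite iter_succn addnC.
Qed.

Lemma comp_subn {A} {eA : Enc A} (f g : A -> nat) :
  computable f -> computable g -> computable (fun a => (f a - g a)%N).
Proof.
move=> Hf Hg; have : computable (fun a => iter (g a) predn (f a)).
  apply: (comp_iter (F := fun _ n => n.-1)) => //.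
  exact/comp_predn/comp_snd/comp_id.
by apply: comp_ext => a; rewrite iter_predn.
Qed.

Lemma comp_eqn0 {A} {eA : Enc A} (f : A -> nat) :
  computable f -> computable (fun a => f a == 0%N).
Proof.
case=> p Hp; exists (PIf p PLeaf (PNode PLeaf PLeaf)) => a; have := Hp a.
case: (f a) => [|n] Hn.
  by apply: EvIfFalse (Hn) _; apply: EvNode; apply: EvLeaf.
exact: EvIfTrue Hn (EvLeaf _).
Qed.

Lemma comp_leq {A} {eA : Enc A} (f g : A -> nat) :
  computable f -> computable g -> computable (fun a => (f a <= g a)%N).
Proof. by move=> Hf Hg; apply/comp_eqn0/comp_subn. Qed.

Lemma comp_eqn {A} {eA : Enc A} (f g : A -> nat) :
  computable f -> computable g -> computable (fun a => f a == g a).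
Proof.
move=> Hf Hg; have := comp_andb (comp_leq Hf Hg) (comp_leq Hg Hf).
by apply: comp_ext => a; rewrite eqn_leq.
Qed.

Lemma comp_muln {A} {eA : Enc A} (f g : A -> nat) :
  computable f -> computable g -> computable (fun a => (f a * g a)%N).
Proof.
move=> Hf Hg; have : computable (fun a => iter (g a) (addn (f a)) 0%N).
  apply: (comp_iter (F := fun a n => (f a + n)%N)) => //; last exact: comp_const.
  apply: comp_addn; last exact/comp_snd/comp_id.
  by apply: (comp_comp (f := fst)) => //; exact/comp_fst/comp_id.
by apply: comp_ext => a; rewrite iter_addn_0.
Qed.

Lemma comp_expn {A} {eA : Enc A} (f g : A -> nat) :
  computable f -> computable g -> computable (fun a => (f a ^ g a)%N).
Proof.
move=> Hf Hg; have : computable (fun a => iter (g a) (muln (f a)) 1%N).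
  apply: (comp_iter (F := fun a n => (f a * n)%N)) => //; last exact: comp_const.
  apply: comp_muln; last exact/comp_snd/comp_id.
  by apply: (comp_comp (f := fst)) => //; exact/comp_fst/comp_id.
by apply: comp_ext => a; rewrite iter_muln_1.
Qed.

Lemma comp_int_pos {A} {eA : Enc A} (f : A -> int) :
  computable f -> computable (fun a => int_pos (f a)).
Proof.
by case=> p Hp; exists (PSeq p PLeft) => a; apply: EvSeq (Hp a) (EvLeft (Node _ _)).
Qed.

Lemma comp_int_neg {A} {eA : Enc A} (f : A -> int) :
  computable f -> computable (fun a => int_neg (f a)).
Proof.
by case=> p Hp; exists (PSeq p PRight) => a; apply: EvSeq (Hp a) (EvRight (Node _ _)).
Qed.

Lemma int_pos_neg z : z = (int_pos z)%:Z - (int_neg z)%:Z.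
Proof. by case: z => n /=; rewrite ?subr0 // sub0r NegzE. Qed.

Lemma comp_subz_nat {A} {eA : Enc A} (f g : A -> nat) :
  computable f -> computable g -> computable (fun a => (f a)%:Z - (g a)%:Z).
Proof.
move=> Hf Hg; apply: comp_recode (comp_pair (comp_subn Hf Hg) (comp_subn Hg Hf)) => a.
rewrite /Enc_int /Enc_prod /Enc_nat /=; move: (f a) (g a) => m n.
have [le|lt] := leqP n m.
  by rewrite subzn //= (eqP (le : (n - m == 0)%N)).
rewrite -opprB subzn ?(ltnW lt) //.
have : (m - n = 0)%N by apply/eqP; exact: ltnW.
by move=> ->; case E: (n - m)%N => [|k] //; move: lt; rewrite -subn_gt0 E.
Qed.

Lemma comp_addz {A} {eA : Enc A} (f g : A -> int) :
  computable f -> computable g -> computable (fun a => f a + g a).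
Proof.
move=> Hf Hg.
have := comp_subz_nat (comp_addn (comp_int_pos Hf) (comp_int_pos Hg))
                      (comp_addn (comp_int_neg Hf) (comp_int_neg Hg)).
by apply: comp_ext => a; rewrite [f a in RHS]int_pos_neg [g a in RHS]int_pos_neg !PoszD; ring.
Qed.

Lemma comp_oppz {A} {eA : Enc A} (f : A -> int) :
  computable f -> computable (fun a => - f a).
Proof.
move=> Hf; have := comp_subz_nat (comp_int_neg Hf) (comp_int_pos Hf).
by apply: comp_ext => a; rewrite [f a in RHS]int_pos_neg; ring.
Qed.

Lemma comp_mulz {A} {eA : Enc A} (f g : A -> int) :
  computable f -> computable g -> computable (fun a => f a * g a).
Proof.
move=> Hf Hg.
have := comp_subz_nat
  (comp_addn (comp_muln (comp_int_pos Hf) (comp_int_pos Hg))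
             (comp_muln (comp_int_neg Hf) (comp_int_neg Hg)))
  (comp_addn (comp_muln (comp_int_pos Hf) (comp_int_neg Hg))
             (comp_muln (comp_int_neg Hf) (comp_int_pos Hg))).
apply: comp_ext => a; rewrite [f a in RHS]int_pos_neg [g a in RHS]int_pos_neg.
by rewrite !PoszD !PoszM; ring.
Qed.

Lemma comp_Posz {A} {eA : Enc A} (f : A -> nat) :
  computable f -> computable (fun a => (f a)%:Z).
Proof.
move=> Hf; have := comp_subz_nat Hf (comp_const 0%N).
by apply: comp_ext => a; rewrite subr0.
Qed.

Lemma comp_lez {A} {eA : Enc A} (f g : A -> int) :
  computable f -> computable g -> computable (fun a => f a <= g a).
Proof.
move=> Hf Hg; have := comp_leq (comp_addn (comp_int_pos Hf) (comp_int_neg Hg))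
                               (comp_addn (comp_int_pos Hg) (comp_int_neg Hf)).
apply: comp_ext => a; rewrite [f a in RHS]int_pos_neg [g a in RHS]int_pos_neg.
by rewrite -lez_nat !PoszD lerBlDr addrAC lerBrDr.
Qed.

Lemma comp_ltz {A} {eA : Enc A} (f g : A -> int) :
  computable f -> computable g -> computable (fun a => f a < g a).
Proof.
move=> Hf Hg; have := comp_negb (comp_lez Hg Hf).
by apply: comp_ext => a; rewrite ltNge.
Qed.

Lemma comp_eqz {A} {eA : Enc A} (f g : A -> int) :
  computable f -> computable g -> computable (fun a => f a == g a).
Proof.
move=> Hf Hg; have := comp_andb (comp_lez Hf Hg) (comp_lez Hg Hf).
by apply: comp_ext => a; rewrite eq_le.
Qed.

Lemma comp_absz {A} {eA : Enc A} (f : A -> int) :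
  computable f -> computable (fun a => absz (f a)).
Proof.
move=> Hf; have := comp_addn (comp_int_pos Hf) (comp_int_neg Hf).
by apply: comp_ext => a; case: (f a) => n /=; rewrite ?addn0.
Qed.

Lemma comp_expz {A} {eA : Enc A} (f : A -> int) (g : A -> nat) :
  computable f -> computable g -> computable (fun a => f a ^+ g a).
Proof.
move=> Hf Hg; have : computable (fun a => iter (g a) ( *%R (f a)) (1 : int)).
  apply: (comp_iter (F := fun a n => f a * n)) => //; last exact: comp_const.
  apply: comp_mulz; last exact/comp_snd/comp_id.
  by apply: (comp_comp (f := fst)) => //; exact/comp_fst/comp_id.
by apply: comp_ext => a; rewrite iter_mulr_1.
Qed.

Lemma comp_size {A} {eA : Enc A} {B} {eB : Enc B} (s : A -> seq B) :
  computable s -> computable (fun a => size (s a)).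
Proof.
move=> Hs; have : computable (fun a => foldr (fun _ n => n.+1) 0%N (s a)).
  apply: (comp_foldr (F := fun _ _ n => n.+1)) => //; last exact: comp_const.
  exact/comp_succn/comp_snd/comp_id.
by apply: comp_ext => a; elim: (s a) => //= _ t ->.
Qed.

Lemma comp_nth {A} {eA : Enc A} {B} {eB : Enc B}
    (b0 : A -> B) (s : A -> seq B) (n : A -> nat) :
  computable b0 -> computable s -> computable n ->
  computable (fun a => nth (b0 a) (s a) (n a)).
Proof.
move=> Hb Hs Hn; have : computable (fun a => head (b0 a) (iter (n a) behead (s a))).
  apply: comp_head => //; apply: (comp_iter (F := fun _ => behead)) => //.
  exact/comp_behead/comp_snd/comp_id.
by apply: comp_ext => a; elim: (n a) (s a) => [|k IHk] [|b t] //; rewrite iterSr IHk ?nth_nil.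
Qed.

Lemma comp_rcons {A} {eA : Enc A} {B} {eB : Enc B} (s : A -> seq B) (b : A -> B) :
  computable s -> computable b -> computable (fun a => rcons (s a) (b a)).
Proof.
move=> Hs Hb; have := comp_rev (comp_cons Hb (comp_rev Hs)).
by apply: comp_ext => a; rewrite rev_cons revK.
Qed.

Lemma comp_iota0 {A} {eA : Enc A} (n : A -> nat) :
  computable n -> computable (fun a => iota 0 (n a)).
Proof.
move=> Hn; have : computable (fun a => iter (n a) (fun s => rcons s (size s)) [::]).
  apply: (comp_iter (F := fun _ s => rcons s (size s))) => //; last exact: comp_const.
  by apply: comp_rcons; [|apply: comp_size]; apply/comp_snd/comp_id.
apply: comp_ext => a; elim: (n a) => // k IHk.
by rewrite iterS IHk size_iota -addn1 iotaD cats1.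
Qed.

Lemma comp_sum_nat_seq {A} {eA : Enc A} {B} {eB : Enc B}
    (F : A -> B -> nat) (s : A -> seq B) :
    computable (fun p : A * B => F p.1 p.2) -> computable s ->
  computable (fun a => \sum_(b <- s a) F a b)%N.
Proof.
move=> HF Hs; have : computable (fun a => foldr (fun b n => F a b + n)%N 0%N (s a)).
  apply: (comp_foldr (F := fun a b n => F a b + n)%N) => //; last exact: comp_const.
  apply: comp_addn; last exact/comp_snd/comp_id.
  exact: (comp_comp (f := fun p : A * B * nat => p.1) (comp_fst comp_id) HF).
by apply: comp_ext => a; rewrite unlock.
Qed.

Lemma comp_sum_int_seq {A} {eA : Enc A} {B} {eB : Enc B}
    (F : A -> B -> int) (s : A -> seq B) :
    computable (fun p : A * B => F p.1 p.2) -> computable s ->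
  computable (fun a => \sum_(b <- s a) F a b).
Proof.
move=> HF Hs; have : computable (fun a => foldr (fun b n => F a b + n) 0 (s a)).
  apply: (comp_foldr (F := fun a b n => F a b + n)) => //; last exact: comp_const.
  apply: comp_addz; last exact/comp_snd/comp_id.
  exact: (comp_comp (f := fun p : A * B * int => p.1) (comp_fst comp_id) HF).
by apply: comp_ext => a; rewrite unlock.
Qed.

Lemma comp_sum_nat {A} {eA : Enc A} (F : A -> nat -> nat) (n : A -> nat) :
    computable (fun p : A * nat => F p.1 p.2) -> computable n ->
  computable (fun a => \sum_(0 <= i < n a) F a i)%N.
Proof.
move=> HF Hn; have := comp_sum_nat_seq HF (comp_iota0 Hn).
by apply: comp_ext => a; rewrite /index_iota subn0.
Qed.

Lemma comp_sum_int {A} {eA : Enc A} (F : A -> nat -> int) (n : A -> nat) :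
    computable (fun p : A * nat => F p.1 p.2) -> computable n ->
  computable (fun a => \sum_(0 <= i < n a) F a i).
Proof.
move=> HF Hn; have := comp_sum_int_seq HF (comp_iota0 Hn).
by apply: comp_ext => a; rewrite /index_iota subn0.
Qed.

(** * Deriving computability from the shape of a definition *)

(** Extended below to the functions already known to be computable. *)
Ltac comp_defined := fail.

(** One step matches the body of a function, which may depend on its argument,
    with the operation at its root; local variables bound by list operations
    become projections of an enlarged argument. *)
Ltac comp_step :=
  lazy beta zeta;
  lazymatch goal with
  | |- @computable _ _ _ _ (fun x => @?f x) => idtac
  | |- @computable ?A ?B ?eA ?eB ?f => change (@computable A B eA eB (fun x => f x))
  end;
  first
  [ match goal with
    | H : @computable _ _ _ _ ?f |- @computable _ _ _ _ (fun x => ?f (@?h x)) =>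
        refine (comp_comp (f := h) (g := f) _ H)
    end
  | assumption
  | comp_defined
  | lazymatch goal with
    | |- @computable _ _ _ _ (fun x => x) => exact comp_id
    | |- @computable _ _ _ _ (fun _ => ?b) => exact (comp_const b)
    | |- @computable _ _ _ _ (fun x => (@?f x).1) => refine (comp_fst (f := f) _)
    | |- @computable _ _ _ _ (fun x => (@?f x).2) => refine (comp_snd (f := f) _)
    | |- @computable _ _ _ _ (fun x => (@?f x, @?g x)) =>
        refine (comp_pair (f := f) (g := g) _ _)
    | |- @computable _ _ _ _ (fun x => ~~ @?f x) => refine (comp_negb (b := f) _)
    | |- @computable _ _ _ _ (fun x => @?f x && @?g x) =>
        refine (comp_andb (b := f) (c := g) _ _)
    | |- @computable _ _ _ _ (fun x => @?f x || @?g x) =>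
        refine (comp_orb (b := f) (c := g) _ _)
    | |- @computable _ _ _ _ (fun x => Posz (@?f x)) => refine (comp_Posz (f := f) _)
    | |- @computable _ _ _ _ (fun x => absz (@?f x)) => refine (comp_absz (f := f) _)
    | |- @computable _ _ _ _ (fun x => Algebra.add (@?f x) (@?g x)) =>
        refine (comp_addz (f := f) (g := g) _ _)
    | |- @computable _ _ _ _ (fun x => Algebra.opp (@?f x)) =>
        refine (comp_oppz (f := f) _)
    | |- @computable _ _ _ _ (fun x => GRing.mul (@?f x) (@?g x)) =>
        refine (comp_mulz (f := f) (g := g) _ _)
    | |- @computable _ _ _ _ (fun x => GRing.exp (@?f x) (@?g x)) =>
        refine (comp_expz (f := f) (g := g) _ _)
    | |- @computable _ _ _ _ (fun x => Order.le (@?f x) (@?g x)) =>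
        refine (comp_lez (f := f) (g := g) _ _)
    | |- @computable _ _ _ _ (fun x => Order.lt (@?f x) (@?g x)) =>
        refine (comp_ltz (f := f) (g := g) _ _)
    | |- @computable _ _ _ _ (fun x => eq_op (@?f x) (@?g x)) =>
        first [ refine (comp_eqn (f := f) (g := g) _ _)
              | refine (comp_eqz (f := f) (g := g) _ _) ]
    | |- @computable _ _ _ _ (fun x => leq (@?f x) (@?g x)) =>
        refine (comp_leq (f := f) (g := g) _ _)
    | |- @computable _ _ _ _ (fun x => addn (@?f x) (@?g x)) =>
        refine (comp_addn (f := f) (g := g) _ _)
    | |- @computable _ _ _ _ (fun x => subn (@?f x) (@?g x)) =>
        refine (comp_subn (f := f) (g := g) _ _)
    | |- @computable _ _ _ _ (fun x => muln (@?f x) (@?g x)) =>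
        refine (comp_muln (f := f) (g := g) _ _)
    | |- @computable _ _ _ _ (fun x => expn (@?f x) (@?g x)) =>
        refine (comp_expn (f := f) (g := g) _ _)
    | |- @computable _ _ _ _ (fun x => S (@?f x)) => refine (comp_succn (f := f) _)
    | |- @computable _ _ _ _ (fun x => Nat.pred (@?f x)) => refine (comp_predn (f := f) _)
    | |- @computable _ _ _ _ (fun x => size (@?s x)) => refine (comp_size (s := s) _)
    | |- @computable _ _ _ _ (fun x => nth (@?b x) (@?s x) (@?n x)) =>
        refine (comp_nth (b0 := b) (s := s) (n := n) _ _ _)
    | |- @computable _ _ _ _ (fun x => rcons (@?s x) (@?b x)) =>
        refine (comp_rcons (s := s) (b := b) _ _)
    | |- @computable _ _ _ _ (fun x => behead (@?s x)) => refine (comp_behead (f := s) _)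
    | |- @computable _ _ _ _ (fun x => (@?f x) :: (@?s x)) =>
        refine (comp_cons (f := f) (g := s) _ _)
    | |- @computable _ _ _ _ (fun x => iota 0 (@?n x)) => refine (comp_iota0 (n := n) _)
    | |- @computable _ _ _ _ (fun x => map (@?F x) (@?s x)) =>
        refine (comp_map (F := F) (s := s) _ _)
    | |- @computable _ _ _ _ (fun x => all (@?F x) (@?s x)) =>
        refine (comp_all (F := F) (s := s) _ _)
    | |- @computable _ _ _ _ (fun x => foldr (@?F x) (@?b x) (@?s x)) =>
        refine (comp_foldr (F := F) (b0 := b) (s := s) _ _ _)
    | |- @computable _ _ _ _ (fun x => iter (@?n x) (@?F x) (@?b x)) =>
        refine (comp_iter (F := F) (n := n) (b0 := b) _ _ _)
    | |- @computable _ _ _ _ (fun x => Node (@?f x) (@?g x)) =>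
        refine (comp_Node (f := f) (g := g) _ _)
    | |- @computable _ _ _ _ (fun x => left_tree (@?f x)) => refine (comp_left (f := f) _)
    | |- @computable _ _ _ _ (fun x => right_tree (@?f x)) => refine (comp_right (f := f) _)
    | |- @computable _ _ _ _ (fun x => is_node (@?f x)) => refine (comp_is_node (f := f) _)
    | |- @computable _ _ _ _ (fun x => bigop.body _ _ _) =>
        first [ apply: comp_sum_nat | apply: comp_sum_int
              | apply: comp_sum_nat_seq | apply: comp_sum_int_seq ]
    end
  | apply comp_if ].

Ltac comp := repeat comp_step.

Lemma comp_gauss_mul A (eA : Enc A) (z w : A -> int * int) :
  computable z -> computable w -> computable (fun a => gauss_mul (z a) (w a)).
Proof. by move=> Hz Hw; rewrite /gauss_mul; comp. Qed.
Ltac comp_defined ::= apply: comp_gauss_mul.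

Lemma comp_gauss_exp A (eA : Enc A) (z : A -> int * int) (n : A -> nat) :
  computable z -> computable n -> computable (fun a => gauss_exp (z a) (n a)).
Proof. by move=> Hz Hn; rewrite /gauss_exp; comp. Qed.

Lemma comp_gauss_norm A (eA : Enc A) (z : A -> int * int) :
  computable z -> computable (fun a => gauss_norm (z a)).
Proof. by move=> Hz; rewrite /gauss_norm; comp. Qed.

Ltac comp_defined ::= first
  [apply: comp_gauss_mul | apply: comp_gauss_exp | apply: comp_gauss_norm].

Lemma comp_gauss_eval A (eA : Enc A) (fs : A -> seq int) (m : A -> nat)
    (z : A -> int * int) :
  computable fs -> computable m -> computable z ->
  computable (fun a => gauss_eval (fs a) (m a) (z a)).
Proof. by move=> Hf Hm Hz; rewrite /gauss_eval; comp. Qed.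

Ltac comp_defined ::= first
  [apply: comp_gauss_mul | apply: comp_gauss_exp | apply: comp_gauss_norm | apply: comp_gauss_eval].

Lemma comp_isolates A (eA : Enc A) (fs : A -> seq int) (E m : A -> nat) (zs : A -> seq
    (int * int)) :
  computable fs -> computable E -> computable m -> computable zs ->
  computable (fun a => isolates (fs a) (E a) (m a) (zs a)).
Proof. by move=> Hf HE Hm Hz; rewrite /isolates; comp. Qed.

(** * The certificates *)

Fixpoint spine (t : tree) : seq tree := if t is Node l r then l :: spine r else [::].

(** Binary digits, with the implicit leading 1 as initial value. *)
Definition read_nat (t : tree) : nat :=
  if is_node t then
    foldr (fun b n => 2 * n + (if is_node b then 1 else 0))%N 1%N (spine (right_tree t))
  else 0%N.
Definition read_int (t : tree) : int :=
  if is_node (left_tree t) then - (read_nat (right_tree t))%:Z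
  else (read_nat (right_tree t))%:Z.
Definition read_count (t : tree) : nat := read_nat (right_tree (left_tree t)).
(** Only the numerators: the coefficients are integers. *)
Definition read_coefs (t : tree) : seq int :=
  [seq read_int (left_tree c) | c <- spine (right_tree (right_tree t))].

(** Certificates are read so that every tree is one, whatever its shape. *)
Definition cert_nat (t : tree) : nat := size (spine t).
Definition cert_int (t : tree) : int :=
  (cert_nat (left_tree t))%:Z - (cert_nat (right_tree t))%:Z.
Definition cert_gauss (t : tree) : int * int :=
  (cert_int (left_tree t), cert_int (right_tree t)).
Definition cert_gausses (t : tree) : seq (int * int) := [seq cert_gauss c | c <- spine t].
Definition cert_ints (t : tree) : seq int := [seq cert_int c | c <- spine t].
Definition cert_vectors (t : tree) : seq (seq int) := [seq cert_ints c | c <- spine t].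
Definition cert_towers (t : tree) : seq (seq (seq int)) := [seq cert_vectors c | c <- spine t].

(** In units of [1 / E], a bound on the error made on the sum of the [|a|^2] when
    each [a] is replaced by a point at distance at most [1 / E]. *)
Definition error_count (fs : seq int) : nat := (size fs).-1 * (2 * root_bound fs + 1).

(** The sum of the [|a|^2] is within [error_count fs / E] of
    [gauss_sum zs / m ^ 2], and is thus less than [4 d] plus the gap. *)
Definition sum_le4 (fs : seq int) (E m : nat) (zs : seq (int * int)) : bool :=
  let d := (size fs).-1 in
  let gap := ((d * root_bound fs ^ 2 + 4 * d) ^ (d ^ d))%N in
  isolates fs E m zs &&
  ((gauss_sum zs * E%:Z + (error_count fs * m ^ 2)%N%:Z) * gap%:Z
     < (4 * d * gap + 1)%N%:Z * (E * m ^ 2)%N%:Z).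

(** Dually, the sum is at least [d (u / v) ^ 2], and [2 < u / v]. *)
Definition sum_ge (fs : seq int) (E m u v : nat) (zs : seq (int * int)) : bool :=
  [&& isolates fs E m zs, (0 < v)%N, (2 * v < u)%N
    & ((size fs).-1 * u ^ 2 * E * m ^ 2 + error_count fs * v ^ 2 * m ^ 2)%N%:Z
        <= gauss_sum zs * (v ^ 2 * E)%N%:Z].

Definition is_prime (p : nat) : bool :=
  (1 < p)%N && all (fun a => all (fun b => ~~ ((a * b)%N == p)) (iota 0 p)) (iota 0 p).

Definition coefs_eval (fs : seq int) (k : int) : int :=
  \sum_(0 <= i < size fs) fs`_i * k ^+ i.

(** The remainder [r] witnesses that [p ^ 2] does not divide the value at [k]. *)
Definition exact_prime (fs : seq int) (p r : nat) (k e : int) : bool :=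
  [&& is_prime p, (0 < r)%N, (r < p)%N & coefs_eval fs k == p%:Z * (p%:Z * e + r%:Z)].

Definition distinct_towers (fs : seq int) (n p u v : nat) (k : int)
    (wss : seq (seq (seq int))) : bool :=
  [&& size wss == n,
      all (fun i => all (fun j => (i == j) ||
        ~~ (size (nth [::] wss i) == size (nth [::] wss j))) (iota 0 n)) (iota 0 n)
    & all (fun ws => good_tower fs p k u v ws) wss].

(** The tag of a certificate tells which of [4 < q] and [q <= 4] it is for. *)
Definition check (t c : tree) : bool :=
  let fs := read_coefs t in
  let E := cert_nat (left_tree (left_tree (right_tree c))) in
  let m := cert_nat (right_tree (left_tree (right_tree c))) in
  let zs := cert_gausses (left_tree (right_tree (right_tree c))) in
  let c1 := right_tree (right_tree (right_tree c)) in
  let u := cert_nat (left_tree (left_tree c1)) in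
  let v := cert_nat (right_tree (left_tree c1)) in
  let c2 := right_tree c1 in
  let p := cert_nat (left_tree (left_tree c2)) in
  let r := cert_nat (right_tree (left_tree c2)) in
  let k := cert_int (left_tree (left_tree (right_tree c2))) in
  let e := cert_int (right_tree (left_tree (right_tree c2))) in
  let wss := cert_towers (right_tree (right_tree c2)) in
  if is_node (left_tree c) then
    [&& sum_ge fs E m u v zs, exact_prime fs p r k e
      & distinct_towers fs (read_count t) p u v k wss]
  else sum_le4 fs E m zs.

(** Increment on binary numerals; the accumulator holds each tail together with
    its successor. *)
Definition succ_bits (s : seq bool) : seq bool :=
  (foldr (fun b (q : seq bool * seq bool) =>
     (b :: q.1, if b then false :: q.2 else true :: q.1)) ([::], [:: false]) s).2.
Definition bits (n : nat) : seq bool := iter n.-1 succ_bits [::].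
Definition bits_tree (s : seq bool) : tree := enc_seq enc_bool s.
Definition write_nat (n : nat) : tree :=
  if n == 0%N then Leaf else Node Leaf (bits_tree (bits n)).
Definition write_int (z : int) : tree :=
  Node (if z < 0 then Node Leaf Leaf else Leaf) (write_nat (absz z)).
Definition list_tree (s : seq tree) : tree := foldr Node Leaf s.
Definition write_rat (z : int) : tree := Node (write_int z) (write_int 1).
Definition write_vector (v : seq int) : tree := list_tree [seq write_rat c | c <- v].
Definition write_poly (G : seq (seq int)) : tree :=
  Node (write_int (size G).-1%:Z) (list_tree [seq write_vector v | v <- G]).

Definition answer (t c : tree) : tree :=
  let fs := read_coefs t in
  let c2 := right_tree (right_tree (right_tree (right_tree c))) in
  let p := cert_nat (left_tree (left_tree c2)) in
  let k := cert_int (left_tree (left_tree (right_tree c2))) in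
  let wss := cert_towers (right_tree (right_tree c2)) in
  if is_node (left_tree c) then
    Node Leaf (list_tree [seq write_poly (tower fs p k ws) | ws <- wss])
  else Leaf.

(** * The test of certificates is computable *)

Lemma comp_spine A (eA : Enc A) (f : A -> tree) :
  computable f -> computable (fun a => spine (f a)).
Proof.
apply: comp_recode => a; rewrite /Enc_seq.
have E t : enc_seq Enc_tree (spine t) = t by elim: t => //= l _ r ->.
exact: E.
Qed.

Lemma comp_list_tree A (eA : Enc A) (f : A -> seq tree) :
  computable f -> computable (fun a => list_tree (f a)).
Proof. by move=> Hf; rewrite /list_tree; comp. Qed.

Lemma comp_bits_tree A (eA : Enc A) (f : A -> seq bool) :
  computable f -> computable (fun a => bits_tree (f a)).
Proof. exact: comp_recode. Qed.

Ltac comp_defined ::= lazymatch goal with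
  | |- @computable _ _ _ _ (fun x => isolates _ _ _ _) => apply: comp_isolates
  | |- @computable _ _ _ _ (fun x => gauss_norm _) => apply: comp_gauss_norm
  | |- @computable _ _ _ _ (fun x => spine _) => apply: comp_spine
  | |- @computable _ _ _ _ (fun x => list_tree _) => apply: comp_list_tree
  | |- @computable _ _ _ _ (fun x => bits_tree _) => apply: comp_bits_tree
  end.

Lemma comp_read_nat A (eA : Enc A) (f : A -> tree) :
  computable f -> computable (fun a => read_nat (f a)).
Proof. by move=> Hf; rewrite /read_nat; comp. Qed.

Lemma comp_cert_int A (eA : Enc A) (f : A -> tree) :
  computable f -> computable (fun a => cert_int (f a)).
Proof. by move=> Hf; rewrite /cert_int /cert_nat; comp. Qed.

Ltac comp_defined ::= lazymatch goal with
  | |- @computable _ _ _ _ (fun x => isolates _ _ _ _) => apply: comp_isolates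
  | |- @computable _ _ _ _ (fun x => gauss_norm _) => apply: comp_gauss_norm
  | |- @computable _ _ _ _ (fun x => spine _) => apply: comp_spine
  | |- @computable _ _ _ _ (fun x => list_tree _) => apply: comp_list_tree
  | |- @computable _ _ _ _ (fun x => bits_tree _) => apply: comp_bits_tree
  | |- @computable _ _ _ _ (fun x => read_nat _) => apply: comp_read_nat
  | |- @computable _ _ _ _ (fun x => cert_int _) => apply: comp_cert_int
  end.

Lemma comp_read_coefs A (eA : Enc A) (f : A -> tree) :
  computable f -> computable (fun a => read_coefs (f a)).
Proof. by move=> Hf; rewrite /read_coefs /read_int; comp. Qed.

Lemma comp_cert_gausses A (eA : Enc A) (f : A -> tree) :
  computable f -> computable (fun a => cert_gausses (f a)).
Proof. by move=> Hf; rewrite /cert_gausses /cert_gauss; comp. Qed.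

Lemma comp_cert_towers A (eA : Enc A) (f : A -> tree) :
  computable f -> computable (fun a => cert_towers (f a)).
Proof. by move=> Hf; rewrite /cert_towers /cert_vectors /cert_ints; comp. Qed.

Lemma comp_gauss_sum A (eA : Enc A) (f : A -> seq (int * int)) :
  computable f -> computable (fun a => gauss_sum (f a)).
Proof. by move=> Hf; rewrite /gauss_sum; comp. Qed.

Lemma comp_root_bound A (eA : Enc A) (f : A -> seq int) :
  computable f -> computable (fun a => root_bound (f a)).
Proof. by move=> Hf; rewrite /root_bound; comp. Qed.

Ltac comp_defined ::= lazymatch goal with
  | |- @computable _ _ _ _ (fun x => isolates _ _ _ _) => apply: comp_isolates
  | |- @computable _ _ _ _ (fun x => gauss_norm _) => apply: comp_gauss_norm
  | |- @computable _ _ _ _ (fun x => spine _) => apply: comp_spine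
  | |- @computable _ _ _ _ (fun x => list_tree _) => apply: comp_list_tree
  | |- @computable _ _ _ _ (fun x => bits_tree _) => apply: comp_bits_tree
  | |- @computable _ _ _ _ (fun x => read_nat _) => apply: comp_read_nat
  | |- @computable _ _ _ _ (fun x => cert_int _) => apply: comp_cert_int
  | |- @computable _ _ _ _ (fun x => read_coefs _) => apply: comp_read_coefs
  | |- @computable _ _ _ _ (fun x => cert_gausses _) => apply: comp_cert_gausses
  | |- @computable _ _ _ _ (fun x => cert_towers _) => apply: comp_cert_towers
  | |- @computable _ _ _ _ (fun x => gauss_sum _) => apply: comp_gauss_sum
  | |- @computable _ _ _ _ (fun x => root_bound _) => apply: comp_root_bound
  end.

Lemma comp_sum_le4 A (eA : Enc A) (fs : A -> seq int) (E m : A -> nat)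
    (zs : A -> seq (int * int)) :
  computable fs -> computable E -> computable m -> computable zs ->
  computable (fun a => sum_le4 (fs a) (E a) (m a) (zs a)).
Proof. by move=> Hf HE Hm Hz; rewrite /sum_le4 /error_count; comp. Qed.

Lemma comp_sum_ge A (eA : Enc A) (fs : A -> seq int) (E m u v : A -> nat)
    (zs : A -> seq (int * int)) :
  computable fs -> computable E -> computable m -> computable u -> computable v ->
  computable zs -> computable (fun a => sum_ge (fs a) (E a) (m a) (u a) (v a) (zs a)).
Proof. by move=> Hf HE Hm Hu Hv Hz; rewrite /sum_ge /error_count; comp. Qed.

Lemma comp_exact_prime A (eA : Enc A) (fs : A -> seq int) (p r : A -> nat)
    (k e : A -> int) :
  computable fs -> computable p -> computable r -> computable k -> computable e ->
  computable (fun a => exact_prime (fs a) (p a) (r a) (k a) (e a)).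
Proof.
by move=> Hf Hp Hr Hk He; rewrite /exact_prime /is_prime /coefs_eval; comp.
Qed.

Lemma comp_vec_add A (eA : Enc A) (d : A -> nat) (u v : A -> seq int) :
  computable d -> computable u -> computable v ->
  computable (fun a => vec_add (d a) (u a) (v a)).
Proof. by move=> Hd Hu Hv; rewrite /vec_add; comp. Qed.

Lemma comp_vec_scale A (eA : Enc A) (k : A -> int) (v : A -> seq int) :
  computable k -> computable v -> computable (fun a => vec_scale (k a) (v a)).
Proof. by move=> Hk Hv; rewrite /vec_scale; comp. Qed.

Lemma comp_vec_one A (eA : Enc A) (d : A -> nat) :
  computable d -> computable (fun a => vec_one (d a)).
Proof.
move=> Hd.
have : computable (fun a => [seq if (i == 0)%N then 1 else 0 | i <- iota 0 (d a)] : seq int).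
  by comp.
by apply: comp_ext => a; apply: eq_map => -[].
Qed.

Lemma comp_vec_mulgen A (eA : Enc A) (fs v : A -> seq int) :
  computable fs -> computable v -> computable (fun a => vec_mulgen (fs a) (v a)).
Proof. by move=> Hf Hv; rewrite /vec_mulgen; comp. Qed.

Ltac comp_defined ::= lazymatch goal with
  | |- @computable _ _ _ _ (fun x => root_bound _) => apply: comp_root_bound
  | |- @computable _ _ _ _ (fun x => vec_add _ _ _) => apply: comp_vec_add
  | |- @computable _ _ _ _ (fun x => vec_scale _ _) => apply: comp_vec_scale
  | |- @computable _ _ _ _ (fun x => vec_one _) => apply: comp_vec_one
  | |- @computable _ _ _ _ (fun x => vec_mulgen _ _) => apply: comp_vec_mulgen
  end.

Lemma comp_tower A (eA : Enc A) (fs : A -> seq int) (p : A -> nat) (k : A -> int)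
    (ws : A -> seq (seq int)) :
  computable fs -> computable p -> computable k -> computable ws ->
  computable (fun a => tower (fs a) (p a) (k a) (ws a)).
Proof. by move=> Hf Hp Hk Hw; rewrite /tower; comp. Qed.

Lemma comp_taylor_shift A (eA : Enc A) (fs : A -> seq int) (G : A -> seq (seq int)) :
  computable fs -> computable G -> computable (fun a => taylor_shift (fs a) (G a)).
Proof. by move=> Hf HG; rewrite /taylor_shift /taylor_cons; comp. Qed.

Lemma comp_small_tail A (eA : Enc A) (B u v : A -> nat) (H : A -> seq (seq int)) :
  computable B -> computable u -> computable v -> computable H ->
  computable (fun a => small_tail (B a) (u a) (v a) (H a)).
Proof. by move=> HB Hu Hv HH; rewrite /small_tail /vec_norm; comp. Qed.

Ltac comp_defined ::= lazymatch goal with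
  | |- @computable _ _ _ _ (fun x => root_bound _) => apply: comp_root_bound
  | |- @computable _ _ _ _ (fun x => tower _ _ _ _) => apply: comp_tower
  | |- @computable _ _ _ _ (fun x => taylor_shift _ _) => apply: comp_taylor_shift
  | |- @computable _ _ _ _ (fun x => small_tail _ _ _ _) => apply: comp_small_tail
  end.

Lemma comp_distinct_towers A (eA : Enc A) (fs : A -> seq int) (n p u v : A -> nat)
    (k : A -> int) (wss : A -> seq (seq (seq int))) :
  computable fs -> computable n -> computable p -> computable u -> computable v ->
  computable k -> computable wss ->
  computable (fun a => distinct_towers (fs a) (n a) (p a) (u a) (v a) (k a) (wss a)).
Proof.
by move=> Hf Hn Hp Hu Hv Hk Hw; rewrite /distinct_towers /good_tower; comp.
Qed.

Ltac comp_defined ::= lazymatch goal with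
  | |- @computable _ _ _ _ (fun x => spine _) => apply: comp_spine
  | |- @computable _ _ _ _ (fun x => read_nat _) => apply: comp_read_nat
  | |- @computable _ _ _ _ (fun x => cert_int _) => apply: comp_cert_int
  | |- @computable _ _ _ _ (fun x => read_coefs _) => apply: comp_read_coefs
  | |- @computable _ _ _ _ (fun x => cert_gausses _) => apply: comp_cert_gausses
  | |- @computable _ _ _ _ (fun x => cert_towers _) => apply: comp_cert_towers
  | |- @computable _ _ _ _ (fun x => sum_le4 _ _ _ _) => apply: comp_sum_le4
  | |- @computable _ _ _ _ (fun x => sum_ge _ _ _ _ _ _) => apply: comp_sum_ge
  | |- @computable _ _ _ _ (fun x => exact_prime _ _ _ _ _) => apply: comp_exact_prime
  | |- @computable _ _ _ _ (fun x => distinct_towers _ _ _ _ _ _ _) => apply: comp_distinct_towers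
  | |- @computable _ _ _ _ (fun x => tower _ _ _ _) => apply: comp_tower
  | |- @computable _ _ _ _ (fun x => list_tree _) => apply: comp_list_tree
  | |- @computable _ _ _ _ (fun x => bits_tree _) => apply: comp_bits_tree
  end.

Lemma comp_check : computable (fun p : tree * tree => check p.1 p.2).
Proof. by rewrite /check /cert_nat /read_count; comp. Qed.

Lemma comp_write_int A (eA : Enc A) (f : A -> int) :
  computable f -> computable (fun a => write_int (f a)).
Proof. by move=> Hf; rewrite /write_int /write_nat /bits /succ_bits; comp. Qed.

Ltac comp_defined ::= lazymatch goal with
  | |- @computable _ _ _ _ (fun x => spine _) => apply: comp_spine
  | |- @computable _ _ _ _ (fun x => cert_int _) => apply: comp_cert_int
  | |- @computable _ _ _ _ (fun x => read_coefs _) => apply: comp_read_coefs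
  | |- @computable _ _ _ _ (fun x => cert_towers _) => apply: comp_cert_towers
  | |- @computable _ _ _ _ (fun x => tower _ _ _ _) => apply: comp_tower
  | |- @computable _ _ _ _ (fun x => list_tree _) => apply: comp_list_tree
  | |- @computable _ _ _ _ (fun x => write_int _) => apply: comp_write_int
  end.

Lemma comp_answer : computable (fun p : tree * tree => answer p.1 p.2).
Proof.
by rewrite /answer /cert_nat /write_poly /write_vector /write_rat; comp.
Qed.

(** * Encodings and unbounded search *)

Lemma spine_enc_seq T (e : T -> tree) (s : seq T) : spine (enc_seq e s) = map e s.
Proof. by elim: s => //= x s ->. Qed.

Lemma read_natK n : read_nat (enc_nat n) = n.
Proof.
rewrite -[RHS]bin_of_natK /enc_nat; case: (bin_of_nat n) => //= p.
rewrite /read_nat /=; elim: p => //= p ->; lia.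
Qed.

Lemma read_intK z : read_int (enc_int z) = z.
Proof. by rewrite /read_int /= read_natK; case: z => n //=; rewrite NegzE. Qed.

Lemma read_count_input n f : read_count (enc_input n f) = n.
Proof. exact: read_natK. Qed.

Lemma read_coefs_input n f : read_coefs (enc_input n f) = [seq numq c | c <- f].
Proof.
rewrite /read_coefs /= spine_enc_seq -map_comp; apply: eq_map => c /=.
exact: read_intK.
Qed.

Fixpoint pos_bits (p : positive) : seq bool :=
  match p with
  | xH => [::]
  | xO p' => false :: pos_bits p'
  | xI p' => true :: pos_bits p'
  end.

Lemma enc_pos_bits p : enc_pos p = bits_tree (pos_bits p).
Proof. by elim: p => //= p ->. Qed.

Lemma succ_pos_bits p : succ_bits (pos_bits p) = pos_bits (Pos.succ p).
Proof.
have E (s : seq bool) : (foldr (fun b (q : seq bool * seq bool) =>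
     (b :: q.1, if b then false :: q.2 else true :: q.1)) ([::], [:: false]) s).1 = s.
  by elim: s => //= b s ->.
by elim: p => //= p IHp; rewrite /succ_bits /= ?E // -IHp.
Qed.

Lemma bits_succ k : exists2 p, bin_of_nat k.+1 = Npos p & bits k.+1 = pos_bits p.
Proof.
suff [p Dp Dk] : exists2 p, nat_of_pos p = k.+1 & iter k succ_bits [::] = pos_bits p.
  by exists p; rewrite // -Dp -[LHS]/(bin_of_nat (nat_of_bin (Npos p))) nat_of_binK.
elim: k => [|k [p Dp Dk]]; first by exists xH.
by exists (Pos.succ p); rewrite ?iterS ?Dk ?succ_pos_bits // nat_of_succ_pos Dp.
Qed.

Lemma write_natE n : write_nat n = enc_nat n.
Proof.
case: n => // k; rewrite /write_nat /enc_nat; have [p -> ->] := bits_succ k.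
by rewrite enc_pos_bits.
Qed.

Lemma write_intE z : write_int z = enc_int z.
Proof. by rewrite /write_int /enc_int write_natE. Qed.

Lemma write_ratE z : write_rat z = enc_rat z%:~R.
Proof. by rewrite /write_rat /enc_rat !write_intE numq_int denq_int. Qed.

Lemma list_treeE T (e : T -> tree) (s : seq T) : list_tree (map e s) = enc_seq e s.
Proof. by elim: s => //= x s ->. Qed.

Lemma enc_seq_map T U (e : U -> tree) (g : T -> U) (s : seq T) :
  enc_seq e (map g s) = enc_seq (e \o g) s.
Proof. by elim: s => //= x s ->. Qed.

Lemma eq_enc_seq T (e1 e2 : T -> tree) (s : seq T) : e1 =1 e2 -> enc_seq e1 s = enc_seq e2 s.
Proof. by move=> e12; elim: s => //= x s ->; rewrite e12. Qed.

Lemma write_polyE G :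
  write_poly G = enc_poly (enc_seq enc_rat) [seq [seq c%:~R | c <- v] | v <- G].
Proof.
rewrite /write_poly /enc_poly write_intE size_map list_treeE enc_seq_map.
congr Node; apply: eq_enc_seq => v /=; rewrite /write_vector list_treeE enc_seq_map.
exact/eq_enc_seq/write_ratE.
Qed.

Lemma cert_nat_onto n : cert_nat (unary n) = n.
Proof. by rewrite /cert_nat; elim: n => //= n ->. Qed.

Lemma cert_int_onto z : cert_int (Enc_int z) = z.
Proof. by rewrite /cert_int /= !cert_nat_onto -int_pos_neg. Qed.

Lemma spine_onto T (e : T -> tree) (r : tree -> T) (s : seq T) :
  cancel e r -> map r (spine (enc_seq e s)) = s.
Proof. by move=> eK; rewrite spine_enc_seq mapK. Qed.

Lemma cert_gausses_onto (s : seq (int * int)) : exists t, cert_gausses t = s.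
Proof.
exists (enc_seq (fun z => Node (Enc_int z.1) (Enc_int z.2)) s); apply: spine_onto => -[a b].
by rewrite /cert_gauss /= !cert_int_onto.
Qed.

Lemma cert_towers_onto (s : seq (seq (seq int))) : exists t, cert_towers t = s.
Proof.
exists (enc_seq (enc_seq (enc_seq Enc_int)) s); apply: spine_onto => w.
by apply: spine_onto => v; apply: spine_onto; apply: cert_int_onto.
Qed.

(** Iterated from the empty list, this yields all trees of bounded height. *)
Definition next_level (l : seq tree) : seq tree :=
  Leaf :: foldr (fun a r => foldr (fun b r => Node a b :: r) r l) [::] l.

Lemma comp_next_level : computable next_level.
Proof. by rewrite /next_level; comp. Qed.

Lemma has_next_level (P : pred tree) l :
  has P (next_level l) = P Leaf || has (fun a => has (fun b => P (Node a b)) l) l.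
Proof.
rewrite /next_level /=; congr (_ || _).
have inner a m r : has P (foldr (fun b r => Node a b :: r) r m) =
    has (fun b => P (Node a b)) m || has P r.
  by elim: m => //= b m ->; rewrite orbA.
elim: {2 4}l => //= a m IHm.
by rewrite inner IHm.
Qed.

Lemma has_level t : exists k0, forall k, (k0 <= k)%N -> forall P : pred tree, P t ->
  has P (iter k next_level [::]).
Proof.
elim: t => [|a [ka Ha] b [kb Hb]].
  by exists 1%N => -[//|k] _ P PL; rewrite iterS has_next_level PL.
exists (maxn ka kb).+1 => -[//|k]; rewrite ltnS geq_max => /andP[lea leb] P Pab.
rewrite iterS has_next_level; apply/orP; right.
by apply: (Ha k lea); apply: (Hb k leb).
Qed.

(** Generate the trees level by level until one passes the test, which happens
    because every tree occurs in all large enough levels. *)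
Lemma search_program (chk : tree -> tree -> bool) (ans : tree -> tree -> tree) :
    computable (fun p : tree * tree => chk p.1 p.2) ->
    computable (fun p : tree * tree => ans p.1 p.2) ->
  exists p, forall t, (exists c, chk t c) ->
    exists2 c, chk t c & eval p t (ans t c).
Proof.
move=> Hchk Hans.
have Htest : computable (fun s : tree * seq tree => all (fun c => ~~ chk s.1 c) s.2).
  apply: (comp_all (F := fun (s : tree * seq tree) c => ~~ chk s.1 c)); last by comp.
  apply: comp_negb.
  apply: (comp_comp (f := fun p : tree * seq tree * tree => (p.1.1, p.2)) _ Hchk).
  by comp.
have Hstep : computable (fun s : tree * seq tree => (s.1, next_level s.2)).
  by apply: comp_pair; [comp | apply: (comp_comp _ comp_next_level); comp].
pose pick (s : tree * seq tree) := foldr (fun c r => if chk s.1 c then c else r) Leaf s.2.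
have Hpick : computable pick.
  apply: (comp_foldr (F := fun (s : tree * seq tree) c r => if chk s.1 c then c else r));
    [|by comp|by comp].
  apply: comp_if; [|by comp|by comp].
  apply: (comp_comp (f := fun p : tree * seq tree * tree * tree => (p.1.1.1, p.1.2))
    _ Hchk).
  by comp.
have [pw Hpw] := eval_while Htest Hstep.
have [pi Hpi] : computable (fun t : tree => (t, [::] : seq tree)) by comp.
have [po Hpo] : computable (fun s : tree * seq tree => ans s.1 (pick s)).
  apply: (comp_comp (f := fun s : tree * seq tree => (s.1, pick s)) _ Hans).
  by apply: comp_pair => //; comp.
exists (PSeq pi (PSeq pw po)) => t [c chk_c].
have iterE k : iter k (fun s : tree * seq tree => (s.1, next_level s.2)) (t, [::])
    = (t, iter k next_level [::]).
  by elim: k => //= k ->.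
have ex : exists k, has (chk t) (iter k next_level [::]).
  by have [k0 H] := has_level c; exists k0; apply: H.
have [k Hk min_k] := ex_minnP ex.
pose l := iter k next_level [::].
exists (pick (t, l)).
  by rewrite /pick /=; move: Hk; rewrite -/l; elim: (l) => //= a m IHm; case: ifP.
apply: EvSeq (Hpi t) _; apply: (@EvSeq _ _ _ (enc (t, l))); last exact: (Hpo (t, l)).
rewrite -iterE; apply: Hpw => [j ltj|]; rewrite iterE /=.
  by rewrite all_predC; apply/negP => /min_k; rewrite leqNgt ltj.
by rewrite all_predC negbK.
Qed.

(** * Deciding whether the mean square exceeds 4 *)

Lemma input_minpoly_coefs (x : algC) (f : {poly rat}) :
    x \in Aint -> map_poly ratr f = minCpoly x ->
  minpoly_coefs [seq numq c | c <- f] x.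
Proof.
move=> Ax Df; have fK c : c \in (f : seq rat) -> (numq c)%:~R = ratr c :> algC.
  case/(nthP 0)=> i _ <-; move: Ax; rewrite unfold_in -Df => /polyOverP/(_ i).
  rewrite coef_map /= => /intrP[n Dn].
  have -> : f`_i = n%:~R.
    by apply: (fmorph_inj (ratr : {rmorphism rat -> algC})); rewrite /= Dn rmorph_int.
  by rewrite numq_int rmorph_int.
split; last by rewrite size_map -Df size_map_poly.
rewrite -Df; apply/polyP=> i; rewrite coef_map coef_map coef_Poly /=.
have [lti|gei] := ltnP i (size f); last by rewrite !nth_default ?size_map ?rmorph0.
by rewrite (nth_map 0) // fK // mem_nth.
Qed.

Lemma q_sum fs x : minpoly_coefs fs x ->
  \sum_(a <- conjugates x) `|a| ^+ 2 = (size fs).-1%:R * q x.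
Proof.
move=> fsx; rewrite q_conjugates (minpoly_coefs_degree fsx) mulrA divff ?mul1r //.
by rewrite pnatr_eq0 -lt0n (minpoly_coefs_degree_gt0 fsx).
Qed.

Lemma q_real x : q x \is Num.real.
Proof.
rewrite q_conjugates rpredM ?rpredV ?rpred_nat //.
by apply: rpred_sum => a _; rewrite rpredX // normr_real.
Qed.

Section Checks.
Context (fs : seq int) (x : algC) (fsx : minpoly_coefs fs x).
Let d := (size fs).-1.
Let S : algC := \sum_(a <- conjugates x) `|a| ^+ 2.
Let err (E : nat) : algC := (error_count fs)%:R / E%:R.
Let approx (m : nat) (zs : seq (int * int)) : algC := (gauss_sum zs)%:~R / m%:R ^+ 2.

Let S_real : S \is Num.real.
Proof. by apply: rpred_sum => a _; rewrite rpredX // normr_real. Qed.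

Let d0 : 0 < d%:R :> algC.
Proof. by rewrite ltr0n (minpoly_coefs_degree_gt0 fsx). Qed.

Let approx_real m zs : approx m zs \is Num.real.
Proof. by rewrite rpredM ?rpredV ?rpredX ?rpred_nat // Rreal_int. Qed.

Lemma isolates_interval E m zs : isolates fs E m zs ->
  S <= approx m zs + err E /\ approx m zs <= S + err E.
Proof.
move=> iso; have := isolates_sound fsx iso; rewrite -/S -/(approx m zs).
rewrite real_ler_distl ?rpredB // => /andP[h1 h2].
by split=> //; rewrite -lerBlDr.
Qed.

Let gap : nat := ((d * root_bound fs ^ 2 + 4 * d) ^ (d ^ d))%N.

Let gap0 : 0 < gap%:R :> algC.
Proof.
rewrite ltr0n expn_gt0 addn_gt0 (muln_gt0 4) /=.
by rewrite (minpoly_coefs_degree_gt0 fsx) orbT.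
Qed.

Lemma sum_le4E E m zs : sum_le4 fs E m zs =
  isolates fs E m zs && (approx m zs + err E < 4 * d%:R + gap%:R^-1).
Proof.
rewrite /sum_le4 -/d -/gap; case iso: isolates => //=.
have /and5P[E0 m0 _ _ _] := iso.
have E0' : 0 < E%:R :> algC by rewrite ltr0n.
have m0' : 0 < m%:R :> algC by rewrite ltr0n.
rewrite /approx /err; move: (gap) gap0 (error_count fs) => g g0 c.
have k0 : 0 < g%:R * (E%:R * m%:R ^+ 2) :> algC by rewrite !mulr_gt0 ?exprn_gt0.
rewrite -(ltr_int algC) -[RHS](ltr_pM2r k0); congr (_ < _).
  rewrite !(rmorphM, rmorphD) /= -!pmulrn ?(natrM, natrD, natrX).
  by field; rewrite !gt_eqF.
rewrite !rmorphM /= -!pmulrn ?(natrM, natrD, natrX).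
by field; rewrite !gt_eqF.
Qed.

Lemma sum_geE E m u v zs : (0 < v)%N -> isolates fs E m zs ->
  sum_ge fs E m u v zs = (2 * v < u)%N && (d%:R * (u%:R / v%:R) ^+ 2 + err E <= approx m zs).
Proof.
move=> v0 iso; rewrite /sum_ge iso v0 /=; congr (_ && _); rewrite -/d.
have /and5P[E0 m0 _ _ _] := iso.
have E0' : 0 < E%:R :> algC by rewrite ltr0n.
have m0' : 0 < m%:R :> algC by rewrite ltr0n.
have v0' : 0 < v%:R :> algC by rewrite ltr0n.
rewrite /approx /err; move: (error_count fs) => c.
have k0 : 0 < v%:R ^+ 2 * (E%:R * m%:R ^+ 2) :> algC by rewrite !mulr_gt0 ?exprn_gt0.
rewrite -(ler_int algC) -[RHS](ler_pM2r k0); congr (_ <= _).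
  rewrite -!pmulrn ?(natrM, natrD, natrX).
  by field; rewrite !gt_eqF.
rewrite !rmorphM /= -!pmulrn ?(natrM, natrD, natrX).
by field; rewrite !gt_eqF.
Qed.

(** Otherwise the sum of the [|a|^2] would exceed [4 d] by less than the gap. *)
Lemma sum_le4_sound E m zs : sum_le4 fs E m zs -> q x <= 4.
Proof.
rewrite sum_le4E => /andP[iso lt]; have [leS _] := isolates_interval iso.
have {leS lt} ltS := le_lt_trans leS lt.
rewrite -(ler_pM2l d0) -(q_sum fsx) -/S mulrC.
rewrite real_leNgt ?rpredM ?rpred_nat //; apply/negP => gtS.
have neq : S != (4 * d)%:R by rewrite natrM gt_eqF.
have := @conjugates_norm_gap x (root_bound fs) (minpoly_coefs_Aint fsx).
rewrite (minpoly_coefs_degree fsx) -/d => /(_ (conjugates_bound fsx) neq).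
rewrite -natrX -/gap -/S natrM ger0_norm ?subr_ge0 ?(ltW gtS) //.
rewrite real_leNgt ?real1 ?(rpredM, rpredB, rpred_nat) // => /negP[].
by rewrite -ltr_pdivlMr // mul1r ltrBlDl.
Qed.

Lemma sum_le4_complete : q x <= 4 -> exists E m zs, sum_le4 fs E m zs.
Proof.
rewrite -(ler_pM2l d0) -(q_sum fsx) -/S => leS.
have [E0 HE] := isolates_complete fsx.
pose E := (E0 + 2 * error_count fs * gap + 1)%N.
have [|m [zs iso]] := HE E; first by rewrite /E -addnA leq_addr.
exists E, m, zs; rewrite sum_le4E iso /=; have [_ leA] := isolates_interval iso.
have E0' : 0 < E%:R :> algC by rewrite ltr0n /E addn1.
apply: (@le_lt_trans _ _ (S + err E + err E)); first by rewrite lerD2r.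
rewrite -addrA; apply: ler_ltD; first by rewrite mulrC.
rewrite /err -mulrDl ltr_pdivrMr // mulrC ltr_pdivlMr // -natrD -natrM ltr_nat /E.
by rewrite addnn -mul2n -addnA addnC addn1 addSn ltnS leq_addr.
Qed.

Lemma sum_ge_sound E m u v zs : sum_ge fs E m u v zs ->
  [/\ (0 < v)%N, (2 * v < u)%N & (u%:R / v%:R) ^+ 2 <= q x].
Proof.
move=> ge; have /and4P[iso v0 uv _] := ge; split=> //.
move: ge; rewrite sum_geE // => /andP[_ le].
have [_ leA] := isolates_interval iso.
have := le_trans le leA; rewrite lerD2r /S (q_sum fsx).
by rewrite ler_pM2l.
Qed.

Lemma sum_ge_complete : 4 < q x -> exists E m u v zs, sum_ge fs E m u v zs.
Proof.
move=> q4; have q4' : 0 < q x - 4 by rewrite subr_gt0.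
(* [(2 + 1 / v) ^ 2 = 4 + 4 / v + 1 / v ^ 2 <= 4 + 5 / v]. *)
pose v := (Num.bound (5 / (q x - 4))).+1; pose u := (2 * v).+1.
have v0' : 0 < v%:R :> algC by rewrite ltr0n.
have ltq : (u%:R / v%:R) ^+ 2 < q x.
  have lt5 : 5 / v%:R < q x - 4.
    rewrite ltr_pdivrMr // mulrC -ltr_pdivrMr //.
    apply: lt_trans (archi_boundP _) _; last by rewrite ltr_nat.
    by rewrite divr_ge0 ?ler0n // ltW.
  apply: (@le_lt_trans _ _ (4 + 5 / v%:R)); last by rewrite -ltrBrDl.
  have -> : (u%:R / v%:R) ^+ 2 = 4 + 4 / v%:R + v%:R^-1 * v%:R^-1 :> algC.
    by rewrite /u -natr1 natrM; field; rewrite gt_eqF.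
  have -> : 4 + 5 / v%:R = 4 + 4 / v%:R + v%:R^-1 :> algC by ring.
  by rewrite lerD2l ger_pMr ?invr_gt0 // invf_le1 // ler1n.
set rho := _ ^+ 2 in ltq; have rho_real : rho \is Num.real.
  by rewrite rpredX ?rpredM ?rpredV ?rpred_nat.
pose del := S - d%:R * rho.
have del0 : 0 < del by rewrite subr_gt0 /S (q_sum fsx) ltr_pM2l.
have [E0 HE] := isolates_complete fsx.
pose E := (E0 + (Num.bound ((error_count fs)%:R *+ 2 / del)).+1)%N.
have [|m [zs iso]] := HE E; first by rewrite /E leq_addr.
have E0' : 0 < E%:R :> algC by rewrite ltr0n /E addnS.
exists E, m, u, v, zs; rewrite sum_geE //; apply/andP; split=> //.
have [leS _] := isolates_interval iso; rewrite -(lerD2r (err E)).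
apply: le_trans leS; rewrite -addrA -lerBrDl -/del /err -mulrDl -mulr2n.
rewrite ler_pdivrMr // [leRHS]mulrC -ler_pdivrMr //.
apply: (le_trans (ltW (archi_boundP _))).
  by rewrite divr_ge0 ?mulrn_wge0 ?ler0n // ltW.
by rewrite ler_nat /E addnS ltnW // ltnS leq_addl.
Qed.

End Checks.

(** * The algorithm *)

Lemma is_primeE p : is_prime p = prime p.
Proof.
apply/idP/primeP => [/andP[p1 /allP H]|[p1 H]].
  split=> // a /dvdnP[b Dp]; rewrite -[xpred2 _ _ _]negbK negb_or; apply/negP => /andP[a1 ap].
  have p0 : (0 < p)%N by apply: ltnW.
  have lta : (a < p)%N by rewrite ltn_neqAle ap dvdn_leq // Dp dvdn_mull.
  have ltb : (b < p)%N.
    rewrite ltn_neqAle dvdn_leq ?Dp ?dvdn_mulr // -?Dp // andbT.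
    apply: contraNneq a1 => bp; move: Dp; rewrite bp => /eqP.
    by rewrite -{1}[p]muln1 eqn_pmul2l // => /eqP <-.
  have := H b; rewrite mem_iota add0n => /(_ ltb)/allP/(_ a).
  by rewrite mem_iota add0n => /(_ lta); rewrite -Dp eqxx.
rewrite /is_prime p1; apply/allP => a; rewrite mem_iota add0n => /= lta.
apply/allP => b; rewrite mem_iota add0n => /= ltb; apply/eqP => Dp.
have dvd_ap : (a %| p)%N by rewrite -Dp dvdn_mulr.
have /orP[/eqP a1|/eqP ap] := H a dvd_ap; last by rewrite ap ltnn in lta.
by rewrite a1 mul1n in Dp; rewrite Dp ltnn in ltb.
Qed.

Lemma coefs_evalE fs k : coefs_eval fs k = (Poly fs).[k].
Proof.
rewrite (@horner_coef_wide _ (size fs)) ?size_Poly // /coefs_eval big_mkord.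
by apply: eq_bigr => i _; rewrite coef_Poly.
Qed.

Section Final.
Context (fs : seq int) (x : algC) (fsx : minpoly_coefs fs x).

Lemma exact_prime_sound p r k e : exact_prime fs p r k e ->
  exists n0 : int, [/\ prime p,
    \prod_(a <- conjugates x) (a - k%:~R) = n0%:~R,
    (p%:Z %| n0)%Z & ~~ ((p ^ 2)%:Z %| n0)%Z].
Proof.
case/and4P; rewrite is_primeE => pr_p r0 rp /eqP Dk.
exists ((-1) ^+ (size fs).-1 * coefs_eval fs k); split=> //.
- rewrite rmorphM rmorphXn rmorphN1 coefs_evalE -[X in _ * X]horner_map /=.
  rewrite -[map_poly _ _]/(intpoly fs) fsx.1 minCpoly_conjugates horner_prod.
  rewrite -(minpoly_coefs_degree fsx).
  have -> : (-1) ^+ size (conjugates x) = \prod_(a <- conjugates x) (-1) :> algC.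
    by rewrite big_const_seq count_predT iter_mulr_1.
  by rewrite -big_split; apply: eq_bigr => a _; rewrite hornerXsubC /=; ring.
- by rewrite Dk dvdz_mull // dvdz_mulr.
have p0 : p%:Z != 0 by rewrite eqz_nat -lt0n prime_gt0.
have -> y : ((p ^ 2)%:Z %| (-1) ^+ (size fs).-1 * y)%Z = ((p ^ 2)%:Z %| y)%Z.
  by rewrite !dvdzE abszM abszX exp1n mul1n.
rewrite Dk (_ : (p ^ 2)%N%:Z = p%:Z * p%:Z); last by rewrite -PoszM.
rewrite dvdz_mul2l // (rpredDl _ (dvdz_mulr _ (dvdzz _))).
by rewrite dvdzE /= gtnNdvd.
Qed.

Lemma exact_prime_complete : exists p r k e, exact_prime fs p r k e.
Proof.
have sepF : separable_poly (map_poly intr (Poly fs) : {poly rat}).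
  have := minCpoly_separable x; rewrite -fsx.1 /intpoly.
  rewrite (_ : map_poly _ _ = map_poly ratr (map_poly intr (Poly fs) : {poly rat})).
    by rewrite separable_map.
  by rewrite -map_poly_comp; apply: eq_map_poly => n /=; rewrite rmorph_int.
have sF : (1 < size (Poly fs))%N.
  have := size_minCpoly x; rewrite -fsx.1 /intpoly size_map_inj_poly //.
  exact: intr_inj.
have [p [k [pr_p /dvdzP[c Dc] p2]]] := exact_prime_value sF sepF.
have p0 : p%:Z != 0 by rewrite eqz_nat -lt0n prime_gt0.
exists p, (absz (c %% p)%Z), k, (c %/ p)%Z; apply/and4P; split.
- by rewrite is_primeE.
- rewrite absz_gt0; apply: contra p2 => /eqP/dvdz_mod0P/dvdzP[b Db].
  by rewrite Dc Db -mulrA -PoszM mulnn dvdz_mull.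
- by rewrite -ltz_nat gez0_abs ?modz_ge0 // ltz_pmod // ltz_nat prime_gt0.
rewrite coefs_evalE Dc mulrC gez0_abs ?modz_ge0 //; apply/eqP; congr (_ * _).
by rewrite [p%:Z * _]mulrC -divz_eq.
Qed.

Lemma distinct_towersE n p u v k wss : distinct_towers fs n p u v k wss =
  [&& size wss == n, uniq (map size wss) & all (good_tower fs p k u v) wss].
Proof.
rewrite /distinct_towers; have [Dn|//] := eqVneq (size wss) n; congr [&& _, _ & _].
rewrite -Dn; apply/idP/(uniqP 0%N) => [/allP H i j|inj].
  rewrite !inE size_map => lti ltj; rewrite !(nth_map [::]) // => eij.
  have := H i; rewrite mem_iota add0n => /(_ lti)/allP/(_ j).
  by rewrite mem_iota add0n => /(_ ltj); rewrite eij eqxx orbF => /eqP.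
apply/allP => i; rewrite mem_iota add0n => /= lti; apply/allP => j.
rewrite mem_iota add0n => /= ltj; have [//|ne] := eqVneq i j.
apply: contra ne => /eqP eij; apply/eqP/inj; rewrite ?inE ?size_map //.
by rewrite !(nth_map [::]).
Qed.

(** Choose the towers one after the other, each larger than all previous ones. *)
Lemma distinct_towers_complete n p u v k : (0 < p)%N -> (0 < v)%N -> (2 * v < u)%N ->
  exists wss, distinct_towers fs n p u v k wss.
Proof.
move=> p0 v0 uv; suff [wss H] : exists wss,
    [&& size wss == n, uniq (map size wss) & all (good_tower fs p k u v) wss].
  by exists wss; rewrite distinct_towersE.
elim: n => [|n [wss /and3P[/eqP sz un good]]]; first by exists [::].
have [ws le_ws good_ws] := good_tower_exists (\sum_(w <- wss) size w).+1 k fsx p0 v0 uv.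
exists (ws :: wss); rewrite /= sz eqxx un good good_ws !andbT.
apply/mapP => -[w ww e]; move: le_ws; rewrite e ltnNge.
by rewrite (big_rem w) //= leq_addr.
Qed.

End Final.

Lemma check_cases t c : check t c ->
  let fs := read_coefs t in
  (exists E m zs, sum_le4 fs E m zs /\ answer t c = Leaf) \/
  (exists E m u v zs p r k e wss,
    [/\ sum_ge fs E m u v zs, exact_prime fs p r k e,
        distinct_towers fs (read_count t) p u v k wss &
        answer t c = Node Leaf (list_tree [seq write_poly (tower fs p k ws) | ws <- wss])]).
Proof.
rewrite /check /answer; case: is_node => /= [/and3P[H1 H2 H3]|H]; [right|left].
  by do 10!eexists; split; [exact: H1 | exact: H2 | exact: H3 |].
by do 3!eexists; split; [exact: H |].
Qed.

Theorem theorem14p10 :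
  exists p : prog,
  forall (n : nat) (alpha : algC) (f : {poly rat}),
    alpha \in Aint -> map_poly ratr f = minCpoly alpha ->
    (4 < q alpha ->
       exists ds : seq (algC * algC),
         [/\ size ds = n,
             forall d, d \in ds -> dec alpha d /\ nontrivial_dec d,
             uniq [seq minpoly_over alpha d.1 | d <- ds]
           & eval p (enc_input n f)
               (enc_output (Some [seq minpoly_over alpha d.1 | d <- ds]))]) /\
    (~~ (4 < q alpha) -> eval p (enc_input n f) (enc_output None)).
Proof.
have [P HP] := search_program comp_check comp_answer.
exists P => n x f Ax Df; set t := enc_input n f.
set fs := [seq numq c | c <- f]; have fsx : minpoly_coefs fs x by apply: input_minpoly_coefs.
have Dfs : read_coefs t = fs by apply: read_coefs_input.
have Dn : read_count t = n by apply: read_count_input.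
have gt4 E m u v zs : sum_ge fs E m u v zs -> 4 < q x.
  case/(sum_ge_sound fsx) => v0 uv; apply: lt_le_trans.
  have v0' : 0 < v%:R :> algC by rewrite ltr0n.
  rewrite (_ : 4 = 2 ^+ 2 :> algC); last by rewrite -natrX.
  rewrite ltr_sqr_nneg ?divr_ge0 ?ler0n // ltr_pdivlMr // -natrM ltr_nat //.
have ex : exists c, check t c.
  have [q4|] := boolP (4 < q x); last first.
    rewrite -real_leNgt ?q_real ?rpred_nat // => /(sum_le4_complete fsx)[E [m [zs H]]].
    have [tz Dz] := cert_gausses_onto zs.
    exists (Node Leaf (Node (Node (unary E) (unary m)) (Node tz Leaf))).
    by rewrite /check /= Dfs !cert_nat_onto Dz.
  have [E [m [u [v [zs H]]]]] := sum_ge_complete fsx q4.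
  have [v0 uv _] := sum_ge_sound fsx H.
  have [p [r [k [e Hp]]]] := exact_prime_complete fsx.
  have [n0 [pr_p _ _ _]] := exact_prime_sound fsx Hp.
  have [wss Hw] := distinct_towers_complete fsx n k (prime_gt0 pr_p) v0 uv.
  have [tz Dz] := cert_gausses_onto zs; have [tw Dw] := cert_towers_onto wss.
  exists (Node (Node Leaf Leaf) (Node (Node (unary E) (unary m)) (Node tz
    (Node (Node (unary u) (unary v)) (Node (Node (unary p) (unary r))
      (Node (Node (Enc_int k) (Enc_int e)) tw)))))).
  by rewrite /check /= Dfs Dn !cert_nat_onto !cert_int_onto Dz Dw H Hp Hw.
have [c chk_c ev] := HP t ex; have := check_cases chk_c; rewrite /= Dfs Dn.
move=> [[E [m [zs [le4 ans]]]]|].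
  rewrite ans in ev; split=> // q4; have := sum_le4_sound fsx le4.
  by move/(lt_le_trans q4); rewrite ltxx.
move=> [E [m [u [v [zs [p [r [k [e [wss [ge Hp Hw ans]]]]]]]]]]].
have q4 := gt4 _ _ _ _ _ ge; split=> [_|]; last by rewrite q4.
have [v0 uv leq] := sum_ge_sound fsx ge.
have [n0 [pr_p normk pn0 p2n0]] := exact_prime_sound fsx Hp.
move: Hw; rewrite distinct_towersE => /and3P[/eqP szw un /allP good].
have u0 : (0 < u)%N by apply: leq_trans uv.
have /choice[g Dg] : forall ws, exists d : algC * algC, ws \in wss ->
    (dec x d /\ nontrivial_dec d) /\
    minpoly_over x d.1 = [seq [seq c%:~R | c <- v] | v <- tower fs p k ws].
  move=> ws; have [/good/and3P[ws2 ws_size small]|] := boolP (ws \in wss);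
    last by exists (0, 0).
  have [d Hd Dd] := tower_dec fsx ws2 ws_size pr_p normk pn0 p2n0 u0 v0 small leq.
  by exists d.
have outE : [seq minpoly_over x d.1 | d <- map g wss] =
    [seq [seq [seq c%:~R | c <- v] | v <- tower fs p k ws] | ws <- wss].
  by rewrite -map_comp; apply/eq_in_map => ws /Dg[].
exists (map g wss); split.
- by rewrite size_map.
- by move=> _ /mapP[ws /Dg[H _] ->].
- rewrite outE; have := un; rewrite -(map_inj_uniq succn_inj) -map_comp.
  have -> : map (succn \o size) wss =
      map size [seq [seq [seq c%:~R : rat | c <- v] | v <- tower fs p k ws] | ws <- wss].
    rewrite -map_comp; apply/eq_in_map => ws /good/and3P[ws2 _ _].
    by rewrite -[LHS](size_tower fs p k ws2) /comp size_map.
  exact: map_uniq.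
rewrite outE; rewrite ans in ev; move: ev; rewrite list_treeE /enc_output /= enc_seq_map.
by rewrite (eq_enc_seq _ (fun ws => write_polyE (tower fs p k ws))).
Qed.
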